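(* Every polynomial identity of degree $\le 7$ satisfied by the bilinear operation $[x,y]=\alpha(x\wedge y)$ on the $\mathfrak{sl}(2,\mathbb{C})$-module $V(6)$ is a consequence of the defining identities for Malcev algebras, $$[a,b]+[b,a]\equiv 0,$$ $$[[[a,c],b],d]+[[[d,a],c],b]+[[[c,b],d],a]+[[[b,d],a],c]-[[a,b],[c,d]]\equiv 0,$$ and the 18-term identity $k(a,b,c,d,e)\equiv0$ of degree 5, where, writing $[x,y]$ as juxtaposition $xy$, $$\begin{aligned} k(a,b,c,d,e)={}&-(((ab)c)e)d+(((ab)e)d)c+(((ac)b)d)e-(((ac)d)e)b\\ &-(((ad)b)c)e-(((ad)c)b)e+(((ae)b)c)d+(((ae)c)b)d\\ &+(((bd)c)a)e-(((be)a)d)c+(((be)c)d)a-(((be)d)a)c\\ &+(((cd)a)e)b-(((cd)b)e)a+(((cd)e)a)b-(((ce)b)a)d\\ &+((ab)c)(de)+((ac)b)(de). \end{aligned}$$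
   Context: $V(6)$ is the 7-dimensional irreducible $\mathfrak{sl}(2,\mathbb{C})$-module with basis $v_6,v_4,v_2,v_0,v_{-2},v_{-4},v_{-6}$ of $H$-eigenvectors, where $H\cdot v_{6-2i}=(6-2i)v_{6-2i}$, $E\cdot v_{6-2i}=(7-i)v_{6-2(i-1)}$, $F\cdot v_{6-2i}=(i+1)v_{6-2(i+1)}$ (with $v_8=v_{-8}=0$). The map $\alpha\colon\Lambda^2V(6)\to V(6)$ is the (unique up to nonzero scalar) nonzero $\mathfrak{sl}(2,\mathbb{C})$-module morphism, normalized so that $[x,y]=\alpha(x\wedge y)$ is the anticommutative product with $[v_6,v_0]=20v_6$, $[v_6,v_{-2}]=10v_4$, $[v_6,v_{-4}]=4v_2$, $[v_6,v_{-6}]=v_0$, $[v_4,v_2]=-60v_6$, $[v_4,v_0]=-20v_4$, $[v_4,v_{-4}]=6v_0$, $[v_4,v_{-6}]=4v_{-2}$, $[v_2,v_0]=-20v_2$, $[v_2,v_{-2}]=-15v_0$, $[v_2,v_{-6}]=10v_{-4}$, $[v_0,v_{-2}]=-20v_{-2}$, $[v_0,v_{-4}]=-20v_{-4}$, $[v_0,v_{-6}]=20v_{-6}$, $[v_{-2},v_{-4}]=-60v_{-6}$, and all other products $[v_p,v_q]$ with $p>q$ equal to $0$. A polynomial identity of degree $\le n$ is a nonassociative polynomial over $\mathbb{C}$ of degree $\le n$ in the given operation which vanishes for all substitutions of elements of the algebra for the variables. An identity is a consequence of a set of identities if it is satisfied by every algebra over $\mathbb{C}$ (with an operation of the given kind)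 that satisfies all identities in the set. *)

(* Defs.v *)
From HB Require Import structures.
From mathcomp Require Import all_boot all_order all_algebra.
From mathcomp Require Import finmap monalg ring.
From mathcomp Require Export reals complex.

Set Implicit Arguments.
Unset Strict Implicit.
Unset Printing Implicit Defensive.

Import Order.TTheory GRing.Theory Num.Theory.
Local Open Scope ring_scope.

(* Nonassociative monomials. *)
Inductive word : Type := Var of nat | Mul of word & word.

Fixpoint word_encode (w : word) : GenTree.tree nat :=
  match w with
  | Var n => GenTree.Leaf n
  | Mul u v => GenTree.Node 0 [:: word_encode u; word_encode v]
  end.

Fixpoint word_decode (t : GenTree.tree nat) : option word :=
  match t with
  | GenTree.Leaf n => Some (Var n)
  | GenTree.Node 0 [:: t1; t2] =>
      if (word_decode t1, word_decode t2) is (Some u, Some v)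
      then Some (Mul u v) else None
  | _ => None
  end.

Lemma word_encodeK : pcancel word_encode word_decode.
Proof. by elim=> //= u -> v ->. Qed.

HB.instance Definition _ := Choice.copy word (pcan_type word_encodeK).

Fixpoint word_degree (w : word) : nat :=
  match w with
  | Var _ => 1
  | Mul u v => word_degree u + word_degree v
  end.

(* Elements of the free nonassociative algebra on countably many variables:
   finitely supported functions from nonassociative words to K. *)
Notation napoly K := {malg K[word]}.

Definition napoly_degree (K : fieldType) (f : napoly K) : nat :=
  (\max_(w <- msupp f) word_degree w)%N.

Section Identities.

Variable K : fieldType.

Fixpoint word_eval (A : Type) (mul : A -> A -> A) (s : nat -> A) (w : word) : A :=
  match w with
  | Var n => s n
  | Mul u v => mul (word_eval mul s u) (word_eval mul s v)
  end.

Definition napoly_eval (A : lmodType K) (mul : A -> A -> A) (s : nat -> A)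
    (f : napoly K) : A :=
  \sum_(w <- msupp f) f@_w *: word_eval mul s w.

Definition identity_of (A : lmodType K) (mul : A -> A -> A) (f : napoly K) : Prop :=
  forall s : nat -> A, napoly_eval mul s f = 0.

Definition consequence (S : napoly K -> Prop) (f : napoly K) : Prop :=
  forall (A : lmodType K) (mul : {bilinear A -> A -> A}),
    (forall g, S g -> identity_of mul g) -> identity_of mul f.

Let a := Var 0.
Let b := Var 1.
Let c := Var 2.
Let d := Var 3.
Let e := Var 4.

Local Notation "x ∙ y" := (Mul x y) (at level 40, left associativity).

Definition anticomm_id : napoly K := << a ∙ b >> + << b ∙ a >>.

Definition malcev_id : napoly K :=
  << a ∙ c ∙ b ∙ d >> + << d ∙ a ∙ c ∙ b >> + << c ∙ b ∙ d ∙ a >>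
  + << b ∙ d ∙ a ∙ c >> - << (a ∙ b) ∙ (c ∙ d) >>.

Definition k_id : napoly K :=
  - << a ∙ b ∙ c ∙ e ∙ d >> + << a ∙ b ∙ e ∙ d ∙ c >>
  + << a ∙ c ∙ b ∙ d ∙ e >> - << a ∙ c ∙ d ∙ e ∙ b >>
  - << a ∙ d ∙ b ∙ c ∙ e >> - << a ∙ d ∙ c ∙ b ∙ e >>
  + << a ∙ e ∙ b ∙ c ∙ d >> + << a ∙ e ∙ c ∙ b ∙ d >>
  + << b ∙ d ∙ c ∙ a ∙ e >> - << b ∙ e ∙ a ∙ d ∙ c >>
  + << b ∙ e ∙ c ∙ d ∙ a >> - << b ∙ e ∙ d ∙ a ∙ c >>
  + << c ∙ d ∙ a ∙ e ∙ b >> - << c ∙ d ∙ b ∙ e ∙ a >>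
  + << c ∙ d ∙ e ∙ a ∙ b >> - << c ∙ e ∙ b ∙ a ∙ d >>
  + << (a ∙ b ∙ c) ∙ (d ∙ e) >> + << (a ∙ c ∙ b) ∙ (d ∙ e) >>.

Lemma napoly_eval_supp (A : lmodType K) (mul : A -> A -> A) s (D : {fset word})
    (f : napoly K) :
  (msupp f `<=` D)%fset ->
  napoly_eval mul s f = \sum_(w <- D) f@_w *: word_eval mul s w.
Proof.
move=> fD; rewrite /napoly_eval (big_fset_incl _ fD) //= => w _.
by move/mcoeff_outdom => ->; rewrite scale0r.
Qed.

Lemma napoly_evalU (A : lmodType K) (mul : A -> A -> A) s w :
  napoly_eval mul s << w >> = word_eval mul s w.
Proof.
by rewrite (napoly_eval_supp _ _ msuppU_le) big_seq_fset1 mcoeffUU scale1r.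
Qed.

Lemma napoly_evalD (A : lmodType K) (mul : A -> A -> A) s (f g : napoly K) :
  napoly_eval mul s (f + g) = napoly_eval mul s f + napoly_eval mul s g.
Proof.
rewrite (napoly_eval_supp _ _ (msuppD_le f g)).
rewrite (napoly_eval_supp _ _ (fsubsetUl _ (msupp g))).
rewrite (napoly_eval_supp _ _ (fsubsetUr (msupp f) _)) -big_split /=.
by apply: eq_bigr => w _; rewrite mcoeffD scalerDl.
Qed.

Lemma napoly_evalN (A : lmodType K) (mul : A -> A -> A) s (f : napoly K) :
  napoly_eval mul s (- f) = - napoly_eval mul s f.
Proof.
rewrite /napoly_eval msuppN -sumrN.
by apply: eq_bigr => w _; rewrite mcoeffN scaleNr.
Qed.

Lemma anticomm_idP (A : lmodType K) (mul : A -> A -> A) :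
  identity_of mul anticomm_id <-> forall x y, mul x y + mul y x = 0.
Proof.
split=> [h x y|h s]; last by rewrite !(napoly_evalD, napoly_evalU) /= h.
by have := h (nth x [:: x; y]); rewrite !(napoly_evalD, napoly_evalU).
Qed.

Lemma malcev_idP (A : lmodType K) (mul : A -> A -> A) :
  identity_of mul malcev_id <->
  forall x y z t, let m := mul in
    m (m (m x z) y) t + m (m (m t x) z) y + m (m (m z y) t) x
    + m (m (m y t) x) z - m (m x y) (m z t) = 0.
Proof.
have E s : napoly_eval mul s malcev_id = let m := mul in
    m (m (m (s 0) (s 2)) (s 1)) (s 3) + m (m (m (s 3) (s 0)) (s 2)) (s 1)
    + m (m (m (s 2) (s 1)) (s 3)) (s 0) + m (m (m (s 1) (s 3)) (s 0)) (s 2)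
    - m (m (s 0) (s 1)) (m (s 2) (s 3)).
  rewrite /malcev_id 4!napoly_evalD napoly_evalN.
  by congr (_ + _ + _ + _ - _); apply: napoly_evalU.
split=> [h x y z t|h s]; last by rewrite E; apply: h.
by have := h (nth x [:: x; y; z; t]); rewrite E.
Qed.

Lemma k_idP (A : lmodType K) (mul : A -> A -> A) :
  identity_of mul k_id <->
  forall x y z t u, let m5 p q r s w := mul (mul (mul (mul p q) r) s) w in
    - m5 x y z u t + m5 x y u t z + m5 x z y t u - m5 x z t u y
    - m5 x t y z u - m5 x t z y u + m5 x u y z t + m5 x u z y t
    + m5 y t z x u - m5 y u x t z + m5 y u z t x - m5 y u t x z
    + m5 z t x u y - m5 z t y u x + m5 z t u x y - m5 z u y x t
    + mul (mul (mul x y) z) (mul t u) + mul (mul (mul x z) y) (mul t u) = 0.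
Proof.
have E s : napoly_eval mul s k_id =
    let m5 i j k l n :=
      mul (mul (mul (mul (s i) (s j)) (s k)) (s l)) (s n) in
    - m5 0 1 2 4 3 + m5 0 1 4 3 2 + m5 0 2 1 3 4 - m5 0 2 3 4 1
    - m5 0 3 1 2 4 - m5 0 3 2 1 4 + m5 0 4 1 2 3 + m5 0 4 2 1 3
    + m5 1 3 2 0 4 - m5 1 4 0 3 2 + m5 1 4 2 3 0 - m5 1 4 3 0 2
    + m5 2 3 0 4 1 - m5 2 3 1 4 0 + m5 2 3 4 0 1 - m5 2 4 1 0 3
    + mul (mul (mul (s 0) (s 1)) (s 2)) (mul (s 3) (s 4))
    + mul (mul (mul (s 0) (s 2)) (s 1)) (mul (s 3) (s 4)).
  rewrite /k_id 17!napoly_evalD.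
  by do 17?[congr (_ + _)]; rewrite ?napoly_evalN; try congr (- _);
    apply: napoly_evalU.
split=> [h x y z t u|h s]; last by rewrite E; apply: h.
by have := h (nth x [:: x; y; z; t; u]); rewrite E.
Qed.

End Identities.

Notation V6 K := 'rV[K]_7.

Section V6.

Variable K : fieldType.

Definition V6_wt (i : nat) : int := 6 - 2 * i%:Z.

(* The basis vector v_p; zero when p is not a weight, e.g. v_8 = v_{-8} = 0. *)
Definition V6_v (p : int) : V6 K := \row_(i < 7) (p == V6_wt i)%:R.

Local Notation v := V6_v.

(* The linear extensions of
     H v_{6-2i} = (6-2i) v_{6-2i},  E v_{6-2i} = (7-i) v_{6-2(i-1)},
     F v_{6-2i} = (i+1) v_{6-2(i+1)}. *)
Definition V6_H (x : V6 K) : V6 K :=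
  \sum_(i < 7) x 0 i *: ((V6_wt i)%:~R *: v (V6_wt i)).
Definition V6_E (x : V6 K) : V6 K :=
  \sum_(i < 7) x 0 i *: ((7 - i%:R) *: v (6 - 2 * (i%:Z - 1))).
Definition V6_F (x : V6 K) : V6 K :=
  \sum_(i < 7) x 0 i *: ((i%:R + 1) *: v (6 - 2 * (i%:Z + 1))).

(* For a bilinear map, the condition to factor through Lambda^2 V(6). *)
Definition alternating (alpha : V6 K -> V6 K -> V6 K) : Prop :=
  forall x, alpha x x = 0.

(* X acts on x /\ y by X x /\ y + x /\ X y. *)
Definition commutes_with_action (X : V6 K -> V6 K)
    (alpha : V6 K -> V6 K -> V6 K) : Prop :=
  forall x y, X (alpha x y) = alpha (X x) y + alpha x (X y).

Definition sl2_morphism (alpha : V6 K -> V6 K -> V6 K) : Prop :=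
  [/\ commutes_with_action V6_H alpha, commutes_with_action V6_E alpha
    & commutes_with_action V6_F alpha].

(* The entry ((p, q), u) stands for [v_p, v_q] = u. *)
Definition V6_table : seq ((int * int) * V6 K) :=
  [:: ((6, 0), 20 *: v 6);        ((6, -2), 10 *: v 4);
      ((6, -4), 4 *: v 2);        ((6, -6), v 0);
      ((4, 2), -60 *: v 6);       ((4, 0), -20 *: v 4);
      ((4, -4), 6 *: v 0);        ((4, -6), 4 *: v (-2));
      ((2, 0), -20 *: v 2);       ((2, -2), -15 *: v 0);
      ((2, -6), 10 *: v (-4));    ((0, -2), -20 *: v (-2));
      ((0, -4), -20 *: v (-4));   ((0, -6), 20 *: v (-6));
      ((-2, -4), -60 *: v (-6)) ].

(* The sum has one term when (p, q) is listed in the table, and is empty,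
   hence zero, otherwise. *)
Definition V6_normalized (alpha : V6 K -> V6 K -> V6 K) : Prop :=
  forall i j : 'I_7, (i < j)%N ->
    alpha (v (V6_wt i)) (v (V6_wt j)) =
      \sum_(t <- V6_table | t.1 == (V6_wt i, V6_wt j)) t.2.

Local Notation "x `_[ i ]" := (x 0 (inord i)) (at level 2, format "x `_[ i ]").

Let row7 (s : seq K) : V6 K := \row_(i < 7) s`_i.

Let row7_coord s k : (k < 7)%N -> (row7 s)`_[k] = s`_k.
Proof. by move=> ltk; rewrite mxE inordK. Qed.

Let v_coord p k : (k < 7)%N -> (v p)`_[k] = (p == V6_wt k)%:R.
Proof. by move=> ltk; rewrite mxE inordK. Qed.

Let eq_row7 (x : V6 K) s : (forall k, (k < 7)%N -> x`_[k] = s`_k) -> x = row7 s.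
Proof. by move=> h; apply/rowP => k; rewrite -(inord_val k) row7_coord ?h. Qed.

Let sum7 (M : nmodType) (f : 'I_7 -> M) : \sum_(i < 7) f i =
  f (inord 0) + f (inord 1) + f (inord 2) + f (inord 3) + f (inord 4)
  + f (inord 5) + f (inord 6).
Proof.
transitivity (\sum_(0 <= i < 7) f (inord i)).
  by rewrite big_mkord; apply: eq_bigr => i _; rewrite inord_val.
by rewrite !big_nat_recr // big_geq //= add0r.
Qed.

Let V6_HE x : V6_H x = row7
  [:: 6 * x`_[0]; 4 * x`_[1]; 2 * x`_[2]; 0; -2 * x`_[4]; -4 * x`_[5];
      -6 * x`_[6]].
Proof.
apply: eq_row7 => k ltk; rewrite /V6_H sum7 !inordK // !mxE !inordK //.
by move: k ltk => [|[|[|[|[|[|[|//]]]]]]] _ /=; rewrite /V6_wt; ring.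
Qed.

Let V6_EE x : V6_E x = row7
  [:: 6 * x`_[1]; 5 * x`_[2]; 4 * x`_[3]; 3 * x`_[4]; 2 * x`_[5]; x`_[6]; 0].
Proof.
apply: eq_row7 => k ltk; rewrite /V6_E sum7 !inordK // !mxE !inordK //.
by move: k ltk => [|[|[|[|[|[|[|//]]]]]]] _ /=; ring.
Qed.

Let V6_FE x : V6_F x = row7
  [:: 0; x`_[0]; 2 * x`_[1]; 3 * x`_[2]; 4 * x`_[3]; 5 * x`_[4]; 6 * x`_[5]].
Proof.
apply: eq_row7 => k ltk; rewrite /V6_F sum7 !inordK // !mxE !inordK //.
by move: k ltk => [|[|[|[|[|[|[|//]]]]]]] _ /=; ring.
Qed.

Lemma V6_HE_comm x : V6_H (V6_E x) - V6_E (V6_H x) = 2 *: V6_E x.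
Proof.
rewrite !(V6_HE, V6_EE, row7_coord) //; apply/rowP => k; rewrite !mxE.
by case: k => -[|[|[|[|[|[|[|//]]]]]]] _ /=; ring.
Qed.

Lemma V6_HF_comm x : V6_H (V6_F x) - V6_F (V6_H x) = -2 *: V6_F x.
Proof.
rewrite !(V6_HE, V6_FE, row7_coord) //; apply/rowP => k; rewrite !mxE.
by case: k => -[|[|[|[|[|[|[|//]]]]]]] _ /=; ring.
Qed.

Lemma V6_EF_comm x : V6_E (V6_F x) - V6_F (V6_E x) = V6_H x.
Proof.
rewrite !(V6_HE, V6_EE, V6_FE, row7_coord) //; apply/rowP => k; rewrite !mxE.
by case: k => -[|[|[|[|[|[|[|//]]]]]]] _ /=; ring.
Qed.

Definition minor2 (x y : V6 K) (i j : nat) : K :=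
  x`_[i] * y`_[j] - x`_[j] * y`_[i].

Definition V6_prod (x y : V6 K) : V6 K :=
  let D := minor2 x y in
  row7 [:: 20 * D 0%N 3%N - 60 * D 1%N 2%N; 10 * D 0%N 4%N - 20 * D 1%N 3%N;
           4 * D 0%N 5%N - 20 * D 2%N 3%N; D 0%N 6%N + 6 * D 1%N 5%N - 15 * D 2%N 4%N;
           4 * D 1%N 6%N - 20 * D 3%N 4%N; 10 * D 2%N 6%N - 20 * D 3%N 5%N;
           20 * D 3%N 6%N - 60 * D 4%N 5%N].

Let V6_prod_bilinear : bilinear_for *:%R *:%R V6_prod.
Proof.
split=> z c x y; apply/rowP => k; rewrite /V6_prod /minor2 /applyr !mxE.
  by case: k => -[|[|[|[|[|[|[|//]]]]]]] _ /=; ring.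
by case: k => -[|[|[|[|[|[|[|//]]]]]]] _ /=; ring.
Qed.

HB.instance Definition _ :=
  bilinear_isBilinear.Build K (V6 K) (V6 K) (V6 K) *:%R *:%R V6_prod
    V6_prod_bilinear.

Lemma V6_prod_alternating : alternating V6_prod.
Proof.
move=> x; apply/rowP => k; rewrite /V6_prod /minor2 !mxE.
by case: k => -[|[|[|[|[|[|[|//]]]]]]] _ /=; ring.
Qed.

Lemma V6_prod_sl2 : sl2_morphism V6_prod.
Proof.
split=> x y; rewrite !(V6_HE, V6_EE, V6_FE) /V6_prod /minor2;
  apply/rowP => k; rewrite !row7_coord // !mxE;
  by case: k => -[|[|[|[|[|[|[|//]]]]]]] _ /=; ring.
Qed.

Lemma V6_prod_normalized : V6_normalized V6_prod.
Proof.
move=> i j; rewrite /V6_prod /minor2 !v_coord // /V6_table unlock.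
by case: i => -[|[|[|[|[|[|[|//]]]]]]] ?; case: j => -[|[|[|[|[|[|[|//]]]]]]] ? //=;
  move=> _; apply/rowP => -[] [|[|[|[|[|[|[|//]]]]]]] ?; rewrite !mxE /=; ring.
Qed.

Lemma V6_prod_exists : exists alpha : {bilinear V6 K -> V6 K -> V6 K},
  [/\ alternating alpha, sl2_morphism alpha & V6_normalized alpha].
Proof.
exists V6_prod; split.
- exact: V6_prod_alternating.
- exact: V6_prod_sl2.
- exact: V6_prod_normalized.
Qed.

End V6.

(* Main.v *)
Require Import Defs.
From Stdlib Require Import NArith PArith.
From HB Require Import structures.
From mathcomp Require Import all_boot all_order all_algebra.
From mathcomp Require Import finmap monalg.
From mathcomp Require Import boolp functions zify ring.

(** A polynomial identity of degree at most 7 over a field of characteristic 0 is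
    equivalent to multilinear ones ([reduction_to_multilinear]).  So the theorem says
    that a combination f of multilinear words in n <= 7 letters that vanishes on V(6)
    also vanishes on every algebra A that satisfies anticommutativity, the Malcev
    identity and k = 0.

    After a rescaling of the weight vectors, V(6) with the given product is the space
    of traceless split octonions under the commutator ([alpha_oct_vec]): products of
    basis vectors are 0 or, up to sign, basis vectors times a power of 2.  Hence V(6)
    satisfies the three identities, which are checked on basis vectors
    ([satisfies_basis]), and so does the product algebra of A and V(6).

    Suppose that certain normal words span all multilinear words on the product of A
    and V(6), and that these normal words are linearly independent on V(6).  Write f
    as a combination of normal words on the product.  Projecting to V(6), where f
    vanishes, shows that all coefficients are 0; projecting to A, that f vanishes on A
    ([sym_vanishes]).  It remains to find normal words that span as a consequence of
    the three identities and are independent on V(6).  Both are done by computation.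

    In degree 7 there are 454 normal words, too many for a direct computation.  Pair
    the letters as (0 1), (2 3), (4 5), with 6 alone, and decompose functions into
    eigencomponents for the swaps of the pairs.  For a given pattern of signs, a word
    matters only through the super-word in which the two letters of a pair are
    identified, up to a sign, and at most 68 normal words remain.  Exchanging pairs
    reduces the 8 patterns to 4 ([killed_all]).

    All computations take place modulo 5.  For the spanning part, a table of normal
    forms for products of two normal words is obtained by Gaussian elimination from
    substitution instances of the three identities ([run_ok]); then every word is an
    integral combination of normal words modulo 5 times integral combinations of
    words ([spanned_word]).  A matrix that is the identity modulo 5 has nonzero
    determinant, so the error term can be removed ([nakayama], [sym_combination]).
    For independence, values of the normal words at well chosen tuples of basis
    vectors form a matrix of full rank modulo 5 ([independent_ok]). *)

Set Implicit Arguments.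
Unset Strict Implicit.
Unset Printing Implicit Defensive.
Import Order.TTheory GRing.Theory Num.Theory.

(** * Linear algebra modulo 5 on tries *)

(** The residues modulo 5, as a bare enumeration: all the computations below are
    repeated by the kernel, and a table lookup is the cheapest arithmetic. *)
Inductive F5 := f0 | f1 | f2 | f3 | f4.

Definition addF (x y : F5) : F5 :=
  match x with
  | f0 => match y with f0 => f0 | f1 => f1 | f2 => f2 | f3 => f3 | f4 => f4 end
  | f1 => match y with f0 => f1 | f1 => f2 | f2 => f3 | f3 => f4 | f4 => f0 end
  | f2 => match y with f0 => f2 | f1 => f3 | f2 => f4 | f3 => f0 | f4 => f1 end
  | f3 => match y with f0 => f3 | f1 => f4 | f2 => f0 | f3 => f1 | f4 => f2 end
  | f4 => match y with f0 => f4 | f1 => f0 | f2 => f1 | f3 => f2 | f4 => f3 end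
  end.

Definition mulF (x y : F5) : F5 :=
  match x with
  | f0 => f0
  | f1 => y
  | f2 => match y with f0 => f0 | f1 => f2 | f2 => f4 | f3 => f1 | f4 => f3 end
  | f3 => match y with f0 => f0 | f1 => f3 | f2 => f1 | f3 => f4 | f4 => f2 end
  | f4 => match y with f0 => f0 | f1 => f4 | f2 => f3 | f3 => f2 | f4 => f1 end
  end.

Definition oppF (x : F5) : F5 := mulF f4 x.

Definition invF (x : F5) : F5 :=
  match x with f0 => f0 | f1 => f1 | f2 => f3 | f3 => f2 | f4 => f4 end.

Definition signF (b : bool) : F5 := if b then f4 else f1.

(** The seven slots 0, 1, ..., 6 of a multilinear word are paired as (0 1), (2 3),
    (4 5), and 6 is alone.  Up to the swaps of the pairs only the letter of a slot
    matters: [La], [Lb], [Lc] for the pairs and [Ld] for slot 6.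

    A key is a letter followed by a super-word k.  It names a word spelled by k,
    and the leading letter tells the bracketing: [Lc] for the left-normed word,
    [Lb] and [La] for a product of two left-normed words whose right factor has
    length 2 and 3.  A product of at most seven letters has a factor of length at
    most 3, and anticommutativity puts it on the right. *)
Inductive letter := La | Lb | Lc | Ld.

Definition nat_of_letter (l : letter) : nat :=
  match l with La => 0 | Lb => 1 | Lc => 2 | Ld => 3 end.

Definition letter_of_nat (n : nat) : letter :=
  match n with 0 => La | 1 => Lb | 2 => Lc | _ => Ld end.

Lemma nat_of_letterK : cancel nat_of_letter letter_of_nat.
Proof. by case. Qed.

HB.instance Definition _ := Equality.copy letter (can_type nat_of_letterK).

Notation key := (seq letter).

Inductive trie (X : Type) :=
  | Leaf
  | Node of option X & trie X & trie X & trie X & trie X.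
Arguments Leaf {X}.

Definition trim_node X (o : option X) (a b c d : trie X) : trie X :=
  match o, a, b, c, d with
  | None, Leaf, Leaf, Leaf, Leaf => Leaf
  | _, _, _, _, _ => Node o a b c d
  end.

Fixpoint get X (k : key) (t : trie X) {struct t} : option X :=
  match t with
  | Leaf => None
  | Node o a b c d =>
    match k with
    | [::] => o
    | La :: k' => get k' a
    | Lb :: k' => get k' b
    | Lc :: k' => get k' c
    | Ld :: k' => get k' d
    end
  end.

Fixpoint single X (k : key) (x : X) : trie X :=
  match k with
  | [::] => Node (Some x) Leaf Leaf Leaf Leaf
  | La :: k' => Node None (single k' x) Leaf Leaf Leaf
  | Lb :: k' => Node None Leaf (single k' x) Leaf Leaf
  | Lc :: k' => Node None Leaf Leaf (single k' x) Leaf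
  | Ld :: k' => Node None Leaf Leaf Leaf (single k' x)
  end.

Fixpoint put X (k : key) (x : X) (t : trie X) {struct t} : trie X :=
  match t with
  | Leaf => single k x
  | Node o a b c d =>
    match k with
    | [::] => Node (Some x) a b c d
    | La :: k' => Node o (put k' x a) b c d
    | Lb :: k' => Node o a (put k' x b) c d
    | Lc :: k' => Node o a b (put k' x c) d
    | Ld :: k' => Node o a b c (put k' x d)
    end
  end.

Fixpoint entries X (t : trie X) (pre : key) (acc : seq (key * X)) : seq (key * X) :=
  match t with
  | Leaf => acc
  | Node o a b c d =>
    let acc' := entries a (La :: pre) (entries b (Lb :: pre)
      (entries c (Lc :: pre) (entries d (Ld :: pre) acc))) in
    match o with Some x => (rev pre, x) :: acc' | None => acc' end
  end.

(** The first key in lexicographic order.  The bracketings [La] and [Lb] come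
    before [Lc], so that elimination expresses every word by left-normed ones. *)
Fixpoint lead X (t : trie X) : option (key * X) :=
  match t with
  | Leaf => None
  | Node (Some x) _ _ _ _ => Some ([::], x)
  | Node None a b c d =>
    match lead a with
    | Some (k, x) => Some (La :: k, x)
    | None => match lead b with
    | Some (k, x) => Some (Lb :: k, x)
    | None => match lead c with
    | Some (k, x) => Some (Lc :: k, x)
    | None => match lead d with
    | Some (k, x) => Some (Ld :: k, x)
    | None => None
    end end end end
  end.

Notation vec := (trie F5).

Definition nz (x : F5) : option F5 := match x with f0 => None | _ => Some x end.

Fixpoint scale (x : F5) (v : vec) : vec :=
  match v with
  | Leaf => Leaf
  | Node o a b c d =>
    Node (match o with Some y => Some (mulF x y) | None => None end)
      (scale x a) (scale x b) (scale x c) (scale x d)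
  end.

Fixpoint axpy (x : F5) (u v : vec) : vec :=
  match u, v with
  | Leaf, _ => v
  | _, Leaf => scale x u
  | Node o a b c d, Node o' a' b' c' d' =>
    trim_node (match o with
        | None => o'
        | Some y => match o' with
                    | None => Some (mulF x y)
                    | Some z => nz (addF (mulF x y) z)
                    end
        end)
      (axpy x a a') (axpy x b b') (axpy x c c') (axpy x d d')
  end.

Fixpoint bind (v : vec) (f : key -> vec) (acc : vec) : vec :=
  match v with
  | Leaf => acc
  | Node o a b c d =>
    bind a (fun k => f (La :: k)) (bind b (fun k => f (Lb :: k))
      (bind c (fun k => f (Lc :: k)) (bind d (fun k => f (Ld :: k))
        (match o with Some x => axpy x (f [::]) acc | None => acc end))))
  end.

(** Reduction of a row by the pivots already found.  A row that exhausts the fuel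
    is dropped; losing a relation cannot make the result wrong. *)
Fixpoint insert (fuel : nat) (piv : trie vec) (r : vec) : trie vec :=
  match fuel with
  | 0 => piv
  | fuel'.+1 =>
    match lead r with
    | None => piv
    | Some (k, x) =>
      match get k piv with
      | Some q => insert fuel' piv (axpy (oppF x) q r)
      | None => put k (scale (invF x) r) piv
      end
    end
  end.

Definition normal (nf : trie vec) (k : key) : vec :=
  match get k nf with Some v => v | None => single k f1 end.

(** Back substitution.  The pivots come in increasing order of their keys and are
    treated from the last one, so the tail of a row [q] at [k], which is [k - q] up
    to the null rows, only meets keys whose normal form is known. *)
Definition solve (piv : trie vec) : trie vec :=
  foldr (fun kq nf =>
    put kq.1 (bind (scale f4 (axpy f4 (single kq.1 f1) kq.2)) (normal nf) Leaf) nf)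
    Leaf (entries piv [::] [::]).

(** * Products of words with paired letters *)

Definition mem_nat (x : nat) (s : seq nat) : bool := has (eqn x) s.

(** When the words on the slots [S] and [T] are juxtaposed, the pair j appears in
    the wrong order exactly if its odd slot is in [S] and its even slot in [T];
    putting it right costs the sign of the pair. *)
Definition crossing (eps : seq bool) (S T : seq nat) : bool :=
  let c j := [&& nth false eps j, mem_nat j.*2.+1 S & mem_nat j.*2 T] in
  c 0 (+) (c 1 (+) c 2).

(** A multilinear element on given slots, as a combination of keys.  The flag tells
    that the row was computed without leaving the range of the tables. *)
Record elt := Elt { slots : seq nat; row : vec; ok : bool }.

Definition left_normed (r : vec) : bool :=
  match r with Leaf => true | Node None Leaf Leaf _ Leaf => true | _ => false end.

Definition left_part X (r : trie X) : trie X :=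
  match r with Leaf => Leaf | Node _ _ _ c _ => c end.

Definition tag (n : nat) : letter := match n with 1 => Lc | 2 => Lb | _ => La end.

Section Mul.
Variables (eps : seq bool) (tb : trie vec).

(** The product of two combinations of normal words: every product of two normal
    words is looked up in the table of normal forms. *)
Definition mul0 (x y : elt) : elt :=
  let m := size (slots y) in
  Elt (slots x ++ slots y)
    (scale (signF (crossing eps (slots x) (slots y)))
      (bind (left_part (row x)) (fun k1 => bind (left_part (row y)) (fun k2 =>
        normal tb (tag m :: k1 ++ k2)) Leaf) Leaf))
    [&& ok x, ok y, left_normed (row x), left_normed (row y) & m <= 3].

Definition opp_elt (x : elt) : elt := Elt (slots x) (scale f4 (row x)) (ok x).

Definition mul (x y : elt) : elt :=
  if size (slots x) < size (slots y) then opp_elt (mul0 y x) else mul0 x y.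

Fixpoint evalw (args : seq elt) (w : word) : elt :=
  match w with
  | Var i => nth (Elt [::] Leaf false) args i
  | Mul u v => mul (evalw args u) (evalw args v)
  end.

Definition relation := seq (bool * word).

Fixpoint rel_row (args : seq elt) (R : relation) : vec * bool :=
  match R with
  | [::] => (Leaf, true)
  | (b, w) :: R' =>
    let x := evalw args w in
    let: (r, o) := rel_row args R' in
    (axpy (signF b) (row x) r, ok x && o)
  end.

End Mul.

(** * Rewriting products to normal words *)

Definition letter_of (x : nat) : letter := letter_of_nat x./2.

Definition content (k : key) : key :=
  nseq (count_mem La k) La ++ nseq (count_mem Lb k) Lb ++
  nseq (count_mem Lc k) Lc ++ nseq (count_mem Ld k) Ld.

Fixpoint subs (s : seq nat) (m : nat) : seq (seq nat * seq nat) :=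
  match s with
  | [::] => if m is 0 then [:: ([::], [::])] else [::]
  | x :: s' =>
    (if m is m'.+1 then [seq (x :: p.1, p.2) | p <- subs s' m'] else [::])
      ++ [seq (p.1, x :: p.2) | p <- subs s' m]
  end.

(** Splittings that differ by swaps of pairs give the same relation up to sign;
    this keeps the one whose first block takes the even slots first. *)
Definition low_first (p : seq nat * seq nat) : bool :=
  all (fun x => ~~ (odd x && mem_nat x.-1 p.2)) p.1.

Fixpoint parts (s : seq nat) (ms : seq nat) : seq (seq (seq nat)) :=
  match ms with
  | [::] => if s is [::] then [:: [::]] else [::]
  | m :: ms' =>
    flatten [seq [seq p.1 :: r | r <- parts p.2 ms'] | p <- subs s m & low_first p]
  end.

Local Notation "x ∙ y" := (Mul x y) (at level 40, left associativity).

Definition relA : relation :=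
  [:: (false, Var 0 ∙ Var 1); (false, Var 1 ∙ Var 0)].

Definition relJ : relation :=
  let a := Var 0 in let b := Var 1 in let c := Var 2 in let d := Var 3 in
  [:: (false, a ∙ c ∙ b ∙ d); (false, d ∙ a ∙ c ∙ b); (false, c ∙ b ∙ d ∙ a);
      (false, b ∙ d ∙ a ∙ c); (true, (a ∙ b) ∙ (c ∙ d))].

Definition relK : relation :=
  let a := Var 0 in let b := Var 1 in let c := Var 2 in let d := Var 3 in
  let e := Var 4 in
  [:: (true, a ∙ b ∙ c ∙ e ∙ d); (false, a ∙ b ∙ e ∙ d ∙ c);
      (false, a ∙ c ∙ b ∙ d ∙ e); (true, a ∙ c ∙ d ∙ e ∙ b);
      (true, a ∙ d ∙ b ∙ c ∙ e); (true, a ∙ d ∙ c ∙ b ∙ e);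
      (false, a ∙ e ∙ b ∙ c ∙ d); (false, a ∙ e ∙ c ∙ b ∙ d);
      (false, b ∙ d ∙ c ∙ a ∙ e); (true, b ∙ e ∙ a ∙ d ∙ c);
      (false, b ∙ e ∙ c ∙ d ∙ a); (true, b ∙ e ∙ d ∙ a ∙ c);
      (false, c ∙ d ∙ a ∙ e ∙ b); (true, c ∙ d ∙ b ∙ e ∙ a);
      (false, c ∙ d ∙ e ∙ a ∙ b); (true, c ∙ e ∙ b ∙ a ∙ d);
      (false, (a ∙ b ∙ c) ∙ (d ∙ e)); (false, (a ∙ c ∙ b) ∙ (d ∙ e))].

(** The substitution instances that suffice in each degree: an identity, and the
    lengths of the normal words substituted for its variables.  Most instances of
    anticommutativity are built into the order of the factors; the exception is a
    product of two words of equal length. *)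
Definition families (n : nat) : seq (relation * seq nat) :=
  match n with
  | 2 => [:: (relA, [:: 1; 1])]
  | 4 => [:: (relA, [:: 2; 2]); (relJ, [:: 1; 1; 1; 1])]
  | 5 => [:: (relJ, [:: 2; 1; 1; 1]); (relK, [:: 1; 1; 1; 1; 1])]
  | 6 => [:: (relA, [:: 3; 3]); (relJ, [:: 3; 1; 1; 1]); (relK, [:: 1; 1; 2; 1; 1])]
  | 7 => [:: (relJ, [:: 4; 1; 1; 1]); (relK, [:: 1; 1; 3; 1; 1]);
             (relK, [:: 3; 1; 1; 1; 1]); (relJ, [:: 3; 2; 1; 1])]
  | _ => [::]
  end.

Notation basis := (trie (seq key)).

Definition keys_of (N : basis) (c : key) : seq key :=
  match get (content c) N with Some l => l | None => [::] end.

Fixpoint choices (N : basis) (ss : seq (seq nat)) : seq (seq elt) :=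
  match ss with
  | [::] => [:: [::]]
  | s :: ss' =>
    let cs := choices N ss' in
    flatten [seq [seq Elt s (single (Lc :: k) f1) true :: c | c <- cs]
            | k <- keys_of N (map letter_of s)]
  end.

Definition relations (N : basis) (s : seq nat) : seq (relation * seq elt) :=
  flatten [seq flatten [seq [seq (f.1, c) | c <- choices N p] | p <- parts s f.2]
          | f <- families (size s)].

(** The bits of the mask select the relations that raise the rank.  The others
    would reduce to zero, at the cost of most of the computing time. *)
Fixpoint add_rels (eps : seq bool) (tb : trie vec) (rs : seq (relation * seq elt))
    (mask : positive) (piv : trie vec) : trie vec * positive :=
  match rs with
  | [::] => (piv, mask)
  | r :: rs' =>
    match mask with
    | xH => (piv, mask)
    | xO m => add_rels eps tb rs' m piv
    | xI m =>
      let: (v, o) := rel_row eps tb r.2 r.1 in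
      add_rels eps tb rs' m (if o then insert 500 piv v else piv)
    end
  end.

Definition add_normal_forms (nf tb : trie vec) : trie vec :=
  foldr (fun kv t => put kv.1 kv.2 t) tb (entries nf [::] [::]).

(** The normal words on [s] are the left-normed words x1 ... xn for which x1 ... x(n-1)
    is normal and which no relation rewrites. *)
Definition new_keys (N : basis) (tb : trie vec) (s : seq nat) : seq key :=
  flatten [seq [seq k <- [seq rcons k (letter_of x)
                         | x <- p.2, k <- keys_of N (map letter_of p.1)]
               | ~~ (if get (Lc :: k) tb is Some _ then true else false)]
          | p <- subs s (size s).-1 & low_first p].

Notation state := (trie vec * basis * positive)%type.

(** One round: from the relations on the slots [s], the normal forms of all products
    on these slots and the list of normal words.  All shorter words are already
    known, since the sets of slots come by increasing size. *)
Definition step (eps : seq bool) (st : state) (s : seq nat) : state :=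
  let: (tb, N, mask) := st in
  let c := content (map letter_of s) in
  if size s <= 1 then (tb, put c [:: map letter_of s] N, mask) else
  let: (piv, mask') := add_rels eps tb (relations N s) mask Leaf in
  let tb' := add_normal_forms (solve piv) tb in
  (tb', put c (new_keys N tb' s) N, mask').

(** Sets of slots up to swaps of pairs. *)
Definition canonical_sets (n : nat) : seq (seq nat) :=
  [seq p.1 | p <- subs (iota 0 7) n & low_first p].

Definition all_sets : seq (seq nat) :=
  flatten [seq canonical_sets n | n <- iota 1 7].

Definition run (eps : seq bool) (mask : positive) : state :=
  foldl (step eps) (Leaf, Leaf, mask) all_sets.

(** What the tables have to achieve is that products of normal words are combinations
    of normal words.  This is checked on the result of the computation. *)
Fixpoint key_set (ks : seq key) : trie unit :=
  match ks with [::] => Leaf | k :: ks' => put k tt (key_set ks') end.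

Fixpoint supported (v : vec) (t : trie unit) : bool :=
  match v with
  | Leaf => true
  | Node o a b c d =>
    match t with
    | Leaf => false
    | Node o' a' b' c' d' =>
      [&& (if o is Some _ then if o' is Some _ then true else false else true),
          supported a a', supported b b', supported c c' & supported d d']
    end
  end.

Definition contents : seq key := [seq content (map letter_of s) | s <- all_sets].

Definition mul_closed (tb : trie vec) (N : basis) : bool :=
  let cs := contents in
  all (fun l => [:: l] \in keys_of N [:: l]) [:: La; Lb; Lc; Ld] &&
  all (fun c1 => all (fun c2 =>
    if size c1 < size c2 then true else
    let c := content (c1 ++ c2) in
    if c \notin cs then true else
    let ks := key_set (keys_of N c) in
    all (fun k1 => all (fun k2 =>
      let r := normal tb (tag (size c2) :: k1 ++ k2) in
      left_normed r && supported (left_part r) ks)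
    (keys_of N c2)) (keys_of N c1)) cs) cs.

(** * Words and their spellings *)

Fixpoint letters (w : word) : seq nat :=
  match w with Var i => [:: i] | Mul u v => letters u ++ letters v end.

Fixpoint wmap (sigma : nat -> nat) (w : word) : word :=
  match w with Var i => Var (sigma i) | Mul u v => Mul (wmap sigma u) (wmap sigma v) end.

Lemma letters_wmap sigma w : letters (wmap sigma w) = map sigma (letters w).
Proof. by elim: w => //= u -> v ->; rewrite map_cat. Qed.

Lemma word_eval_wmap A (m : A -> A -> A) s sigma w :
  word_eval m s (wmap sigma w) = word_eval m (s \o sigma) w.
Proof. by elim: w => //= u -> v ->. Qed.

Lemma eq_word_eval A (m : A -> A -> A) s s' w :
  {in letters w, s =1 s'} -> word_eval m s w = word_eval m s' w.
Proof.
elim: w => [i|u IHu v IHv] /= H; first by apply: H; rewrite inE.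
by rewrite IHu ?IHv // => x xl; apply: H; rewrite mem_cat xl ?orbT.
Qed.

Definition left_comb (q : seq nat) : word :=
  if q is x :: q' then foldl (fun w y => Mul w (Var y)) (Var x) q' else Var 0.

Lemma left_comb_rcons q x : q != [::] -> left_comb (rcons q x) = Mul (left_comb q) (Var x).
Proof. by case: q => //= y q _; rewrite -cats1 foldl_cat. Qed.

Lemma letters_left_comb q : q != [::] -> letters (left_comb q) = q.
Proof.
elim/last_ind: q => // q x IH _; have [->|q0] := eqVneq q [::]; first by [].
by rewrite left_comb_rcons //= IH // cats1.
Qed.

Lemma wmap_left_comb sigma q : q != [::] -> wmap sigma (left_comb q) = left_comb (map sigma q).
Proof.
elim/last_ind: q => // q x IH _; have [->|q0] := eqVneq q [::]; first by [].
rewrite map_rcons !left_comb_rcons //= ?IH //.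
by rewrite -size_eq0 size_map size_eq0.
Qed.

Definition right_size (l : letter) : nat :=
  match l with La => 3 | Lb => 2 | Lc => 1 | Ld => 0 end.

(** The word named by the key [l :: k] once the super-word k is spelled by the
    slots [q]. *)
Definition tagged_word (l : letter) (q : seq nat) : word :=
  if l is Lc then left_comb q else
  let n := size q - right_size l in Mul (left_comb (take n q)) (left_comb (drop n q)).

Definition valid_tag (l : letter) (n : nat) : bool :=
  match l with La => 3 < n | Lb => 2 < n | Lc => 0 < n | Ld => false end.

Lemma tagged_cat m q q' : 0 < size q -> 0 < m <= 3 -> size q' = m ->
  tagged_word (tag m) (q ++ q') = Mul (left_comb q) (left_comb q').
Proof.
move=> q0 /andP [m0 m3] sq'; have q1 : q != [::] by rewrite -size_eq0 -lt0n.
case: m m0 m3 sq' => [|[|[|[|]]]] // _ _ sq'.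
- by case: q' sq' => [|x [|]] // _; rewrite cats1 /= left_comb_rcons.
- by rewrite /tagged_word /= size_cat sq' addnK take_size_cat // drop_size_cat.
- by rewrite /tagged_word /= size_cat sq' addnK take_size_cat // drop_size_cat.
Qed.

Lemma letters_tagged l q : valid_tag l (size q) -> letters (tagged_word l q) = q.
Proof.
case: l => //= H; last by rewrite letters_left_comb // -size_eq0 -lt0n.
  have sz : size (take (size q - 3) q) = size q - 3 by apply: size_takel; apply: leq_subr.
  rewrite !letters_left_comb ?cat_take_drop // -size_eq0 -lt0n ?size_drop ?sz /=; lia.
have sz : size (take (size q - 2) q) = size q - 2 by apply: size_takel; apply: leq_subr.
rewrite !letters_left_comb ?cat_take_drop // -size_eq0 -lt0n ?size_drop ?sz /=; lia.
Qed.

Lemma wmap_tagged sigma l q : valid_tag l (size q) ->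
  wmap sigma (tagged_word l q) = tagged_word l (map sigma q).
Proof.
case: l => //= H; last by rewrite wmap_left_comb // -size_eq0 -lt0n.
  have sz : size (take (size q - 3) q) = size q - 3 by apply: size_takel; apply: leq_subr.
  rewrite /tagged_word /= size_map !wmap_left_comb ?map_take ?map_drop // -size_eq0 -lt0n ?size_drop ?sz /=; lia.
have sz : size (take (size q - 2) q) = size q - 2 by apply: size_takel; apply: leq_subr.
rewrite /tagged_word /= size_map !wmap_left_comb ?map_take ?map_drop // -size_eq0 -lt0n ?size_drop ?sz /=; lia.
Qed.

Definition tau (j x : nat) : nat :=
  if x == j.*2 then j.*2.+1 else if x == j.*2.+1 then j.*2 else x.

Lemma tauK j : involutive (tau j).
Proof. by move=> x; rewrite /tau; repeat case: eqP => //; lia. Qed.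

Lemma tau_inj j : injective (tau j). Proof. exact: inv_inj (tauK j). Qed.

Lemma letter_of_tau j x : letter_of (tau j x) = letter_of x.
Proof.
rewrite /letter_of /tau; congr letter_of_nat.
by repeat case: eqP => //; lia.
Qed.

Definition good_slots (S : seq nat) : bool := uniq S && all (fun x => x < 7) S.

Lemma good_perm S S' : perm_eq S S' -> good_slots S -> good_slots S'.
Proof. by move=> p; rewrite /good_slots (perm_uniq p) (perm_all _ p). Qed.

Definition before (q : seq nat) (x y : nat) : bool :=
  [&& x \in q, y \in q & index x q < index y q].

(** In a standard list the two slots of a pair come in increasing order.  Every
    super-word has one standard spelling by a given set of slots, which makes keys
    stand for definite words. *)
Definition std (q : seq nat) : bool :=
  all (fun j => ~~ before q j.*2.+1 j.*2) (iota 0 3).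

Lemma stdP q j : std q -> j < 3 -> ~~ before q j.*2.+1 j.*2.
Proof. by move/allP => H j3; apply: H; rewrite mem_iota. Qed.

Lemma letter_of_eq x y : x < 7 -> y < 7 -> letter_of x = letter_of y -> x <> y ->
  exists2 j, j < 3 & (x = j.*2 /\ y = j.*2.+1) \/ (x = j.*2.+1 /\ y = j.*2).
Proof.
move=> x7 y7 E xy; exists x./2.
  by move: x7 y7 E xy; do 7?[case: x => [|x] //]; do 7?[case: y => [|y] //].
by move: x7 y7 E xy; do 7?[case: x => [|x] //]; do 7?[case: y => [|y] //]; auto.
Qed.

Lemma std_first q i j : good_slots q -> std q -> j < 3 -> i < size q ->
  j.*2 \in q -> nth 0 q i = j.*2.+1 ->
  index j.*2 q < i.
Proof.
move=> /andP [uq _] sq j3 iq jq E.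
have iE : index j.*2.+1 q = i by rewrite -E index_uniq.
have := stdP sq j3; rewrite /before jq -{1}E mem_nth //= iE -leqNgt leq_eqVlt.
case/orP => [/eqP e|//].
by have := nth_index 0 jq; rewrite e E; lia.
Qed.

(** At the first difference the two lists have the two slots of one pair, and the
    list with the odd one needs the even one earlier, where the lists agree. *)
Lemma std_inj q q' : good_slots q -> perm_eq q q' ->
  map letter_of q = map letter_of q' -> std q -> std q' -> q = q'.
Proof.
move=> gq pq E sq sq'; have gq' := good_perm pq gq.
have sz : size q = size q' := perm_size pq.
have key : forall p p' i, good_slots p -> good_slots p' -> size p = size p' -> p =i p' ->
  map letter_of p = map letter_of p' -> std p -> std p' -> i < size p ->
  forall j, j < 3 -> nth 0 p i = j.*2 -> nth 0 p' i = j.*2.+1 -> False.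
  move=> p p' i gp gp' szp mp Ep sp sp' ip j j3 pi pi'.
  have ip' : i < size p' by rewrite -szp.
  have jp' : j.*2 \in p' by rewrite -mp -pi mem_nth.
  have lt := std_first gp' sp' j3 ip' jp' pi'; set i' := index _ _ in lt.
  have i'p : i' < size p by apply: ltn_trans lt ip.
  have : letter_of (nth 0 p i') = letter_of j.*2.
    rewrite -(nth_map 0 La) // Ep (nth_map 0 La) -?szp //.
    by rewrite /i' nth_index.
  move: gp => /andP [up /allP p7].
  have ne : nth 0 p i' <> j.*2.
    by rewrite -pi => /eqP; rewrite nth_uniq // => /eqP; lia.
  move=> Ej; have lt7 : j.*2 < 7 by lia.
  case: (letter_of_eq (p7 _ (mem_nth 0 i'p)) lt7 Ej ne) => j' j'3 [[]|[]]; first by lia.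
  move=> e1 e2; have jj : j' = j by lia.
  rewrite {}jj in e1 e2 j'3.
  have := stdP sp j3; rewrite /before -{1}e1 mem_nth // -{1}pi mem_nth //=.
  have -> : index j.*2 p = i by rewrite -pi index_uniq.
  have -> : index j.*2.+1 p = i' by rewrite -e1 index_uniq.
  by rewrite lt.
apply: (@eq_from_nth _ 0) => // i iq; apply/eqP/negPn/negP => /eqP ne.
have iq' : i < size q' by rewrite -sz.
move: (gq) (gq') => /andP [_ /allP q7] /andP [_ /allP q'7].
have El : letter_of (nth 0 q i) = letter_of (nth 0 q' i).
  by rewrite -!(nth_map 0 La) // E.
case: (letter_of_eq (q7 _ (mem_nth 0 iq)) (q'7 _ (mem_nth 0 iq')) El ne) => j j3 [[e1 e2]|[e1 e2]].
  exact: (key _ _ _ gq gq' sz (perm_mem pq) E sq sq' iq j j3 e1 e2).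
apply: (key _ _ _ gq' gq _ _ _ sq' sq iq' j j3 e2 e1) => // x.
by rewrite (perm_mem pq).
Qed.

Definition spelling (S : seq nat) (k : key) : seq nat :=
  head [::] [seq q <- permutations S | std q && (map letter_of q == k)].

Definition spellable (S : seq nat) (k : key) : bool :=
  has (fun q => std q && (map letter_of q == k)) (permutations S).

Lemma spelling_spec S k : spellable S k ->
  [/\ perm_eq (spelling S k) S, std (spelling S k) & map letter_of (spelling S k) = k].
Proof.
rewrite /spellable has_filter /spelling; case E: (filter _ _) => [|q s] // _ /=.
have : q \in [seq q <- permutations S | std q && (map letter_of q == k)].
  by rewrite E inE eqxx.
by rewrite mem_filter mem_permutations => /andP [/andP [-> /eqP ->] ->].
Qed.

Lemma spelling_eq S q : good_slots S -> perm_eq q S -> std q ->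
  spellable S (map letter_of q) /\ spelling S (map letter_of q) = q.
Proof.
move=> word_at pq sq.
have c : spellable S (map letter_of q).
  by apply/hasP; exists q; rewrite ?mem_permutations // sq eqxx.
split=> //; have [pl sl El] := spelling_spec c.
have gl : good_slots (spelling S (map letter_of q)) by apply: good_perm word_at; rewrite perm_sym.
by apply: std_inj => //; apply: perm_trans pl _; rewrite perm_sym.
Qed.

Lemma size_spelling S k : spellable S k -> size (spelling S k) = size S.
Proof. by case/spelling_spec => /perm_size. Qed.

Lemma size_spellable S k : spellable S k -> size k = size S.
Proof. by move=> c; have [p _ <-] := spelling_spec c; rewrite size_map (perm_size p). Qed.

Lemma spelling_perm S S' k : good_slots S -> perm_eq S S' -> spellable S k ->
  spellable S' k /\ spelling S' k = spelling S k.
Proof.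
move=> word_at p c; have [pl sl El] := spelling_spec c.
by have := spelling_eq (good_perm p word_at) (perm_trans pl p) sl; rewrite El.
Qed.

(** Swapping the two slots of a pair when they come in the wrong order turns any
    list into a standard one, without changing the super-word. *)
Definition flip (j : nat) (q : seq nat) : seq nat :=
  if before q j.*2.+1 j.*2 then map (tau j) q else q.

Lemma index_tau j x q : index (tau j x) (map (tau j) q) = index x q.
Proof. exact/index_map/tau_inj. Qed.

Lemma mem_tau j x q : (tau j x \in map (tau j) q) = (x \in q).
Proof. exact/mem_map/tau_inj. Qed.

Lemma tau_same j : (tau j j.*2 = j.*2.+1) * (tau j j.*2.+1 = j.*2).
Proof. by rewrite /tau !eqxx; case: eqP => //; lia. Qed.

Lemma tau_other i j : i != j -> (tau i j.*2 = j.*2) * (tau i j.*2.+1 = j.*2.+1).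
Proof. by move=> ij; rewrite /tau; repeat case: eqP => //; lia. Qed.

Lemma perm_map_tau j S : uniq S -> j.*2 \in S -> j.*2.+1 \in S ->
  perm_eq (map (tau j) S) S.
Proof.
move=> uS a b; apply: uniq_perm => //; first by rewrite map_inj_uniq //; apply: tau_inj.
move=> x; rewrite -{1}[x](tauK j) mem_tau /tau.
by case: eqP => [->|_]; [rewrite a b | case: eqP => [->|//]; rewrite a b].
Qed.

Lemma flip_spec j q : uniq q ->
  [/\ perm_eq (flip j q) q, map letter_of (flip j q) = map letter_of q,
      ~~ before (flip j q) j.*2.+1 j.*2
    & forall i, i != j -> before (flip j q) i.*2.+1 i.*2 = before q i.*2.+1 i.*2].
Proof.
move=> uq; rewrite /flip; case: ifP => [B|/negbT B]; last by split.
split.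
- by move: B => /and3P [a b _]; apply: perm_map_tau.
- by rewrite -map_comp; apply: eq_map => x; apply: letter_of_tau.
- move: B => /and3P [_ _ lt]; rewrite /before.
  have -> : index j.*2.+1 (map (tau j) q) = index j.*2 q.
    by rewrite -{1}(tau_same j).1 index_tau.
  have -> : index j.*2 (map (tau j) q) = index j.*2.+1 q.
    by rewrite -{1}(tau_same j).2 index_tau.
  by rewrite !negb_and -leqNgt (ltnW lt) !orbT.
move=> i ij; have ji : j != i by rewrite eq_sym.
have bE x y : before (map (tau j) q) (tau j x) (tau j y) = before q x y.
  by rewrite /before !mem_tau !index_tau.
by have := bE i.*2.+1 i.*2; rewrite !(tau_other ji).
Qed.

(** * Monomials in split octonions *)

(** A basis of the traceless split octonions, numbered by the weight vector of V(6)
    to which each element is proportional: [y3] is a multiple of v_6, and so on. *)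
Inductive oct := h0 | x1 | x2 | x3 | y1 | y2 | y3.

Definition nat_of_oct (o : oct) : nat :=
  match o with y3 => 0 | x1 => 1 | x2 => 2 | h0 => 3 | y2 => 4 | y1 => 5 | x3 => 6 end.
Definition oct_of_nat (n : nat) : oct :=
  match n with 0 => y3 | 1 => x1 | 2 => x2 | 3 => h0 | 4 => y2 | 5 => y1 | _ => x3 end.
Lemma nat_of_octK : cancel nat_of_oct oct_of_nat. Proof. by case. Qed.
HB.instance Definition _ := Equality.copy oct (can_type nat_of_octK).

Definition eq_oct (a b : oct) : bool :=
  match a, b with
  | h0, h0 | x1, x1 | x2, x2 | x3, x3 | y1, y1 | y2, y2 | y3, y3 => true
  | _, _ => false
  end.

(** [Some (s, p, a)] is (-1)^s 2^p a and [None] is 0.  Products of basis elements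
    have this form, so words in basis elements are evaluated without sums. *)
Definition mono := option (bool * nat * oct).

(** The commutator of Zorn's vector matrices; [h0] is the difference of the two
    diagonal idempotents. *)
Definition oct_mul (a b : oct) : mono :=
  let p k := Some (false, 1, k) in let n k := Some (true, 1, k) in
  match a, b with
  | h0, x1 => p x1 | h0, x2 => p x2 | h0, x3 => p x3
  | h0, y1 => n y1 | h0, y2 => n y2 | h0, y3 => n y3
  | x1, h0 => n x1 | x2, h0 => n x2 | x3, h0 => n x3
  | y1, h0 => p y1 | y2, h0 => p y2 | y3, h0 => p y3
  | x1, y1 | x2, y2 | x3, y3 => Some (false, 0, h0)
  | y1, x1 | y2, x2 | y3, x3 => Some (true, 0, h0)
  | x1, x2 => p y3 | x2, x3 => p y1 | x3, x1 => p y2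
  | x2, x1 => n y3 | x3, x2 => n y1 | x1, x3 => n y2
  | y1, y2 => n x3 | y2, y3 => n x1 | y3, y1 => n x2
  | y2, y1 => p x3 | y3, y2 => p x1 | y1, y3 => p x2
  | _, _ => None
  end.

Definition mono_mul (u v : mono) : mono :=
  match u with None => None | Some (s, p, a) =>
  match v with None => None | Some (t, q, b) =>
  match oct_mul a b with None => None | Some (r, d, c) =>
    Some (s (+) t (+) r, p + q + d, c) end end end.

Fixpoint mono_eval (t : seq oct) (w : word) : mono :=
  match w with
  | Var i => Some (false, 0, nth h0 t i)
  | Mul u v => mono_mul (mono_eval t u) (mono_eval t v)
  end.

(** The coordinate at [o] of a signed sum of monomials, as two natural numbers:
    the sum of the positive contributions and that of the negative ones. *)
Fixpoint mono_sum (o : oct) (b : bool) (ms : seq (bool * mono)) : nat :=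
  match ms with
  | [::] => 0
  | (c, Some (s, p, a)) :: ms' =>
    if eq_oct a o then
      if eqb (s (+) c) b then 2 ^ p + mono_sum o b ms' else mono_sum o b ms'
    else mono_sum o b ms'
  | _ :: ms' => mono_sum o b ms'
  end.

Definition mono_terms (t : seq oct) (R : relation) : seq (bool * mono) :=
  foldr (fun bw ms =>
    match mono_eval t bw.2 with None => ms | u => (bw.1, u) :: ms end) [::] R.

Definition all_oct := [:: h0; x1; x2; x3; y1; y2; y3].

Fixpoint tuples (n : nat) : seq (seq oct) :=
  if n is n'.+1 then [seq a :: t | a <- all_oct, t <- tuples n'] else [:: [::]].

Definition cancels (ms : seq (bool * mono)) : bool :=
  match ms with
  | [::] => true
  | _ => all (fun o => eqn (mono_sum o true ms) (mono_sum o false ms)) all_oct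
  end.

Definition holds_on_basis (R : relation) (n : nat) : bool :=
  all (fun t => cancels (mono_terms t R)) (tuples n).

Fixpoint pow2F (n : nat) : F5 := if n is n'.+1 then mulF f2 (pow2F n') else f1.

Definition mono_coef (o : oct) (u : mono) : F5 :=
  match u with
  | Some (s, p, a) => if eq_oct a o then mulF (signF s) (pow2F p) else f0
  | None => f0
  end.

Definition swap_at (j : nat) (t : seq oct) : seq oct :=
  mkseq (fun i => nth h0 t (if eqn i j.*2 then j.*2.+1 else if eqn i j.*2.+1 then j.*2 else i)) (size t).

(** The value at a tuple of a function symmetrised over the pairs, as a signed sum
    of values at permuted tuples. *)
Fixpoint sym_terms (eps : seq bool) (n : nat) (js : seq nat) (t : seq oct) : seq (bool * seq oct) :=
  match js with
  | [::] => [:: (false, t)]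
  | j :: js' =>
    let l := sym_terms eps n js' t in
    if j.*2.+1 < n then
      l ++ [seq (nth false eps j (+) p.1, p.2) | p <- sym_terms eps n js' (swap_at j t)]
    else l
  end.

(** The standard spelling of a super-word that takes the even slot of a pair first. *)
Fixpoint low_slots (k : key) (used : seq nat) : seq nat :=
  match k with
  | [::] => [::]
  | l :: k' =>
    let x := (nat_of_letter l).*2 in
    let y := if mem_nat x used then x.+1 else x in y :: low_slots k' (y :: used)
  end.

Definition sym_coef (ts : seq (bool * seq oct)) (o : oct) (w : word) : F5 :=
  foldr (fun p acc => addF (mulF (signF p.1) (mono_coef o (mono_eval p.2 w))) acc) f0 ts.

(** The linear form in the coefficients c_k given by one coordinate, at one tuple,
    of the combination of the symmetrised words with coefficients c_k. *)
Definition eval_row (eps : seq bool) (n : nat) (kws : seq (key * word)) (to : seq oct * oct) : vec :=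
  let ts := sym_terms eps n [:: 0; 1; 2] to.1 in
  foldr (fun kw acc =>
    match sym_coef ts to.2 kw.2 with
    | f0 => acc
    | x => axpy f1 (single kw.1 x) acc
    end) Leaf kws.

Definition oct_of_digit (r : N) : oct :=
  match r with
  | Npos 1%positive => h0 | Npos 2%positive => x1 | Npos 3%positive => x2
  | Npos 4%positive => x3 | Npos 5%positive => y1 | Npos 6%positive => y2 | _ => y3
  end.

Fixpoint digits (n : nat) (x : N) : seq oct :=
  if n is n'.+1 then
    let: (q, r) := N.div_eucl x (Npos 10%positive) in oct_of_digit r :: digits n' q
  else [::].

(** A tuple of basis vectors and a coordinate, read from the decimal digits of a
    number, units first. *)
Definition row_point (n : nat) (code : N) : seq oct * oct :=
  let ds := digits n.+1 code in (take n ds, last h0 ds).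

(** The evaluation rows have full rank modulo 5 if elimination reduces every key to
    0.  The list of slots is checked to be the standard spelling of the key. *)
Definition independent (eps : seq bool) (N : basis) (n : nat) (codes : seq BinNums.N) : bool :=
  let S := iota 0 n in
  let K := keys_of N (map letter_of S) in
  let kws := [seq (k, left_comb (low_slots k [::])) | k <- K] in
  let rows := [seq eval_row eps n kws (row_point n c) | c <- codes] in
  let nf := solve (foldl (insert 500) Leaf rows) in
  uniq K && all (fun k => let q := low_slots k [::] in
    [&& perm_eq q S, std q, map letter_of q == k
      & if normal nf k is Leaf then true else false]) K.

Definition certificate (eps : seq bool) (msk : positive) (codes : seq (seq BinNums.N)) : bool :=
  let: (tb, N, _) := run eps msk in
  mul_closed tb N && all (fun nc => independent eps N nc.1 nc.2) (zip (iota 1 7) codes).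

(** * The four computations *)

(** One computation for each sign pattern of the form skew, ..., skew, symmetric,
    ..., symmetric.  The masks select the relations, and the points are the tuples
    and coordinates at which the values on V(6) of the 50, 52, 60 and 68 normal words
    of degree 7, and of the fewer ones of lower degree, are independent modulo 5. *)
Definition mask_fff : positive := 0x100000000000000000000000000000000000000000000000000000000000000000000000000000000000000000000000000000000000000000000000000000000000000000000000020000002cb13fff6ffff87907bb07f000ffffc7ffffff0ff7ff0ff0fffff0ff61fe1ffffec0000000000000029fff038a1a6df1fb1f8fffec0001ffff0000000000000001fffc0040f79ef8fc7fff6fb00007fffc0000000000000029fff0080391effc7fff7db7c0001ffff0000000bf018f7fedb137e000000102f800000000000013805f6fb00000000000002d00bedbe000000206d800000040be000000000000216013df7c000000107b0000000817c000000205f00340150600680000f8e006801a006802a0c01500541b5ab%positive.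
Definition points_fff : seq (seq BinNums.N) := [:: [:: 77];
  [:: ];
  [:: 2225];
  [:: 32315];
  [:: 525547; 146731; 767437; 117542; 342573; 515251; 373634];
  [:: 4714463; 4451724; 5746153; 7323526; 7271745; 7213423; 7427175; 7423376; 7242573; 4462315];
  [:: 13742156; 16121153; 27741142; 11363611; 72515721; 11523764; 65266352; 77473674; 46635471; 14631123; 17621354; 73247342; 16573265; 32457473; 33215147; 76523477; 51433214; 73123764; 11757461; 62665311; 64275663; 44167255; 67664311; 14721547; 44566233; 65664771; 65166213; 75211736; 44376141; 13461231; 56534117; 53371446; 13643724; 43224565; 55234215; 13432256; 11144372; 44574274; 27126365; 55172451; 63472146; 65472746; 25727665; 21674275; 31613235; 22134236; 73674376; 75123176; 56347413; 76225537]]%num.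
Lemma certificate_fff : certificate [:: false; false; false] mask_fff points_fff.
Proof. vm_cast_no_check (erefl true). Qed.

Definition mask_tff : positive := 0x100000000000000000000000000000000000000000000000000000000000000000000000000000000000000000000000000000000000002000000000000000000000000000000002000000000000004000050020043af7cf11dfffffff9ffffff07f000ffffc7ffffff0ff7ff0ff0fffff03f3c7603ff81ffeffff8fc0000000000000029fff038a1a6df1fb1f8fffec0001ffff0000000000110002007f7fc7060e3bef8fc7fff3cffcf000003fffff000000000000002a032bffe8320e473ff1fffdf3cf3ff000003fffff000000084fc443dffb3cf009be000000102f800000000000013805f6fb00000000000002d00bedbe000000206d8000000e1bec0000000000000fc02fbefbe000000387db0000001c37d8000000e1bec00d00541801a00003e3801a006801a01a610034c034c235aa%positive.
Definition points_tff : seq (seq BinNums.N) := [:: [:: 77];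
  [:: 616];
  [:: 4516; 2225];
  [:: 16347; 32315; 47465];
  [:: 176563; 774527; 313423; 146731; 767437; 342573; 515251; 373634];
  [:: 6521124; 6115621; 4714463; 1126343; 4326556; 4451724; 5746153; 7323526; 7271745; 7213423; 2674376; 7427175; 7423376; 7242573; 4462315];
  [:: 13742156; 61465271; 41115116; 66763651; 27741142; 27255621; 14273254; 26657132; 72515721; 32341751; 22565767; 65266352; 77473674; 46635471; 73623251; 14631123; 17621354; 73247342; 16573265; 32457473; 33215147; 51433214; 73123764; 11757461; 64275663; 11613243; 14721547; 65664771; 65166213; 75211736; 44376141; 13461231; 56534117; 53371446; 13643724; 43224565; 55234215; 13432256; 11144372; 44574274; 27126365; 55172451; 63472146; 65472746; 25727665; 21674275; 31613235; 22134236; 73674376; 75123176; 56347413; 76225537]]%num.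
Lemma certificate_tff : certificate [:: true; false; false] mask_tff points_tff.
Proof. vm_cast_no_check (erefl true). Qed.

Definition mask_ttf : positive := 0x10000000000000000000000000000000000000000000000000000000000000000000000000000000000000000000000000000000000000000000000000000200000000000200000000000000000000100822000000000000000404140380011c47be7aa3bffdffffe7fe7ffffffdfc003ffff3ffffffc3fdffc07ff03ffdffff3fffffe03ff81ffeffff8fc000000000044000004ffff03860aa79fffff8fc7fff3c00000fffffc000000000044000801fdff1c1838efbe3f1fffcf3ff3c00000fffffc000100014000000aa007abfff60e388fc77ff1fffcfffffcffc0000001fffffff00004001037f98b1dffcffcf009bff8000000e1bec00000000000009c02fb7d80000000000081e805b7ff7c00000070df6000000386fb00000000000003f00befbef8000000e1f6c000000707bfc000000707bfc00d00d30800680000f8e0068039803980698400d300d30db52a%positive.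
Definition points_ttf : seq (seq BinNums.N) := [:: [:: 77];
  [:: 616];
  [:: 4516; 2225];
  [:: 34173; 32315; 47465];
  [:: 743232; 163432; 464253; 774527; 313423; 146731; 767437; 117542; 342573; 515251; 373634];
  [:: 3552321; 6115621; 7621375; 7132521; 1523421; 5711443; 4451724; 5746153; 3356257; 7323526; 7271745; 7213423; 7427175; 7242573; 4462315];
  [:: 46256531; 13742156; 66256517; 11521567; 41115116; 21737664; 77452774; 35423527; 47311446; 77412473; 64326163; 54573241; 33576243; 66763651; 51133641; 27255621; 31352741; 14273254; 26657132; 72515721; 11523764; 32341751; 22565767; 65266352; 77473674; 46635471; 73623251; 17621354; 73247342; 16573265; 32457473; 33215147; 51433214; 11757461; 64275663; 11613243; 14721547; 65664771; 65166213; 75211736; 44376141; 13461231; 56534117; 53371446; 13643724; 43224565; 55234215; 11144372; 44574274; 27126365; 55172451; 63472146; 65472746; 25727665; 21674275; 31613235; 22134236; 73674376; 75123176; 56347413]]%num.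
Lemma certificate_ttf : certificate [:: true; true; false] mask_ttf points_ttf.
Proof. vm_cast_no_check (erefl true). Qed.

Definition mask_ttt : positive := 0x1000000000000000000000000000000000000000000000000000200000000000000000000000000000000000000000000000000000000000000000000000000000000000000000a0000000000202800000000000000000001a082200000000000400051104453e38084a188b7cb531cfff6fffffe7fffbfffffffcffc007ffff3ffffffc0fff7fffff7ff03fffffff7fffffffbff81fffffffffc00010000000a8000010b7ffff1470c1357fcffffffffc7ffffc0000001fffffff000040000002a00068017f5ffd1e0e238ef9ffffc7ffffcffff00000007ffffffc000100014000000aa007abfff60e388fc77ff1fffcfffffcffc0000001fffffff00014000b06bfd1c4f1ffffffff000137ff8000000e0f7f800000000000893801f7fbfc0000000000040f402dbffbe000002302ffe000000383dfe00000000000007e017df7df0000001c17ff0000001c1eff0000001c1eff007300d30d803980000f8e00e600e600e601a61b00d300d30da52a%positive.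
Definition points_ttt : seq (seq BinNums.N) := [:: [:: 77];
  [:: 616];
  [:: 4516; 2225];
  [:: 34173; 32315; 47465];
  [:: 743232; 163432; 464253; 774527; 313423; 146731; 767437; 117542; 342573; 515251; 373634];
  [:: 5547576; 6425761; 1467437; 2734612; 3613734; 7132521; 1523421; 1126343; 5711443; 4326556; 4451724; 5746153; 3356257; 7323526; 7271745; 7213423; 2674376; 7427175; 7242573; 4462315];
  [:: 61465271; 12756745; 66256517; 12163745; 11521567; 25322412; 44753462; 26121715; 41613542; 67561421; 24211321; 64576326; 37156131; 21737664; 77452774; 35423527; 47311446; 77412473; 64326163; 54573241; 66754236; 33576243; 66763651; 51133641; 27255621; 31352741; 14273254; 26657132; 72515721; 32341751; 22565767; 65266352; 77473674; 46635471; 73623251; 17621354; 73247342; 16573265; 32457473; 33215147; 51433214; 73123764; 11757461; 64275663; 11613243; 55435212; 14721547; 65166213; 75211736; 44376141; 13461231; 56534117; 53371446; 13643724; 55234215; 11144372; 44574274; 27126365; 55172451; 63472146; 65472746; 25727665; 21674275; 31613235; 22134236; 73674376; 75123176; 56347413]]%num.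
Lemma certificate_ttt : certificate [:: true; true; true] mask_ttt points_ttt.
Proof. vm_cast_no_check (erefl true). Qed.

(** * Soundness of elimination *)

Variant all_trie X (P : key -> X -> Prop) (t : trie X) : Prop :=
  AllTrie of forall k x, get k t = Some x -> P k x.

Lemma all_trie_get X (P : key -> X -> Prop) t k x : all_trie P t -> get k t = Some x -> P k x.
Proof. by case=> H /H. Qed.

Lemma get_single X k (x : X) k' y :
  get k' (single k x) = Some y -> k' = k /\ y = x.
Proof.
elim: k k' => [|l k IH] k'.
  by case: k' => [|[] k'] //= [->].
by case: l; case: k' => [|[] k'] //= /IH [-> ->].
Qed.

Lemma get_put X k (x : X) t k' y :
  get k' (put k x t) = Some y -> (k' = k /\ y = x) \/ get k' t = Some y.
Proof.
elim: t k k' => [|o a IHa b IHb c IHc d IHd] k k' /=; first by move=> H; left; apply: get_single H.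
case: k => [|[] k]; case: k' => [|[] k'] //=; try (by right); try (by case=> ->; left).
- by move/IHa => [[-> ->]|]; [left|right].
- by move/IHb => [[-> ->]|]; [left|right].
- by move/IHc => [[-> ->]|]; [left|right].
- by move/IHd => [[-> ->]|]; [left|right].
Qed.

Lemma get_trim_node X (o : option X) a b c d k :
  get k (trim_node o a b c d) = get k (Node o a b c d).
Proof.
case: o => [x|] //; case: a => [|? ? ? ? ?] //; case: b => [|? ? ? ? ?] //.
by case: c => [|? ? ? ? ?] //; case: d => [|? ? ? ? ?] //; case: k => [|[] k].
Qed.

Lemma all_trie_single X P k (x : X) : P k x -> all_trie P (single k x).
Proof. by move=> Px; split=> k' y H; case: (get_single H) => -> ->. Qed.

Lemma all_trie_put X P k (x : X) t : P k x -> all_trie P t -> all_trie P (put k x t).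
Proof. by move=> Px [Pt]; split=> k' y H; case: (get_put H) => [[-> ->]|/Pt]. Qed.

Lemma lead_get X (t : trie X) k x : lead t = Some (k, x) -> get k t = Some x.
Proof.
elim: t k x => [|o a IHa b IHb c IHc d IHd] k x //=.
case: o => [y|]; first by case=> <- <-.
case: (lead a) IHa => [[k' y]|] IHa; first by case=> <- <-; apply: IHa.
case: (lead b) IHb => [[k' y]|] IHb; first by case=> <- <-; apply: IHb.
case: (lead c) IHc => [[k' y]|] IHc; first by case=> <- <-; apply: IHc.
case: (lead d) IHd => [[k' y]|] IHd; first by case=> <- <-; apply: IHd.
by [].
Qed.

Definition all_entries X (P : key -> X -> Prop) (l : seq (key * X)) : Prop :=
  foldr (fun kx Q => P kx.1 kx.2 /\ Q) True l.

Lemma all_entriesP X (P : key -> X -> Prop) t pre acc :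
  (forall k x, get k t = Some x -> P (rev pre ++ k) x) ->
  all_entries P acc -> all_entries P (entries t pre acc).
Proof.
elim: t pre acc => [|o a IHa b IHb c IHc d IHd] pre acc //= Pt Pacc.
have H : all_entries P (entries a (La :: pre) (entries b (Lb :: pre)
    (entries c (Lc :: pre) (entries d (Ld :: pre) acc)))).
  apply: IHa => [k x kx|]; first by rewrite rev_cons cat_rcons; apply: Pt.
  apply: IHb => [k x kx|]; first by rewrite rev_cons cat_rcons; apply: Pt.
  apply: IHc => [k x kx|]; first by rewrite rev_cons cat_rcons; apply: Pt.
  by apply: IHd => [k x kx|//]; rewrite rev_cons cat_rcons; apply: Pt.
by case: o Pt => [x|] Pt //=; split => //; rewrite -[rev _]cats0; apply: Pt.
Qed.

Definition supp (P : key -> Prop) (v : vec) : Prop := all_trie (fun k _ => P k) v.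

Lemma supp_node P o a b c d :
  supp P (Node o a b c d) <->
  [/\ o -> P [::], supp (fun k => P (La :: k)) a, supp (fun k => P (Lb :: k)) b,
      supp (fun k => P (Lc :: k)) c & supp (fun k => P (Ld :: k)) d].
Proof.
split=> [[H]|[Ho [Ha] [Hb] [Hc] [Hd]]]; last split=> -[|[] k] x /=; last 5 first.
- by move=> ox; apply: Ho; rewrite ox.
- exact: Ha.
- exact: Hb.
- exact: Hc.
- exact: Hd.
split=> [||||].
- by case: o H => [x|] // H _; apply: (H [::] x).
- by split=> k x kx; apply: (H (La :: k) x).
- by split=> k x kx; apply: (H (Lb :: k) x).
- by split=> k x kx; apply: (H (Lc :: k) x).
- by split=> k x kx; apply: (H (Ld :: k) x).
Qed.

Lemma supp_sub (P Q : key -> Prop) v : (forall k, P k -> Q k) -> supp P v -> supp Q v.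
Proof. by move=> PQ [H]; split=> k x /H/PQ. Qed.

Lemma supp_single (P : key -> Prop) k x : P k -> supp P (single k x).
Proof. exact: (@all_trie_single _ (fun k _ => P k)). Qed.

Lemma supp_scale P x v : supp P v -> supp P (scale x v).
Proof.
elim: v P => [|o a IHa b IHb c IHc d IHd] P //= /supp_node [Ho Ha Hb Hc Hd].
apply/supp_node; split; [by case: o Ho|exact: IHa|exact: IHb|exact: IHc|exact: IHd].
Qed.

Lemma supp_axpy P x u v : supp P u -> supp P v -> supp P (axpy x u v).
Proof.
elim: u v P => [|o a IHa b IHb c IHc d IHd] v P // Hu Hv.
case: v Hv => [|o' a' b' c' d'] Hv; first by rewrite /=; apply: (@supp_scale P x (Node o a b c d)).
move/supp_node: Hu => [Ho Ha Hb Hc Hd].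
move/supp_node: Hv => [Ho' Ha' Hb' Hc' Hd'].
suff H : supp P (Node (match o with
    | None => o'
    | Some y => match o' with None => Some (mulF x y) | Some z => nz (addF (mulF x y) z) end
    end) (axpy x a a') (axpy x b b') (axpy x c c') (axpy x d d')).
  by case: H => H; split=> k y; rewrite /= get_trim_node; apply: H.
apply/supp_node; split; [|exact: IHa|exact: IHb|exact: IHc|exact: IHd].
by case: o o' Ho Ho' => [x1|] [x2|] //= Ho Ho' _; apply: Ho.
Qed.

Lemma supp_bind (P Q : key -> Prop) v f acc :
  supp Q v -> (forall k, Q k -> supp P (f k)) -> supp P acc ->
  supp P (bind v f acc).
Proof.
elim: v Q f acc => [|o a IHa b IHb c IHc d IHd] Q f acc //=.
move=> /supp_node [Ho Ha Hb Hc Hd] Hf Hacc.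
apply: (IHa _ _ _ Ha) => [k Qk|]; first exact: Hf.
apply: (IHb _ _ _ Hb) => [k Qk|]; first exact: Hf.
apply: (IHc _ _ _ Hc) => [k Qk|]; first exact: Hf.
apply: (IHd _ _ _ Hd) => [k Qk|]; first exact: Hf.
by case: o Ho => [x|] // Ho; apply: supp_axpy => //; apply: Hf; apply: Ho.
Qed.

Definition valF (x : F5) : nat :=
  match x with f0 => 0 | f1 => 1 | f2 => 2 | f3 => 3 | f4 => 4 end.

Local Open Scope ring_scope.

(** A trie over F5 stands for a combination of elements [g k] of an abelian group,
    read modulo a subgroup [Nul] that contains every [5 g k]: this is what makes the
    coefficients modulo 5 meaningful. *)
Section Congruence.

Variables (V : zmodType) (Nul : V -> Prop).
Hypothesis Nul0 : Nul 0.
Hypothesis NulB : forall x y, Nul x -> Nul y -> Nul (x - y).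

Lemma NulN x : Nul x -> Nul (- x).
Proof. by move=> Nx; rewrite -sub0r; apply: NulB. Qed.

Lemma NulD x y : Nul x -> Nul y -> Nul (x + y).
Proof. by move=> Nx Ny; rewrite -[y]opprK; apply: NulB => //; apply: NulN. Qed.

Lemma NulMn x n : Nul x -> Nul (x *+ n).
Proof. by move=> Nx; elim: n => [|n IH]; rewrite ?mulr0n // mulrS; apply: NulD. Qed.

Definition eqN x y := Nul (x - y).

Lemma eqN_refl x : eqN x x. Proof. by rewrite /eqN subrr. Qed.
Lemma eqN_sym x y : eqN x y -> eqN y x.
Proof. by move=> xy; rewrite /eqN -opprB; apply: NulN. Qed.
Lemma eqN_trans y x z : eqN x y -> eqN y z -> eqN x z.
Proof. by move=> xy yz; rewrite /eqN -(subrKA y); apply: NulD. Qed.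
Lemma eqND x y x' y' : eqN x x' -> eqN y y' -> eqN (x + y) (x' + y').
Proof. by move=> xx yy; rewrite /eqN opprD addrACA; apply: NulD. Qed.
Lemma eqNMn x y n : eqN x y -> eqN (x *+ n) (y *+ n).
Proof. by move=> xy; rewrite /eqN -mulrnBl; apply: NulMn. Qed.
Lemma eqN_Nul x y : eqN x y -> Nul y -> Nul x.
Proof. by move=> xy Ny; rewrite -(subrK y x); apply: NulD. Qed.

Fixpoint sem (v : vec) (g : key -> V) : V :=
  match v with
  | Leaf => 0
  | Node o a b c d =>
    (if o is Some x then g [::] *+ valF x else 0)
    + (sem a (fun k => g (La :: k)) + (sem b (fun k => g (Lb :: k))
    + (sem c (fun k => g (Lc :: k)) + sem d (fun k => g (Ld :: k)))))
  end.

Lemma sem_single k x g : sem (single k x) g = g k *+ valF x.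
Proof.
by elim: k g => [|[] k IH] g /=; rewrite ?IH ?addr0 ?add0r.
Qed.

Lemma sem_supp (P : key -> Prop) v g h :
  supp P v -> (forall k, P k -> eqN (g k) (h k)) -> eqN (sem v g) (sem v h).
Proof.
elim: v P g h => [|o a IHa b IHb c IHc d IHd] P g h /=; first by move=> _ _; apply: eqN_refl.
move=> /supp_node [Ho Ha Hb Hc Hd] H.
apply: eqND; first by case: o Ho => [x|] Ho; [apply/eqNMn/H/Ho | apply: eqN_refl].
apply: eqND; first by apply: (IHa _ _ _ Ha) => k Pk; apply: H.
apply: eqND; first by apply: (IHb _ _ _ Hb) => k Pk; apply: H.
apply: eqND; first by apply: (IHc _ _ _ Hc) => k Pk; apply: H.
by apply: (IHd _ _ _ Hd) => k Pk; apply: H.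
Qed.

Lemma sem_eq v g h : g =1 h -> sem v g = sem v h.
Proof.
elim: v g h => [|o a IHa b IHb c IHc d IHd] g h E //=.
rewrite (IHa _ _ (fun k => E (La :: k))) (IHb _ _ (fun k => E (Lb :: k))).
by rewrite (IHc _ _ (fun k => E (Lc :: k))) (IHd _ _ (fun k => E (Ld :: k))) E.
Qed.

Definition killed5 (x : V) := Nul (x *+ 5).

Lemma eqN_mod m n z : killed5 z -> m = n %[mod 5] -> eqN (z *+ m) (z *+ n).
Proof.
move=> z5 mn; rewrite (divn_eq m 5) (divn_eq n 5) mn !mulrnDr.
by apply: eqND (eqN_refl _); rewrite !(mulnC _ 5%N) !mulrnA /eqN;
  apply: NulB; apply: NulMn.
Qed.

Lemma addF_ok x y z : killed5 z ->
  eqN (z *+ valF (addF x y)) (z *+ valF x + z *+ valF y).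
Proof. by move=> z5; rewrite -mulrnDr; apply: eqN_mod => //; case: x; case: y. Qed.

Lemma mulF_ok x y z : killed5 z ->
  eqN (z *+ valF (mulF x y)) (z *+ valF y *+ valF x).
Proof. by move=> z5; rewrite -mulrnA; apply: eqN_mod => //; case: x; case: y. Qed.

Lemma sem_scale x v g : (forall k, killed5 (g k)) ->
  eqN (sem (scale x v) g) (sem v g *+ valF x).
Proof.
elim: v g => [|o a IHa b IHb c IHc d IHd] g g5 /=.
  by rewrite mul0rn; apply: eqN_refl.
rewrite !mulrnDl; apply: eqND.
  case: o => [y|]; last by rewrite mul0rn; apply: eqN_refl.
  exact: mulF_ok.
by apply: eqND; [|apply: eqND; [|apply: eqND]]; [apply: IHa|apply: IHb|apply: IHc|apply: IHd].
Qed.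

Lemma sem_trim_node o a b c d g : sem (trim_node o a b c d) g = sem (Node o a b c d) g.
Proof. case: o => [x|] //; case: a => [|? ? ? ? ?] //; case: b => [|? ? ? ? ?] //.
by case: c => [|? ? ? ? ?] //; case: d => [|? ? ? ? ?] //=; rewrite !addr0. Qed.

Lemma nz_ok x z : (if nz x is Some y then z *+ valF y else 0) = z *+ valF x :> V.
Proof. by case: x. Qed.

Lemma sem_axpy x u v g : (forall k, killed5 (g k)) ->
  eqN (sem (axpy x u v) g) (sem u g *+ valF x + sem v g).
Proof.
elim: u v g => [|o a IHa b IHb c IHc d IHd] v g g5.
  by rewrite /= mul0rn add0r; apply: eqN_refl.
case: v => [|o' a' b' c' d'].
  by rewrite [sem Leaf g]/= addr0; apply: sem_scale.
rewrite [axpy _ _ _]/= sem_trim_node /= !mulrnDl.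
rewrite addrACA; apply: eqND.
  case: o => [y|]; last by rewrite mul0rn add0r; apply: eqN_refl.
  case: o' => [z|]; last by rewrite addr0; apply: mulF_ok.
  rewrite nz_ok; apply: eqN_trans (addF_ok _ _ (g5 _)) _.
  by apply: eqND (eqN_refl _); apply: mulF_ok.
rewrite addrACA; apply: eqND; first exact: IHa.
rewrite addrACA; apply: eqND; first exact: IHb.
by rewrite addrACA; apply: eqND; [apply: IHc | apply: IHd].
Qed.

Lemma sem_bind v f acc g : (forall k, killed5 (g k)) ->
  eqN (sem (bind v f acc) g) (sem v (fun k => sem (f k) g) + sem acc g).
Proof.
move=> g5; elim: v f acc => [|o a IHa b IHb c IHc d IHd] f acc /=.
  by rewrite add0r; apply: eqN_refl.
apply: eqN_trans (IHa _ _) _.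
apply: eqN_trans (eqND (eqN_refl _) (IHb _ _)) _.
apply: eqN_trans (eqND (eqN_refl _) (eqND (eqN_refl _) (IHc _ _))) _.
apply: eqN_trans (eqND (eqN_refl _) (eqND (eqN_refl _) (eqND (eqN_refl _) (IHd _ _)))) _.
set A := sem a _; set B := sem b _; set C := sem c _; set D := sem d _.
set O := (X in X + (A + _) + _); set E := sem acc g.
have -> : O + (A + (B + (C + D))) + E = A + (B + (C + (D + (O + E)))).
  by rewrite -!addrA (addrCA D O) (addrCA C O) (addrCA B O) (addrCA A O).
do 4 apply: eqND (eqN_refl _) _.
rewrite /O {O}; case: o => [x|]; last by rewrite add0r; apply: eqN_refl.
exact: sem_axpy.
Qed.

Definition null_row (P : key -> Prop) (g : key -> V) (v : vec) : Prop :=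
  supp P v /\ Nul (sem v g).

Definition pivots_ok (P : key -> Prop) (g : key -> V) : trie vec -> Prop :=
  all_trie (fun k q => P k /\ null_row P g q).

(** Pivot rows stay null rows: a row operation modulo 5 changes the element by a
    multiple of 5. *)
Lemma insert_ok (P : key -> Prop) (g : key -> V) fuel piv r :
  (forall k, killed5 (g k)) ->
  pivots_ok P g piv -> null_row P g r -> pivots_ok P g (insert fuel piv r).
Proof.
move=> g5; elim: fuel piv r => [|fuel IH] piv r Hp Hr //=.
case L: (lead r) => [[k x]|] //; case E: (get k piv) => [q|].
  apply: IH => //; have [_ [Pq Nq]] := all_trie_get Hp E; have [Pr Nr] := Hr.
  split; first exact: supp_axpy.
  by apply: eqN_Nul (sem_axpy _ _ _ g5) _; apply: NulD => //; apply: NulMn.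
apply: all_trie_put => //; have [Pr Nr] := Hr; split; last split.
- exact: (all_trie_get Pr (lead_get L)).
- exact: supp_scale.
- by apply: eqN_Nul (sem_scale _ _ g5) _; apply: NulMn.
Qed.

Definition nf_ok (P : key -> Prop) (g : key -> V) (k : key) (v : vec) : Prop :=
  [/\ P k, supp P v & eqN (g k) (sem v g)].

Lemma normal_ok (P : key -> Prop) (g : key -> V) nf k :
  all_trie (nf_ok P g) nf -> P k -> nf_ok P g k (normal nf k).
Proof.
rewrite /normal => H Pk; case E: (get k nf) => [v|]; first exact: (all_trie_get H).
by split=> //; [apply: supp_single | rewrite sem_single; apply: eqN_refl].
Qed.

(** The tail of a pivot row at [k] is congruent to [g k], and replacing its keys by
    their normal forms keeps it so. *)
Lemma solve_ok (P : key -> Prop) (g : key -> V) piv :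
  (forall k, killed5 (g k)) -> pivots_ok P g piv -> all_trie (nf_ok P g) (solve piv).
Proof.
move=> g5 Hp; rewrite /solve.
have : all_entries (fun k q => P k /\ null_row P g q) (entries piv [::] [::]).
  by apply: all_entriesP => // k q; apply: (all_trie_get Hp).
elim: (entries _ _ _) => [|[k q] l IH] //= [[Pk [Pq Nq]] /IH {}IH].
apply: all_trie_put => //; set t := scale f4 _.
have Pt : supp P t by exact: (supp_scale _ (supp_axpy _ (supp_single _ Pk) Pq)).
split=> //.
  by apply: (supp_bind Pt) => [k' Pk'|]; [have [] := normal_ok IH Pk' | split].
apply: eqN_sym; apply: eqN_trans (sem_bind t (normal _) Leaf g5) _; rewrite /= addr0.
apply: (@eqN_trans (sem t g)).
  apply: sem_supp Pt _ => k' Pk'; apply: eqN_sym.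
  by have [] := normal_ok IH Pk'.
apply: eqN_trans (sem_scale _ _ g5) _.
apply: eqN_trans (eqNMn 4 (sem_axpy _ _ _ g5)) _.
rewrite sem_single /= mulr1n mulrnDl -mulrnA /eqN addrAC -[X in _ - X]mulr1n -mulrnBr //.
apply: NulD; last exact: NulMn.
(* The coefficient 4 stands for -1, and 4 * 4 - 1 is a multiple of 5. *)
by rewrite -[(4 * 4 - 1)%N]/(5 * 3)%N mulrnA; apply: NulMn; apply: g5.
Qed.

End Congruence.

(** * Multilinear functions modulo 5 and signs *)

(** Words are interpreted as functions of the assignments of elements of the algebra
    to the slots, so that identities of the algebra become equalities. *)
Section Functions.

Variables (B : zmodType) (m : B -> B -> B).
Hypothesis mBl : forall x y z, m (x - y) z = m x z - m y z.
Hypothesis mBr : forall x y z, m z (x - y) = m z x - m z y.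

Notation V := ((nat -> B) -> B).

Definition hat (w : word) : V := fun s => word_eval m s w.
Definition act (sigma : nat -> nat) (f : V) : V := fun s => f (s \o sigma).
Definition mulV (f g : V) : V := fun s => m (f s) (g s).

Lemma hat_wmap sigma w : hat (wmap sigma w) = act sigma (hat w).
Proof. by apply/funext => s; rewrite /hat /act word_eval_wmap. Qed.

Lemma hat_mul u v : hat (Mul u v) = mulV (hat u) (hat v). Proof. by []. Qed.

Lemma actB sigma f g : act sigma (f - g) = act sigma f - act sigma g. Proof. by []. Qed.
Lemma actD sigma f g : act sigma (f + g) = act sigma f + act sigma g. Proof. by []. Qed.
Lemma act0 sigma : act sigma 0 = 0. Proof. by []. Qed.
Lemma actMn sigma f n : act sigma (f *+ n) = act sigma f *+ n.
Proof. by elim: n => [|n IH]; [rewrite !mulr0n act0 | rewrite !mulrS actD IH]. Qed.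

Lemma mulVBl f g h : mulV (f - g) h = mulV f h - mulV g h.
Proof. by apply/funext => s; apply: mBl. Qed.
Lemma mulVBr f g h : mulV h (f - g) = mulV h f - mulV h g.
Proof. by apply/funext => s; apply: mBr. Qed.
Lemma mulV0l h : mulV 0 h = 0. Proof. by rewrite -(subrr 0) mulVBl !subrr. Qed.
Lemma mulV0r h : mulV h 0 = 0. Proof. by rewrite -(subrr 0) mulVBr !subrr. Qed.
Lemma mulVNl f h : mulV (- f) h = - mulV f h.
Proof. by rewrite -sub0r mulVBl mulV0l sub0r. Qed.
Lemma mulVNr f h : mulV h (- f) = - mulV h f.
Proof. by rewrite -sub0r mulVBr mulV0r sub0r. Qed.
Lemma mulVDl f g h : mulV (f + g) h = mulV f h + mulV g h.
Proof. by rewrite -[g]opprK mulVBl mulVNl !opprK. Qed.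
Lemma mulVDr f g h : mulV h (f + g) = mulV h f + mulV h g.
Proof. by rewrite -[g]opprK mulVBr mulVNr !opprK. Qed.
Lemma mulVMnl f h n : mulV (f *+ n) h = mulV f h *+ n.
Proof. by elim: n => [|n IH]; rewrite ?mulr0n ?mulV0l // !mulrS mulVDl IH. Qed.
Lemma mulVMnr f h n : mulV h (f *+ n) = mulV h f *+ n.
Proof. by elim: n => [|n IH]; rewrite ?mulr0n ?mulV0r // !mulrS mulVDr IH. Qed.

Inductive lattice (S : seq nat) : V -> Prop :=
  | lattice_word w of perm_eq (letters w) S : lattice S (hat w)
  | lattice0 : lattice S 0
  | latticeB f g of lattice S f & lattice S g : lattice S (f - g).

Lemma latticeN S f : lattice S f -> lattice S (- f).
Proof. by move=> Sf; rewrite -sub0r; apply: latticeB => //; apply: lattice0. Qed.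

Lemma lattice_perm S S' f : perm_eq S S' -> lattice S f -> lattice S' f.
Proof.
move=> p; elim=> [w pw||f1 f2 _ L1 _ L2]; [|exact: lattice0|exact: latticeB].
by apply: lattice_word; apply: perm_trans pw p.
Qed.

Lemma lattice_act sigma S f : lattice S f -> lattice (map sigma S) (act sigma f).
Proof.
elim=> [w pw||f1 f2 _ L1 _ L2].
- by rewrite -hat_wmap; apply: lattice_word; rewrite letters_wmap; apply: perm_map.
- by rewrite act0; apply: lattice0.
- by rewrite actB; apply: latticeB.
Qed.

Lemma lattice_mul S T f g : lattice S f -> lattice T g -> lattice (S ++ T) (mulV f g).
Proof.
move=> Sf Tg; elim: Sf => [u pu||f1 f2 _ L1 _ L2].
- elim: Tg => [v pv||g1 g2 _ L1 _ L2].
  + by rewrite -hat_mul; apply: lattice_word; apply: perm_cat.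
  + by rewrite mulV0r; apply: lattice0.
  + by rewrite mulVBr; apply: latticeB.
- by rewrite mulV0l; apply: lattice0.
- by rewrite mulVBl; apply: latticeB.
Qed.

Lemma lattice_fix sigma S f : {in S, sigma =1 id} -> lattice S f -> act sigma f = f.
Proof.
move=> E; elim=> [w pw|//|f1 f2 _ L1 _ L2]; last by rewrite actB L1 L2.
apply/funext => s; apply: eq_word_eval => x xw /=; rewrite E //.
by rewrite -(perm_mem pw).
Qed.

Definition signed (b : bool) (f : V) : V := if b then - f else f.

Lemma signedB b f g : signed b (f - g) = signed b f - signed b g.
Proof. by case: b; rewrite /signed // opprD. Qed.
Lemma act_signed sigma b f : act sigma (signed b f) = signed b (act sigma f). Proof. by case: b. Qed.
Lemma mulV_signedl b f g : mulV (signed b f) g = signed b (mulV f g).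
Proof. by case: b => //=; apply: mulVNl. Qed.
Lemma mulV_signedr b f g : mulV f (signed b g) = signed b (mulV f g).
Proof. by case: b => //=; apply: mulVNr. Qed.
Lemma signed_add a b f : signed a (signed b f) = signed (a (+) b) f.
Proof. by case: a; case: b; rewrite /signed ?opprK. Qed.

Variable eps : seq bool.

(** The congruence of the computations: multiples of 5 vanish, and the swap of a
    pair inside [S] acts as the sign of the pair. *)
Inductive Null (S : seq nat) : V -> Prop :=
  | Null5 f of lattice S f : Null S (f *+ 5)
  | Null_swap j f of (j < 3)%N & j.*2 \in S & j.*2.+1 \in S & lattice S f :
      Null S (f - signed (nth false eps j) (act (tau j) f))
  | Null_0 : Null S 0
  | Null_B f g of Null S f & Null S g : Null S (f - g).

Lemma Null_perm S S' f : perm_eq S S' -> Null S f -> Null S' f.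
Proof.
move=> p; elim=> [f1 L|j f1 j3 a b L||f1 f2 _ N1 _ N2].
- by apply: Null5; apply: lattice_perm L.
- by apply: Null_swap; rewrite -?(perm_mem p) //; apply: lattice_perm L.
- exact: Null_0.
- exact: Null_B.
Qed.

(** [Null] is compatible with products because a function on [T] is fixed by the
    swaps of pairs inside the disjoint set [S]. *)
Lemma Null_mull S T f g : uniq (S ++ T) -> Null S f -> lattice T g -> Null (S ++ T) (mulV f g).
Proof.
move=> uST Sf Tg; elim: Sf => [f1 L|j f1 j3 a b L||f1 f2 _ N1 _ N2].
- by rewrite mulVMnl; apply: Null5; apply: lattice_mul.
- have E : act (tau j) g = g.
    apply: (lattice_fix _ Tg) => x xT; rewrite /tau.
    move: uST; rewrite cat_uniq => /and3P [_ /hasPn H _].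
    by case: eqP => [e|_]; [|case: eqP => [e|//]]; have := H _ xT; rewrite /= e ?a ?b.
  rewrite mulVBl mulV_signedl -{2}E -[mulV (act _ _) _]/(act (tau j) (mulV f1 g)).
  by apply: Null_swap; rewrite ?mem_cat ?a ?b //; apply: lattice_mul.
- by rewrite mulV0l; apply: Null_0.
- by rewrite mulVBl; apply: Null_B.
Qed.

Lemma Null_mulr S T f g : uniq (S ++ T) -> lattice S f -> Null T g -> Null (S ++ T) (mulV f g).
Proof.
move=> uST Sf Tg; elim: Tg => [g1 L|j g1 j3 a b L||g1 g2 _ N1 _ N2].
- by rewrite mulVMnr; apply: Null5; apply: lattice_mul.
- have E : act (tau j) f = f.
    apply: (lattice_fix _ Sf) => x xS; rewrite /tau.
    move: uST; rewrite cat_uniq => /and3P [_ /hasPn H _].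
    case: eqP => [e|_]; first by have := H _ a; rewrite /= -e xS.
    by case: eqP => [e|//]; have := H _ b; rewrite /= -e xS.
  rewrite mulVBr mulV_signedr -{2}E -[mulV _ (act _ _)]/(act (tau j) (mulV f g1)).
  by apply: Null_swap; rewrite ?mem_cat ?a ?b ?orbT //; apply: lattice_mul.
- by rewrite mulV0r; apply: Null_0.
- by rewrite mulVBr; apply: Null_B.
Qed.

Lemma tauC i j x : tau i (tau j x) = tau j (tau i x).
Proof. by rewrite /tau; do !case: eqP => //; lia. Qed.

Lemma act_tauC i j f : act (tau i) (act (tau j) f) = act (tau j) (act (tau i) f).
Proof. by apply/funext => s; rewrite /act; congr f; apply/funext => x /=; rewrite tauC. Qed.

Lemma act_tauK j f : act (tau j) (act (tau j) f) = f.
Proof. by apply/funext => s; rewrite /act; congr f; apply/funext => x /=; rewrite tauK. Qed.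

Lemma mem_tau2 i j S : (j.*2 \in S) && (j.*2.+1 \in S) ->
  (j.*2 \in map (tau i) S) && (j.*2.+1 \in map (tau i) S).
Proof.
move=> /andP [a b]; have [->|ij] := eqVneq i j.
  by rewrite -{1}(tau_same j).2 -{2}(tau_same j).1 !mem_tau a b.
by rewrite -{1}(tau_other ij).1 -(tau_other ij).2 !mem_tau a b.
Qed.

(** The swaps commute, so each preserves the sign rule of the others. *)
Lemma Null_act i S f : Null S f -> Null (map (tau i) S) (act (tau i) f).
Proof.
elim=> [f1 L|j f1 j3 a b L||f1 f2 _ N1 _ N2].
- by rewrite actMn; apply: Null5; apply: lattice_act.
- rewrite actB act_signed act_tauC.
  have /andP [a' b'] : (j.*2 \in map (tau i) S) && (j.*2.+1 \in map (tau i) S).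
    by apply: mem_tau2; rewrite a b.
  by apply: Null_swap => //; apply: lattice_act.
- by rewrite act0; apply: Null_0.
- by rewrite actB; apply: Null_B.
Qed.

End Functions.

Section Products.

Variables (B : zmodType) (m : B -> B -> B).
Hypothesis mBl : forall x y z, m (x - y) z = m x z - m y z.
Hypothesis mBr : forall x y z, m z (x - y) = m z x - m z y.
Variable eps : seq bool.

Notation V := ((nat -> B) -> B).
Notation hat := (hat m).
Notation lattice := (lattice m).
Notation Null := (Null m eps).
Notation mulV := (mulV m).
Notation "x == y %[null S ]" := (eqN (Null S) x y)
  (at level 70, y at next level, format "x  ==  y  %[null  S ]").

Lemma Null_refl S x : x == x %[null S].
Proof. by apply: eqN_refl; apply: Null_0. Qed.
Lemma Null_trans S y x z : x == y %[null S] -> y == z %[null S] -> x == z %[null S].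
Proof. by apply: eqN_trans; [apply: Null_0|apply: Null_B]. Qed.
Lemma Null_sym S x y : x == y %[null S] -> y == x %[null S].
Proof. by apply: eqN_sym; [apply: Null_0|apply: Null_B]. Qed.
Lemma Null_N S x : Null S x -> Null S (- x).
Proof. by apply: NulN; [apply: Null_0|apply: Null_B]. Qed.
Lemma Null_signed S b x : Null S x -> Null S (signed b x).
Proof. by case: b => //=; apply: Null_N. Qed.
Lemma Null_signed2 S b x y : x == y %[null S] -> signed b x == signed b y %[null S].
Proof. by rewrite /eqN -signedB; apply: Null_signed. Qed.

Definition spells (S : seq nat) (k : key) : bool :=
  if k is l :: k' then valid_tag l (size k') && spellable S k' else false.

(** * Products of represented elements *)

Definition word_at (S : seq nat) (k : key) : V :=
  if spells S k then hat (tagged_word (head La k) (spelling S (behead k))) else 0.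

Lemma lattice_word_at S k : lattice S (word_at S k).
Proof.
rewrite /word_at; case: ifP => H; last exact: lattice0.
case: k H => [|l k] //= /andP [v c]; apply: lattice_word.
have [p _ _] := spelling_spec c; rewrite letters_tagged //.
by rewrite (perm_size p) -(size_spellable c).
Qed.

Lemma word_at5 S k : killed5 (Null S) (word_at S k).
Proof. by apply: Null5; apply: lattice_word_at. Qed.

Lemma spells_perm S S' k : good_slots S -> perm_eq S S' -> spells S k = spells S' k.
Proof.
move=> gd p; have p' : perm_eq S' S by rewrite perm_sym.
case: k => [|l k] //=; congr (_ && _); apply/idP/idP => c.
  by case: (spelling_perm gd p c).
by case: (spelling_perm (good_perm p gd) p' c).
Qed.

Lemma word_at_perm S S' k : good_slots S -> perm_eq S S' -> word_at S k = word_at S' k.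
Proof.
move=> gd p; rewrite /word_at -(spells_perm k gd p); case: ifP => // H.
case: k H => [|l k] //= /andP [_ c].
by case: (spelling_perm gd p c) => _ ->.
Qed.

Definition inversions (q : seq nat) : bool :=
  let c j := nth false eps j && before q j.*2.+1 j.*2 in c 0%N (+) (c 1%N (+) c 2%N).

Lemma flip_congruent l j q : good_slots q -> valid_tag l (size q) -> (j < 3)%N ->
  hat (tagged_word l q) == signed (nth false eps j && before q j.*2.+1 j.*2)
     (hat (tagged_word l (flip j q))) %[null q].
Proof.
move=> gq v j3; rewrite /flip; case: ifP => [/and3P [b a _]|_]; last first.
  by rewrite andbF; apply: Null_refl.
rewrite andbT -wmap_tagged // hat_wmap; apply: Null_swap => //.
by apply: lattice_word; rewrite letters_tagged.
Qed.

(** A word with arbitrary slots is congruent, up to a sign, to the word named by its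
    key: put the pairs in order one after the other, each at the cost of its sign. *)
Lemma sort_pairs l q : good_slots q -> valid_tag l (size q) ->
  spells q (l :: map letter_of q) /\
  hat (tagged_word l q) == signed (inversions q) (word_at q (l :: map letter_of q)) %[null q].
Proof.
move=> gq v; have uq : uniq q by case/andP: gq.
have [p0 e0 n0 o0] := flip_spec 0 uq; set q1 := flip 0 q in p0 e0 n0 o0 *.
have p0' : perm_eq q q1 by rewrite perm_sym.
have g1 : good_slots q1 := good_perm p0' gq; have u1 : uniq q1 by case/andP: g1.
have [p1 e1 n1 o1] := flip_spec 1 u1; set q2 := flip 1 q1 in p1 e1 n1 o1 *.
have p1' : perm_eq q1 q2 by rewrite perm_sym.
have g2 : good_slots q2 := good_perm p1' g1; have u2 : uniq q2 by case/andP: g2.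
have [p2 e2 n2 o2] := flip_spec 2 u2; set q3 := flip 2 q2 in p2 e2 n2 o2 *.
have p2' : perm_eq q2 q3 by rewrite perm_sym.
have s3 : std q3.
  by rewrite /std /= n2 !o2 // n1 o1 // n0.
have p3 : perm_eq q3 q by apply: perm_trans p2 (perm_trans p1 p0).
have [c cE] := spelling_eq gq p3 s3.
have E : map letter_of q3 = map letter_of q by rewrite e2 e1 e0.
rewrite E in c cE.
have PSq : spells q (l :: map letter_of q) by rewrite /= size_map v.
split=> //; rewrite /word_at PSq /= cE /inversions.
have v1 : valid_tag l (size q1) by rewrite (perm_size p0).
have v2 : valid_tag l (size q2) by rewrite (perm_size p1).
apply: Null_trans (flip_congruent (j := 0) gq v _) _ => //.
rewrite -signed_add; apply: Null_signed2; rewrite -/q1.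
have N1 := flip_congruent (j := 1) g1 v1 isT; rewrite -/q2 in N1.
apply: Null_trans (Null_perm p0 N1) _.
rewrite -signed_add (o0 1%N) //; apply: Null_signed2.
have N2 := flip_congruent (j := 2) g2 v2 isT; rewrite -/q3 in N2.
apply: Null_trans (Null_perm (perm_trans p1 p0) N2) _.
by rewrite (o1 2%N) // (o0 2%N) //; apply: Null_refl.
Qed.

Lemma mem_natE x s : mem_nat x s = (x \in s).
Proof. by elim: s => //= y s ->; rewrite inE eqnE. Qed.

Lemma before_cat p q j : std p -> std q -> uniq (p ++ q) -> (j < 3)%N ->
  before (p ++ q) j.*2.+1 j.*2 = (j.*2.+1 \in p) && (j.*2 \in q).
Proof.
move=> sp sq u j3; have := stdP sp j3; have := stdP sq j3.
rewrite /before !mem_cat !index_cat; move: u; rewrite cat_uniq => /and3P [_ /hasPn H _].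
have D x : x \in q -> x \in p = false by move=> xq; apply/negbTE; apply: H.
have I x : x \in p -> (index x p < size p)%N by rewrite index_mem.
case ap : (j.*2.+1 \in p); case bp : (j.*2 \in p) => /=.
- have -> : (j.*2 \in q) = false by apply/negP => /D; rewrite bp.
  by move=> _ /negbTE.
- by case bq : (j.*2 \in q) => //= _ _; rewrite (leq_trans (I _ ap)) ?leq_addr.
- have -> : (j.*2 \in q) = false by apply/negP => /D; rewrite bp.
  move=> _ _; case aq: (_ \in q) => //=; apply/negbTE; rewrite -leqNgt.
  by rewrite (leq_trans (ltnW (I _ bp))) ?leq_addr.
- by move=> + _; rewrite ltn_add2l => /negbTE.
Qed.

(** Two standard lists in a row have only the crossing pairs out of order, so the
    sign of [sort_pairs] is [crossing]. *)
Lemma word_at_mul S T k1 k2 : good_slots (S ++ T) -> spells S (Lc :: k1) -> spells T (Lc :: k2) ->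
  (size T <= 3)%N ->
  let k := tag (size T) :: k1 ++ k2 in
  spells (S ++ T) k /\
  mulV (word_at S (Lc :: k1)) (word_at T (Lc :: k2))
    == signed (crossing eps S T) (word_at (S ++ T) k) %[null S ++ T].
Proof.
move=> gST P1 P2 T3 k.
have -> : word_at S (Lc :: k1) = hat (left_comb (spelling S k1)) by rewrite /word_at P1.
have -> : word_at T (Lc :: k2) = hat (left_comb (spelling T k2)) by rewrite /word_at P2.
move: P1 P2 => /= /andP [z1 c1] /andP [z2 c2].
have [p1 s1 e1] := spelling_spec c1; have [p2 s2 e2] := spelling_spec c2.
set q1 := spelling S k1 in p1 s1 e1 *; set q2 := spelling T k2 in p2 s2 e2 *.
have pq : perm_eq (q1 ++ q2) (S ++ T) by apply: perm_cat.
have pq' : perm_eq (S ++ T) (q1 ++ q2) by rewrite perm_sym.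
have gq : good_slots (q1 ++ q2) := good_perm pq' gST.
have uq : uniq (q1 ++ q2) by case/andP: gq.
have sz2 : size q2 = size T := perm_size p2.
have sz1 : size q1 = size k1 by rewrite -e1 size_map.
have sk2 : size k2 = size T by rewrite (size_spellable c2).
rewrite sk2 in z2.
have v : valid_tag (tag (size T)) (size (q1 ++ q2)).
  rewrite size_cat sz1 sz2; move: z1 z2 T3.
  by case: (size T) => [|[|[|[|]]]] //=; lia.
have := sort_pairs gq v; rewrite map_cat e1 e2 -/k => -[Pk Nk].
have Pk' : spells (S ++ T) k by rewrite (spells_perm _ gST pq').
split; first exact: Pk'.
rewrite -hat_mul -(@tagged_cat (size T)) ?sz1 ?z2 //.
apply: Null_trans (Null_perm pq Nk) _.
rewrite (word_at_perm _ gq pq).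
suff -> : inversions (q1 ++ q2) = crossing eps S T by apply: Null_refl.
by rewrite /inversions /crossing !before_cat // !mem_natE !(perm_mem p1) !(perm_mem p2).
Qed.

Lemma sem_additive (W W' : zmodType) (phi : W -> W') v g :
  (forall x y, phi (x - y) = phi x - phi y) -> phi (sem v g) = sem v (fun k => phi (g k)).
Proof.
move=> phiB; have phi0 : phi 0 = 0 by rewrite -(subrr 0) phiB !subrr.
have phiN x : phi (- x) = - phi x by rewrite -sub0r phiB phi0 sub0r.
have phiD x y : phi (x + y) = phi x + phi y by rewrite -[y]opprK phiB phiN !opprK.
have phiM x n : phi (x *+ n) = phi x *+ n.
  by elim: n => [|n IH]; rewrite ?mulr0n // !mulrS phiD IH.
elim: v g => [|o a IHa b IHb c IHc d IHd] g //=.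
by rewrite !phiD IHa IHb IHc IHd; case: o => [x|]; rewrite ?phiM ?phi0.
Qed.

Lemma sem_signed v (g : key -> V) b : sem v (fun k => signed b (g k)) = signed b (sem v g).
Proof. by rewrite (@sem_additive V V (@signed B b)) // => x y; apply: signedB. Qed.

Lemma lattice_sem S v g : (forall k, lattice S (g k)) -> lattice S (sem v g).
Proof.
have latticeD x y : lattice S x -> lattice S y -> lattice S (x + y).
  by move=> Lx Ly; rewrite -[y]opprK; apply: latticeB => //; apply: latticeN.
have latticeM x n : lattice S x -> lattice S (x *+ n).
  by move=> Lx; elim: n => [|n IH]; rewrite ?mulr0n ?mulrS; [apply: lattice0|apply: latticeD].
elim: v g => [|o a IHa b IHb c IHc d IHd] g Hg /=; first exact: lattice0.
apply: (latticeD _ _); first by case: o => [x|]; [apply: latticeM | apply: lattice0].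
by do 3?apply: (latticeD _ _); [apply: IHa | apply: IHb | apply: IHc | apply: IHd].
Qed.

Lemma sem_left_part (W : zmodType) r (g : key -> W) : left_normed r ->
  sem r g = sem (left_part r) (fun k => g (Lc :: k)).
Proof. by case: r => [|[x|] [|? ? ? ? ?] [|? ? ? ? ?] c [|? ? ? ? ?]] //= _; rewrite !add0r addr0. Qed.

Lemma supp_left_part (P : key -> Prop) r : supp P r ->
  supp (fun k => P (Lc :: k)) (left_part r).
Proof. by case: r => [|o a b c d] /=; [move=> _; split | case/supp_node]. Qed.

Lemma sem_scaleS S x v :
  sem (scale x v) (word_at S) == sem v (word_at S) *+ valF x %[null S].
Proof. by apply: sem_scale; [apply: Null_0|apply: Null_B|apply: word_at5]. Qed.

Lemma sem_bindS S v f :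
  sem (bind v f Leaf) (word_at S) == sem v (fun k => sem (f k) (word_at S)) %[null S].
Proof.
have := @sem_bind _ (Null S) (Null_0 _ _ _) (@Null_B _ m eps S) v f Leaf _ (word_at5 S).
by rewrite [sem Leaf _]/= addr0.
Qed.

Lemma sem_suppS S (P : key -> Prop) v (g h : key -> V) :
  supp P v -> (forall k, P k -> g k == h k %[null S]) -> sem v g == sem v h %[null S].
Proof. by apply: sem_supp; [apply: Null_0|apply: Null_B]. Qed.

Lemma scale_signF S b v :
  sem (scale (signF b) v) (word_at S) == signed b (sem v (word_at S)) %[null S].
Proof.
apply: Null_trans (sem_scaleS _ _ _) _.
case: b => /=; last exact: Null_refl.
rewrite /eqN opprK -mulrSr; apply: Null5; apply: lattice_sem => k; exact: lattice_word_at.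
Qed.

(** A table is used for all sets of slots that spell its keys, not only for the set
    on which it was computed. *)
Definition table_ok (tb : trie vec) : Prop := forall S, good_slots S ->
  all_trie (fun k v => spells S k -> nf_ok (Null S) (spells S) (word_at S) k v) tb.

Lemma table_normal tb S k : table_ok tb -> good_slots S -> spells S k ->
  nf_ok (Null S) (spells S) (word_at S) k (normal tb k).
Proof.
move=> tb_ok gd Pk; rewrite /normal; case E : (get k tb) => [v|].
  exact: (all_trie_get (tb_ok S gd) E).
by split=> //; [apply: supp_single | rewrite sem_single; apply: Null_refl].
Qed.

Definition represents (x : elt) (f : V) : Prop :=
  [/\ good_slots (slots x), lattice (slots x) f &
      ok x -> supp (spells (slots x)) (row x) /\
              f == sem (row x) (word_at (slots x)) %[null (slots x)]].

(** Both factors may be replaced by their rows since [Null] is an ideal; then the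
    product is expanded into products of words, which the table rewrites. *)
Lemma mul0_ok tb x y f g : table_ok tb -> good_slots (slots x ++ slots y) ->
  represents x f -> represents y g -> represents (mul0 eps tb x y) (mulV f g).
Proof.
move=> tb_ok gd [gx Lx Hx] [gy Ly Hy]; split=> //=; first exact: lattice_mul.
case/and5P => /Hx [Px Nx] /Hy [Py Ny] lx ly y3.
set S := slots x in gd gx Lx Px Nx *; set T := slots y in gd gy Ly Py Ny y3 *.
have uST : uniq (S ++ T) by case/andP: gd.
have Px' := supp_left_part Px; have Py' := supp_left_part Py.
rewrite (sem_left_part _ lx) in Nx; rewrite (sem_left_part _ ly) in Ny.
set r1 := left_part _ in Px' Nx *; set r2 := left_part _ in Py' Ny *.
set h := fun k1 k2 => normal tb (tag (size T) :: k1 ++ k2).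
have Hh k1 k2 : spells S (Lc :: k1) -> spells T (Lc :: k2) ->
    supp (spells (S ++ T)) (h k1 k2) /\
    mulV (word_at S (Lc :: k1)) (word_at T (Lc :: k2)) ==
    signed (crossing eps S T) (sem (h k1 k2) (word_at (S ++ T))) %[null S ++ T].
  move=> P1 P2; have [Pk Nk] := word_at_mul gd P1 P2 y3.
  have [_ Ph Nh] := table_normal tb_ok gd Pk; split=> //.
  by apply: Null_trans Nk _; apply: Null_signed2.
split.
  apply: supp_scale; apply: supp_bind Px' _ _; last by split.
  move=> k1 P1; apply: supp_bind Py' _ _; last by split.
  by move=> k2 P2; case: (Hh k1 k2 P1 P2).
apply: Null_trans (Null_sym (scale_signF _ _ _)).
apply: (@Null_trans _ (mulV f (sem r2 (fun k => word_at T (Lc :: k))))).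
  by rewrite /eqN -mulVBr //; apply: Null_mulr.
apply: (@Null_trans _ (mulV (sem r1 (fun k => word_at S (Lc :: k))) (sem r2 (fun k => word_at T (Lc :: k))))).
  rewrite /eqN -mulVBl //; apply: Null_mull => //.
  by apply: lattice_sem => k; apply: lattice_word_at.
set phi := fun f => mulV f (sem r2 (fun k => word_at T (Lc :: k))).
rewrite -/(phi _) (@sem_additive _ _ phi); last by move=> ??; apply: mulVBl.
apply: Null_trans; last first.
  by apply: Null_signed2; apply: Null_sym; apply: sem_bindS.
rewrite -sem_signed.
apply: (sem_suppS Px') => k1 P1.
rewrite /phi (@sem_additive _ _ (mulV (word_at S (Lc :: k1)))); last by move=> ??; apply: mulVBr.
apply: Null_trans; last first.
  by apply: Null_signed2; apply: Null_sym; apply: sem_bindS.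
rewrite -sem_signed.
apply: (sem_suppS Py') => k2 P2.
by case: (Hh k1 k2 P1 P2).
Qed.

End Products.

Definition all_prop T (P : T -> Prop) (l : seq T) : Prop :=
  foldr (fun x Q => P x /\ Q) True l.

Lemma all_prop_cat T (P : T -> Prop) l1 l2 : all_prop P l1 -> all_prop P l2 -> all_prop P (l1 ++ l2).
Proof. by elim: l1 => //= x l1 IH [Px H1] H2; split=> //; apply: IH. Qed.

Lemma all_prop_flatten (T : eqType) U (P : U -> Prop) (F : T -> seq U) s :
  (forall x, x \in s -> all_prop P (F x)) -> all_prop P (flatten [seq F x | x <- s]).
Proof.
elim: s => //= x s IH H; apply: all_prop_cat; first by apply: H; rewrite mem_head.
by apply: IH => y ys; apply: H; rewrite inE ys orbT.
Qed.

Lemma all_prop_map T U (P : U -> Prop) (F : T -> U) s :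
  all_prop (fun x => P (F x)) s -> all_prop P (map F s).
Proof. by elim: s => //= x s IH [Px /IH]. Qed.

Lemma all_prop_sub T (P Q : T -> Prop) s : (forall x, P x -> Q x) -> all_prop P s -> all_prop Q s.
Proof. by move=> PQ; elim: s => //= x s IH [/PQ Qx /IH]. Qed.

Lemma subs_ok s n p : p \in subs s n -> perm_eq (p.1 ++ p.2) s /\ size p.1 = n.
Proof.
elim: s n p => [|x s IH] n p /=; first by case: n => //; rewrite inE => /eqP ->.
rewrite mem_cat => /orP [|/mapP [p' /IH [H1 H2] -> /=]]; last first.
  by split=> //; rewrite perm_catC /= perm_cons perm_catC.
by case: n => // n /mapP [p' /IH [H1 H2] -> /=]; rewrite perm_cons H1 H2.
Qed.

Lemma parts_ok ms s p : p \in parts s ms -> perm_eq (flatten p) s /\ map size p = ms.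
Proof.
elim: ms s p => [|n ms IH] s p /=; first by case: s => //; rewrite inE => /eqP ->.
case/flatten_mapP => q; rewrite mem_filter => /andP [_ /subs_ok [H1 H2]].
case/mapP => r /IH [H3 H4] -> /=; split; last by rewrite H2 H4.
by apply: perm_trans H1; rewrite perm_cat2l.
Qed.

Lemma good_cat S T : good_slots (S ++ T) -> good_slots S /\ good_slots T.
Proof.
by rewrite /good_slots cat_uniq all_cat => /andP [/and3P [-> _ ->] /andP [-> ->]].
Qed.

Lemma content_perm (k : key) : perm_eq (content k) k.
Proof.
rewrite /perm_eq; apply/allP => l _ /=; apply/eqP.
rewrite /content !count_cat !count_nseq.
by case: l; rewrite /= !mul1n !mul0n ?addn0 ?add0n.
Qed.

Lemma content_eq (k k' : key) : perm_eq k k' -> content k = content k'.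
Proof. by move/permP => E; rewrite /content !E. Qed.

(** A list of slots that spells the super-word becomes standard by [sort_pairs],
    applied to the zero product on the integers as only lists matter here. *)
Lemma spellable_perm S k : good_slots S -> perm_eq (map letter_of S) k -> spellable S k.
Proof.
move=> gd p; have := p; rewrite perm_sym => /(perm_iotaP La) [Is pI ->].
set q := [seq nth 0%N S i | i <- Is].
have sI : {in Is, forall i, (i < size S)%N}.
  by move=> i; rewrite (perm_mem pI) mem_iota size_map.
have pq : perm_eq q S.
  apply: (@perm_trans _ [seq nth 0%N S i | i <- iota 0 (size S)]).
    by apply: perm_map; rewrite -[size S](size_map letter_of).
  by rewrite map_nth_iota0 // take_size.
have -> : [seq nth La [seq letter_of i | i <- S] i | i <- Is] = map letter_of q.
  by rewrite -map_comp; apply/eq_in_map => i iI /=; rewrite (nth_map 0%N) // sI.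
have pq' : perm_eq S q by rewrite perm_sym.
have gq := good_perm pq' gd.
have [q0|q1] := posnP (size q).
  have S0 : S = [::] by apply/size0nil; rewrite -(perm_size pq).
  by move/size0nil: q0 => ->; rewrite S0.
have [c _] := @sort_pairs int (fun _ _ => 0) [::] Lc q gq q1.
by case/andP: c => _ c; case: (spelling_perm gq pq c).
Qed.

Lemma spellable_content S k : spellable S k -> perm_eq (map letter_of S) k.
Proof.
case/spelling_spec => p _ E; rewrite -[X in perm_eq _ X]E.
by apply: perm_map; rewrite perm_sym.
Qed.

(** A swap of a pair of which only the odd slot is present leads from any set to a
    low one, so tables are computed for low sets only. *)
Definition low (S : seq nat) : bool :=
  all (fun j => (j.*2.+1 \in S) ==> (j.*2 \in S)) (iota 0 3).

Lemma tau_good j S : (j < 3)%N -> good_slots S -> good_slots (map (tau j) S).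
Proof.
move=> j3 /andP [u /allP a]; rewrite /good_slots map_inj_uniq ?u //=; last exact: tau_inj.
by apply/allP => _ /mapP [x /a x7 ->]; rewrite /tau; do !case: eqP => //; lia.
Qed.

Definition settle (j : nat) (S : seq nat) : seq nat :=
  if (j.*2.+1 \in S) && (j.*2 \notin S) then map (tau j) S else S.

Lemma settle_spec j S : (j < 3)%N -> good_slots S ->
  [/\ good_slots (settle j S), perm_eq (map letter_of (settle j S)) (map letter_of S),
      (j.*2.+1 \in settle j S) ==> (j.*2 \in settle j S)
    & forall i, i != j -> ((i.*2.+1 \in settle j S) = (i.*2.+1 \in S)) *
                          ((i.*2 \in settle j S) = (i.*2 \in S))].
Proof.
move=> j3 gd; rewrite /settle; case: ifP => [/andP [a b]|/negbT]; last first.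
  by rewrite negb_and negbK -implybE => ?; split.
split.
- exact: tau_good.
- by rewrite -map_comp (eq_map (letter_of_tau j)).
- by rewrite -{1}(tau_same j).1 mem_tau (negbTE b).
move=> i ij; have ji : j != i by rewrite eq_sym.
by split; [rewrite -{1}(tau_other ji).2 | rewrite -{1}(tau_other ji).1]; rewrite mem_tau.
Qed.

Section Engine.

Variables (B : zmodType) (m : B -> B -> B).
Hypothesis mBl : forall x y z, m (x - y) z = m x z - m y z.
Hypothesis mBr : forall x y z, m z (x - y) = m z x - m z y.
Variable eps : seq bool.

Notation V := ((nat -> B) -> B).
Notation hat := (hat m).
Notation lattice := (lattice m).
Notation Null := (Null m eps).
Notation mulV := (mulV m).
Notation word_at := (word_at m).
Notation represents := (represents m eps).
Notation table_ok := (table_ok m eps).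
Notation "x == y %[null S ]" := (eqN (Null S) x y)
  (at level 70, y at next level, format "x  ==  y  %[null  S ]").

(** * Consequences of the identities *)

Definition rel_val (fs : seq V) (R : relation) : V :=
  foldr (fun bw f => signed bw.1 (word_eval mulV (nth 0 fs) bw.2) + f) 0 R.

Definition satisfies (R : relation) : Prop := forall s,
  foldr (fun bw x => (if bw.1 then - word_eval m s bw.2 else word_eval m s bw.2) + x) 0 R = 0.

Lemma word_evalV fs w s :
  word_eval mulV (nth 0 fs) w s = word_eval m (fun i => nth 0 fs i s) w.
Proof. by elim: w => //= u IHu v IHv; rewrite /mulV IHu IHv. Qed.

Lemma rel_val0 fs R : satisfies R -> rel_val fs R = 0.
Proof.
move=> H; apply/funext => s; rewrite -[RHS](H (fun i => nth 0 fs i s)).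
elim: R {H} => //= -[b w] R IH /=; rewrite -IH -word_evalV.
by case: b.
Qed.

Hypothesis satA : satisfies relA.
Hypothesis satJ : satisfies relJ.
Hypothesis satK : satisfies relK.

Lemma mul_anticomm x y : m x y = - m y x.
Proof.
have := satA (fun i => if i is 0%N then x else y).
by rewrite /= addr0 => /eqP; rewrite addr_eq0 => /eqP.
Qed.

Lemma mulVC f g : mulV f g = - mulV g f.
Proof. by apply/funext => s; apply: mul_anticomm. Qed.

Lemma signF_mul S b x : lattice S x -> x *+ valF (signF b) == signed b x %[null S].
Proof.
case: b => /= Lx; last exact: Null_refl.
by rewrite /eqN opprK -mulrSr; apply: Null5.
Qed.

Lemma opp_ok x f : represents x f -> represents (opp_elt x) (- f).
Proof.
case=> gx Lx Hx; split=> //=; first exact: latticeN.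
move=> /Hx [Px Nx]; split; first exact: supp_scale.
apply: Null_trans (Null_sym (@scale_signF _ m eps _ true _)).
exact: (@Null_signed2 _ _ _ _ true).
Qed.

(** The shorter factor goes to the right, by anticommutativity. *)
Lemma mul_ok tb x y f g : table_ok tb -> good_slots (slots x ++ slots y) ->
  represents x f -> represents y g ->
  represents (mul eps tb x y) (mulV f g) /\
  perm_eq (slots (mul eps tb x y)) (slots x ++ slots y).
Proof.
move=> tb_ok gd rx ry; rewrite /mul; case: ifP => _ /=; last by split=> //; apply: mul0_ok.
split; last by rewrite perm_catC.
rewrite mulVC; apply: opp_ok; apply: mul0_ok => //.
by apply: good_perm gd; rewrite perm_catC.
Qed.

Definition slots_at (args : seq elt) (I : seq nat) : seq nat :=
  flatten [seq slots (nth (Elt [::] Leaf false) args i) | i <- I].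

Lemma slots_at_good args I : good_slots (flatten (map slots args)) ->
  uniq I -> all (fun i => i < size args)%N I -> good_slots (slots_at args I).
Proof.
move=> gd uI aI; pose I' := [seq i <- iota 0 (size args) | i \notin I].
have p : perm_eq (iota 0 (size args)) (I ++ I').
  apply: uniq_perm; first exact: iota_uniq.
    rewrite cat_uniq uI filter_uniq ?iota_uniq ?andbT //=.
    by apply/hasPn => i; rewrite mem_filter => /andP [].
  move=> i; rewrite mem_cat mem_filter mem_iota /=.
  by case iI : (i \in I) => //=; have /allP := aI; apply.
have p' : perm_eq (flatten (map slots args)) (slots_at args (I ++ I')).
  rewrite -{1}[args](mkseq_nth (Elt [::] Leaf false)) /mkseq -map_comp.
  by apply: perm_flatten; apply: perm_map.
have := good_perm p' gd; rewrite /slots_at map_cat flatten_cat.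
by case/good_cat.
Qed.

Definition args_ok (args : seq elt) (fs : seq V) : Prop :=
  good_slots (flatten (map slots args)) /\
  forall i, (i < size args)%N ->
    represents (nth (Elt [::] Leaf false) args i) (nth 0 fs i).

Lemma evalw_ok tb args fs w : table_ok tb -> args_ok args fs ->
  uniq (letters w) -> all (fun i => i < size args)%N (letters w) ->
  represents (evalw eps tb args w) (word_eval mulV (nth 0 fs) w) /\
  perm_eq (slots (evalw eps tb args w)) (slots_at args (letters w)).
Proof.
move=> tb_ok [gd Hargs]; elim: w => [i|u IHu v IHv] /=.
  by rewrite andbT => _ iw; split; [apply: Hargs | rewrite /slots_at /= cats0].
move=> uw aw; have gw := slots_at_good gd uw aw.
move: uw aw; rewrite cat_uniq all_cat => /and3P [uu _ uv] /andP [au av].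
have [ru pu] := IHu uu au; have [rv pv] := IHv uv av.
have E : slots_at args (letters u ++ letters v) = slots_at args (letters u) ++ slots_at args (letters v).
  by rewrite /slots_at map_cat flatten_cat.
rewrite E in gw *.
have p : perm_eq (slots (evalw eps tb args u) ++ slots (evalw eps tb args v))
  (slots_at args (letters u) ++ slots_at args (letters v)) by apply: perm_cat.
have p' : perm_eq (slots_at args (letters u) ++ slots_at args (letters v))
   (slots (evalw eps tb args u) ++ slots (evalw eps tb args v)) by rewrite perm_sym.
have [r q] := mul_ok tb_ok (good_perm p' gw) ru rv.
by split=> //; apply: perm_trans q p.
Qed.

Lemma represents_perm x f S : represents x f -> perm_eq (slots x) S -> ok x ->
  supp (spells S) (row x) /\ f == sem (row x) (word_at S) %[null S].
Proof.
move=> [gx _ H] p /H [Px Nx]; split.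
  by apply: supp_sub Px => k; rewrite (spells_perm _ gx p).
by rewrite -(sem_eq _ (fun k => word_at_perm m k gx p)); apply: Null_perm Nx.
Qed.

Definition multilinear (R : relation) (n : nat) : bool :=
  all (fun bw => perm_eq (letters bw.2) (iota 0 n)) R.

(** In an algebra that satisfies the relation its value is 0, so that the row is a
    null row. *)
Lemma rel_row_ok tb args fs R S : table_ok tb -> args_ok args fs ->
  multilinear R (size args) -> perm_eq (flatten (map slots args)) S ->
  (rel_row eps tb args R).2 ->
  supp (spells S) (rel_row eps tb args R).1 /\
  rel_val fs R == sem (rel_row eps tb args R).1 (word_at S) %[null S].
Proof.
move=> tb_ok a_ok mlR pS; have [gd _] := a_ok.
have gS' : good_slots S := good_perm pS gd.
elim: R mlR => [|[b w] R IH] /=; first by move=> _ _; split; [split | apply: Null_refl].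
case/andP => mlw /IH; case: (rel_row _ _ _ _) => r o /= {}IH /andP [ok1 /IH [Pr Nr]].
have uw : uniq (letters w) by rewrite (perm_uniq mlw) iota_uniq.
have aw : all (fun i => i < size args)%N (letters w).
  by rewrite (perm_all _ mlw); apply/allP => i; rewrite mem_iota.
have [rw pw] := evalw_ok tb_ok a_ok uw aw.
have pwS : perm_eq (slots (evalw eps tb args w)) S.
  apply: perm_trans pw _; apply: perm_trans pS; rewrite /slots_at.
  apply: (@perm_trans _ (flatten [seq slots (nth (Elt [::] Leaf false) args i) | i <- iota 0 (size args)])).
    by apply: perm_flatten; apply: perm_map.
  by rewrite -{3}[args](mkseq_nth (Elt [::] Leaf false)) /mkseq -map_comp.
have [Pw Nw] := represents_perm rw pwS ok1.
split; first exact: supp_axpy.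
apply: Null_trans (Null_sym (@sem_axpy _ _ (Null_0 _ _ _) (@Null_B _ m eps S) _ _ _ _ (word_at5 _ _ _))).
apply: eqND; [exact: Null_0|exact: Null_B| |exact: Nr].
apply: (@Null_trans _ _ _ _ (signed b (sem (row (evalw eps tb args w)) (word_at S)))).
  exact: Null_signed2.
by apply: Null_sym; apply: signF_mul; apply: lattice_sem => k; apply: lattice_word_at.
Qed.

(** * Transport of normal forms *)

Lemma std_tau j q : (j < 3)%N -> ~~ ((j.*2 \in q) && (j.*2.+1 \in q)) ->
  std q -> std (map (tau j) q).
Proof.
move=> j3 N /allP sq; apply/allP => i i3; have := sq _ i3.
have bE x y : before (map (tau j) q) (tau j x) (tau j y) = before q x y.
  by rewrite /before !mem_tau !index_tau.
have [->|ij] := eqVneq i j; last first.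
  have ji : j != i by rewrite eq_sym.
  by have := bE i.*2.+1 i.*2; rewrite !(tau_other ji) => ->.
move=> _; rewrite -{1}(tau_same j).1 -{2}(tau_same j).2 bE /before.
by apply/negP => /and3P [a b _]; rewrite a b in N.
Qed.

Lemma spellable_tau j S k : (j < 3)%N -> good_slots S ->
  ~~ ((j.*2 \in S) && (j.*2.+1 \in S)) ->
  spellable S k -> spellable (map (tau j) S) k /\ spelling (map (tau j) S) k = map (tau j) (spelling S k).
Proof.
move=> j3 gd N c; have [p s E] := spelling_spec c.
have E' : map letter_of (map (tau j) (spelling S k)) = k.
  by rewrite -map_comp (eq_map (letter_of_tau j)) E.
rewrite -{1 2}E'; apply: spelling_eq; first exact: tau_good.
  exact: perm_map.
by apply: std_tau => //; rewrite !(perm_mem p).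
Qed.

Lemma mapK_tau j S : map (tau j) (map (tau j) S) = S.
Proof. by rewrite -map_comp -[RHS]map_id; apply: eq_map => x /=; apply: tauK. Qed.

Lemma mem_tau' j S : (j.*2 \in map (tau j) S) && (j.*2.+1 \in map (tau j) S)
  = (j.*2 \in S) && (j.*2.+1 \in S).
Proof.
rewrite -{1}(tau_same j).2 -{2}(tau_same j).1 !mem_tau.
by rewrite andbC.
Qed.

Lemma spells_tau j S k : (j < 3)%N -> good_slots S ->
  ~~ ((j.*2 \in S) && (j.*2.+1 \in S)) -> spells (map (tau j) S) k = spells S k.
Proof.
move=> j3 gd N; case: k => [|l k] //=; congr (_ && _); apply/idP/idP => c.
  rewrite -[S](mapK_tau j).
  by case: (@spellable_tau j (map (tau j) S) k j3 _ _ c); rewrite ?mem_tau' //; apply: tau_good.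
by case: (spellable_tau j3 gd N c).
Qed.

(** If not both slots of the pair j are in [S], the swap of the pair only renames a
    slot, and standard lists stay standard. *)
Lemma word_at_tau j S k : (j < 3)%N -> good_slots S ->
  ~~ ((j.*2 \in S) && (j.*2.+1 \in S)) -> word_at (map (tau j) S) k = act (tau j) (word_at S k).
Proof.
move=> j3 gd N; rewrite /word_at spells_tau //; case: ifP => // P.
case: k P => [|l k] //= /andP [v c].
have [_ ->] := spellable_tau j3 gd N c; rewrite -wmap_tagged ?hat_wmap //.
by rewrite (size_spelling c) -(size_spellable c).
Qed.

Definition nf_at (S : seq nat) := nf_ok (Null S) (spells S) (word_at S).

Lemma act_sem sigma v (g : key -> V) : act sigma (sem v g) = sem v (fun k => act sigma (g k)).
Proof. exact: (@sem_additive V V (act sigma)). Qed.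

Lemma nf_tau j S k v : (j < 3)%N -> good_slots S ->
  ~~ ((j.*2 \in S) && (j.*2.+1 \in S)) -> nf_at S k v -> nf_at (map (tau j) S) k v.
Proof.
move=> j3 gd N [Pk Pv Nk]; split; first by rewrite spells_tau.
  by apply: supp_sub Pv => k'; rewrite spells_tau.
rewrite (word_at_tau _ j3 gd N) (sem_eq _ (fun k => word_at_tau k j3 gd N)) -act_sem.
by rewrite /eqN -actB; apply: Null_act.
Qed.

Lemma nf_perm S S' k v : good_slots S -> perm_eq S S' -> nf_at S k v -> nf_at S' k v.
Proof.
move=> gd p [Pk Pv Nk]; split; first by rewrite -(spells_perm _ gd p).
  by apply: supp_sub Pv => k'; rewrite (spells_perm _ gd p).
rewrite -(word_at_perm m k gd p) -(sem_eq _ (fun k => word_at_perm m k gd p)).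
exact: Null_perm Nk.
Qed.

Lemma nf_settle j S k v : (j < 3)%N -> good_slots S ->
  nf_at (settle j S) k v -> nf_at S k v.
Proof.
move=> j3 gd; rewrite /settle; case: ifP => // /andP [a b] H.
rewrite -[S](mapK_tau j); apply: nf_tau => //; first exact: tau_good.
by rewrite mem_tau' (negbTE b).
Qed.

(** A low set is determined by its content: one slot of a pair must be the even one. *)
Lemma low_eq S S' : good_slots S -> good_slots S' -> low S -> low S' ->
  perm_eq (map letter_of S) (map letter_of S') -> perm_eq S S'.
Proof.
move=> /andP [uS aS] /andP [uS' aS'] lS lS' /permP p; apply: uniq_perm => // x.
have cnt U l : uniq U -> all (fun x => x < 7)%N U ->
    count_mem l (map letter_of U) = count (fun y => y \in U) [seq y <- iota 0 7 | letter_of y == l].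
  move=> uU aU; rewrite count_map -!size_filter; apply: perm_size.
  rewrite -filter_predI; apply: uniq_perm; rewrite ?filter_uniq ?iota_uniq //.
  move=> y; rewrite !mem_filter mem_iota /= add0n.
  case yU : (y \in U); rewrite ?andbF ?andbT //=.
  by have /allP/(_ _ yU) -> := aU; rewrite andbT.
have C l : count (fun y => y \in S) [seq y <- iota 0 7 | letter_of y == l]
    = count (fun y => y \in S') [seq y <- iota 0 7 | letter_of y == l].
  by rewrite -!cnt.
have [x7|x7] := ltnP x 7; last first.
  by apply/idP/idP => xU; [have /allP/(_ _ xU) := aS | have /allP/(_ _ xU) := aS']; lia.
have := (C La, C Lb, C Lc, C Ld); move: lS lS'; rewrite /low /= !addn0.
case=> /and4P [l0 l1 l2 _] /and4P [l0' l1' l2' _] [[[c0 c1] c2] c3].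
have pair (a b a' b' : bool) : (b ==> a)%B -> (b' ==> a')%B ->
    (a + b = a' + b')%N -> a = a' /\ b = b'.
  by case: a; case: b; case: a'; case: b'.
have [e0 e1] := pair _ _ _ _ l0 l0' c0; have [e2 e3] := pair _ _ _ _ l1 l1' c1.
have [e4 e5] := pair _ _ _ _ l2 l2' c2.
have e6 : (6 \in S) = (6 \in S') by move: c3; do 2!case: (_ \in _).
by move: {C c0 c1 c2 c3 l0 l1 l2 l0' l1' l2' p cnt} x7; do 7?[case: x => [//|x]].
Qed.

(** A normal form found on a low set of slots holds on every set of slots with the
    same content: rename the slots by swaps until the set is low. *)
Lemma nf_transport S0 S k v : good_slots S0 -> low S0 -> nf_at S0 k v ->
  good_slots S -> spells S k -> nf_at S k v.
Proof.
move=> g0 l0 H gd Pk; have [P0 _ _] := H.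
have pl : perm_eq (map letter_of S0) (map letter_of S).
  case: k Pk P0 {H} => [|l k] //= /andP [_ /spellable_content c] /andP [_ /spellable_content c0].
  by apply: perm_trans c0 _; rewrite perm_sym.
have [g1 p1 s1 o1] := @settle_spec 0 S isT gd; set S1 := settle 0 S in g1 p1 s1 o1.
have [g2 p2 s2 o2] := @settle_spec 1 S1 isT g1; set S2 := settle 1 S1 in g2 p2 s2 o2.
have [g3 p3 s3 o3] := @settle_spec 2 S2 isT g2; set S3 := settle 2 S2 in g3 p3 s3 o3.
have l3 : low S3.
  rewrite /low /= s3 andbT !andbT; move: s1 s2; rewrite -!(o3 1%N) // -!(o2 0%N) // -!(o3 0%N) //.
  by move=> -> ->.
have p : perm_eq S0 S3.
  apply: low_eq => //; apply: perm_trans pl _; rewrite perm_sym.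
  by apply: perm_trans p3 (perm_trans p2 p1).
apply: (@nf_settle 0) => //; apply: (@nf_settle 1) => //; apply: (@nf_settle 2) => //.
exact: nf_perm p H.
Qed.

End Engine.

(** * Soundness of the tables *)

Arguments insert : simpl never.

Definition basis_ok (N : basis) : Prop := all_trie (fun c ks => all (perm_eq^~ c) ks) N.

Lemma keys_of_ok N c k : basis_ok N -> k \in keys_of N c -> perm_eq k c.
Proof.
move=> N_ok; rewrite /keys_of; case E: (get _ N) => [ks|] // kks.
have /allP/(_ _ kks) p := all_trie_get N_ok E.
by apply: perm_trans p (content_perm c).
Qed.

Lemma all_sets_ok : all (fun S => [&& good_slots S, low S & (0 < size S)%N]) all_sets.
Proof. by vm_compute. Qed.

Lemma families_ok n f : f \in families n ->
  multilinear f.1 (size f.2) && all (fun x => 0 < x)%N f.2.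
Proof.
have: all (fun n => all (fun f => multilinear f.1 (size f.2) && all (fun x => 0 < x)%N f.2)
   (families n)) (iota 0 8) by vm_compute.
move/allP => H; have [n8|n8] := ltnP n 8.
  by have := H n; rewrite mem_iota => /(_ n8) /allP h /h.
by do 8?[case: n n8 => [|n] // n8].
Qed.

Section Engine.

Variables (B : zmodType) (m : B -> B -> B).
Hypothesis mBl : forall x y z, m (x - y) z = m x z - m y z.
Hypothesis mBr : forall x y z, m z (x - y) = m z x - m z y.
Variable eps : seq bool.

Notation V := ((nat -> B) -> B).
Notation hat := (hat m).
Notation lattice := (lattice m).
Notation Null := (Null m eps).
Notation mulV := (mulV m).
Notation word_at := (word_at m).
Notation represents := (represents m eps).
Notation table_ok := (table_ok m eps).
Notation "x == y %[null S ]" := (eqN (Null S) x y)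
  (at level 70, y at next level, format "x  ==  y  %[null  S ]").
Hypothesis satA : satisfies m relA.
Hypothesis satJ : satisfies m relJ.
Hypothesis satK : satisfies m relK.

Lemma families_sat n f : f \in families n -> satisfies m f.1.
Proof.
have [n8|n8] := ltnP n 8; last by do 8?[case: n n8 => [|n] // n8].
do 8?[case: n n8 => [|n] // n8] => /=; rewrite ?inE //;
  by do ?[case/orP]; move/eqP ->.
Qed.

Lemma choices_ok N ss : basis_ok N -> all (fun s => 0 < size s)%N ss ->
  good_slots (flatten ss) ->
  all_prop (fun args : seq elt => map slots args = ss /\ exists fs, args_ok m eps args fs) (choices N ss).
Proof.
move=> N_ok; elim: ss => [|s ss IH] /=.
  by move=> _ _; split=> //; split=> //; exists [::].
case/andP => s0 ss0 gd; have [gs gss] := good_cat gd.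
apply: all_prop_flatten => k kN; apply: all_prop_map.
apply: all_prop_sub (IH ss0 gss) => c [E [fs [gc Hc]]]; split; first by rewrite /= E.
have p := keys_of_ok N_ok kN.
have Pk : spells s (Lc :: k).
  rewrite /= (perm_size p) size_map s0 spellable_perm //.
  by rewrite perm_sym.
exists (word_at s (Lc :: k) :: fs); split; first by rewrite /= E.
case=> [_|i]; last exact: Hc.
split; [exact: gs | exact: lattice_word_at | move=> _; split].
  exact: (supp_single f1 Pk).
rewrite -[X in eqN _ _ X]/(sem (single (Lc :: k) f1) (word_at s)) sem_single; exact: Null_refl.
Qed.

Definition good_rel (S : seq nat) (r : relation * seq elt) : Prop :=
  satisfies m r.1 /\ multilinear r.1 (size r.2) /\
  perm_eq (flatten (map slots r.2)) S /\ exists fs, args_ok m eps r.2 fs.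

Lemma relations_ok N S : basis_ok N -> good_slots S -> all_prop (good_rel S) (relations N S).
Proof.
move=> N_ok gd; apply: all_prop_flatten => f fF; apply: all_prop_flatten => p pP.
have /andP [ml pos] := families_ok fF.
have [pS sz] := parts_ok pP.
have gp : good_slots (flatten p) by apply: good_perm gd; rewrite perm_sym.
have p0 : all (fun s => 0 < size s)%N p by rewrite -(all_map size (fun x => 0 < x)%N) sz.
apply: all_prop_map; apply: all_prop_sub (choices_ok N_ok p0 gp) => c [E [fs Hc]].
split=> /=; first exact: families_sat fF.
rewrite E; split; last by split=> //; exists fs.
by rewrite -(size_map slots c) E -(size_map size p) sz.
Qed.

(** A substitution instance of an identity of the algebra has a null row, so the
    pivots stay null rows for every choice of the mask. *)
Lemma add_rels_ok tb S rs mask piv : table_ok tb -> all_prop (good_rel S) rs ->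
  pivots_ok (Null S) (spells S) (word_at S) piv ->
  pivots_ok (Null S) (spells S) (word_at S) (add_rels eps tb rs mask piv).1.
Proof.
move=> tb_ok; elim: rs mask piv => [|r rs IH] mask piv //= [Hr Hrs] Hp.
case: mask => [mask|mask|] //; last exact: IH.
have [sat [ml [p [fs a_ok]]]] := Hr.
have := rel_row_ok mBl mBr satA tb_ok a_ok ml p.
case: (rel_row _ _ _ _) => v o /= H; apply: IH => //.
case: o H => // /(_ isT) [Pv Nv].
apply: (@insert_ok V (Null S) (Null_0 m eps S) (@Null_B _ m eps S) (spells S) (word_at S) _ _ _ (@word_at5 _ m eps S) Hp).
split=> //.
move: Nv; rewrite rel_val0 // => /Null_sym.
by rewrite /eqN subr0.
Qed.

Lemma add_normal_forms_ok tb S nf : table_ok tb -> good_slots S -> low S ->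
  all_trie (nf_at m eps S) nf -> table_ok (add_normal_forms nf tb).
Proof.
move=> tb_ok gd l H S' gd'; rewrite /add_normal_forms.
have : all_entries (nf_at m eps S) (entries nf [::] [::]).
  by apply: all_entriesP => // k v; apply: (all_trie_get H).
elim: (entries _ _ _) => [_|[k v] es IH] /=; first exact: tb_ok.
case=> Hk /IH {}IH; apply: all_trie_put => // Pk.
exact: (nf_transport gd l Hk gd' Pk).
Qed.

Lemma new_keys_ok N tb S k : basis_ok N -> k \in new_keys N tb S ->
  perm_eq k (content (map letter_of S)).
Proof.
move=> N_ok /flatten_mapP [p]; rewrite mem_filter => /andP [_ /subs_ok [pS sz]].
rewrite mem_filter => /andP [_ /allpairsP [[x k'] /= [xp kN ->]]].
have pk := keys_of_ok N_ok kN.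
have p2 : p.2 = [:: x].
  have := perm_size pS; rewrite size_cat sz; case: (p.2) xp => [|y [|z q]] //=.
    by rewrite inE => /eqP ->.
  by move=> _; lia.
rewrite perm_sym; apply: perm_trans (content_perm _) _.
apply: (@perm_trans _ (map letter_of (p.1 ++ p.2))).
  by apply: perm_map; rewrite perm_sym.
by rewrite p2 map_cat cats1 -!cats1 perm_cat2r perm_sym.
Qed.

Definition state_ok (st : trie vec * basis * positive) : Prop :=
  table_ok st.1.1 /\ basis_ok st.1.2.

Lemma step_ok st S : state_ok st -> good_slots S -> low S ->
  state_ok (step eps st S).
Proof.
case: st => [[tb N] mask] [/= tb_ok N_ok] gd l; rewrite /step.
case: ifP => [_|_]; first by split=> //=; apply: all_trie_put; rewrite //= perm_sym content_perm.
have := add_rels_ok mask tb_ok (relations_ok N_ok gd) (_ : pivots_ok _ _ _ Leaf).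
case: (add_rels _ _ _ _ _) => piv mask' /= H.
split=> /=.
  apply: add_normal_forms_ok gd l _ => //.
  apply: solve_ok; [exact: Null_0|exact: Null_B|exact: word_at5|].
  by apply: H; split.
apply: all_trie_put => //; apply/allP => k kN.
exact: new_keys_ok kN.
Qed.

Lemma run_ok mask : state_ok (run eps mask).
Proof.
rewrite /run.
have : state_ok (Leaf, Leaf, mask) by split=> [S gd|]; split.
elim: all_sets all_sets_ok (Leaf, Leaf, mask) => //= S ss IH /andP [/and3P [gd l _] H] st st_ok.
by apply: IH => //; apply: step_ok.
Qed.

Lemma supported_ok v t (P : key -> Prop) : supported v t ->
  (forall k, get k t -> P k) -> supp P v.
Proof.
elim: v t P => [|o a IHa b IHb c IHc d IHd] t P /=; first by split.
case: t => // o' a' b' c' d' /and5P [ho ha hb hc hd] H; apply/supp_node; split.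
- by case: o ho => // x; case: o' H => // y H _ _; apply: (H [::]).
- by apply: IHa ha _ => k kk; apply: (H (La :: k)).
- by apply: IHb hb _ => k kk; apply: (H (Lb :: k)).
- by apply: IHc hc _ => k kk; apply: (H (Lc :: k)).
- by apply: IHd hd _ => k kk; apply: (H (Ld :: k)).
Qed.

Lemma get_key_set ks k : get k (key_set ks) -> k \in ks.
Proof.
elim: ks => [|k' ks IH] //=; case E: (get k _) => [u|] // _.
case: (get_put E) => [[-> _]|E']; first exact: mem_head.
by rewrite inE IH ?orbT // E'.
Qed.

Fixpoint subsets (s : seq nat) : seq (seq nat) :=
  if s is x :: s' then [seq x :: t | t <- subsets s'] ++ subsets s' else [:: [::]].

Lemma filter_subsets P s : filter P s \in subsets s.
Proof.
elim: s => //= x s IH; rewrite mem_cat; case: ifP => _; last by rewrite IH orbT.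
by rewrite map_f.
Qed.

(** Every nonempty set of slots has the content of a canonical one; all 128 sets are
    tried. *)
Lemma content_mem S : good_slots S -> (0 < size S)%N -> content (map letter_of S) \in contents.
Proof.
move=> /andP [uS /allP aS] S0; pose T := [seq x <- iota 0 7 | x \in S].
have p : perm_eq S T.
  apply: uniq_perm => //; first by rewrite filter_uniq ?iota_uniq.
  move=> x; rewrite mem_filter mem_iota /=; case xS : (x \in S) => //=.
  by rewrite add0n aS.
have : all (fun T => (0 < size T)%N ==> (content (map letter_of T) \in contents))
  (subsets (iota 0 7)) by vm_compute.
move/allP/(_ T (filter_subsets _ _)); rewrite -(perm_size p) S0 /=.
by rewrite (content_eq (perm_map letter_of p)).
Qed.

(** * Normal words span *)

Section Span.

Variables (tb : trie vec) (N : basis).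
Hypothesis tb_ok : table_ok tb.
Hypothesis N_ok : basis_ok N.
Hypothesis closedN : mul_closed tb N.

Definition in_basis (S : seq nat) (k : key) : bool := k \in keys_of N (map letter_of S).

Definition spanned (S : seq nat) (f : V) : Prop :=
  exists2 v, supp (in_basis S) v & f == sem v (fun k => word_at S (Lc :: k)) %[null S].

Lemma keys_of_content c c' : content c = content c' -> keys_of N c = keys_of N c'.
Proof. by rewrite /keys_of => ->. Qed.

Lemma content_id c : content (content c) = content c.
Proof. exact/content_eq/content_perm. Qed.

Lemma closed_normal S T k1 k2 : good_slots (S ++ T) -> (0 < size T <= size S)%N ->
  in_basis S k1 -> in_basis T k2 ->
  let r := normal tb (tag (size T) :: k1 ++ k2) in
  left_normed r /\ supp (in_basis (S ++ T)) (left_part r).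
Proof.
move=> gd /andP [T0 TS] b1 b2 r; have [gs gt] := good_cat gd.
have S0 : (0 < size S)%N := leq_trans T0 TS.
have sz U : size (content (map letter_of U)) = size U.
  by rewrite (perm_size (content_perm _)) size_map.
have c1 := content_mem gs S0; have c2 := content_mem gt T0.
have c12 : content (content (map letter_of S) ++ content (map letter_of T))
    = content (map letter_of (S ++ T)).
  by rewrite map_cat; apply/content_eq/perm_cat; apply: content_perm.
have c3 : content (content (map letter_of S) ++ content (map letter_of T)) \in contents.
  by rewrite c12; apply: content_mem => //; rewrite size_cat addn_gt0 S0.
move: closedN => /andP [_ /allP /(_ _ c1) /allP /(_ _ c2)].
rewrite !sz ltnNge TS /= c3 /= => /allP.
move=> /(_ k1); rewrite (keys_of_content (content_id _)) => /(_ b1) /allP.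
move=> /(_ k2); rewrite (keys_of_content (content_id _)) => /(_ b2) /andP [lr sr].
split=> //; apply: supported_ok sr _ => k /get_key_set.
by rewrite /in_basis c12 (keys_of_content (content_id _)).
Qed.

Lemma sem_left (W : zmodType) r (g : key -> W) :
  supp (fun k => exists k', k = Lc :: k') r -> sem r g = sem (left_part r) (fun k => g (Lc :: k)).
Proof.
have sem0 P v (h : key -> W) : (forall k, ~ P k) -> supp P v -> sem v h = 0.
  elim: v P h => [|o a IHa b IHb c IHc d IHd] P h //= nP /supp_node [Ho Ha Hb Hc Hd].
  rewrite (IHa _ _ (fun k => nP (La :: k)) Ha) (IHb _ _ (fun k => nP (Lb :: k)) Hb).
  rewrite (IHc _ _ (fun k => nP (Lc :: k)) Hc) (IHd _ _ (fun k => nP (Ld :: k)) Hd).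
  by case: o Ho => [x|] Ho; [have := nP [::] (Ho isT) | rewrite !addr0].
case: r => [|o a b c d] //= /supp_node [Ho Ha Hb _ Hd].
rewrite (sem0 _ _ _ _ Ha) ?(sem0 _ _ _ _ Hb) ?(sem0 _ _ _ _ Hd) ?add0r ?addr0; try by move=> k [].
by case: o Ho => [x|] Ho; [have [] := Ho isT | rewrite add0r].
Qed.

Lemma spanned_mul S T f g : good_slots (S ++ T) -> (0 < size T <= size S)%N ->
  lattice S f -> lattice T g -> spanned S f -> spanned T g -> spanned (S ++ T) (mulV f g).
Proof.
move=> gd TS Lf Lg [v1 P1 N1] [v2 P2 N2]; have [gs gt] := good_cat gd.
have S0 : (0 < size S)%N by case/andP: TS => T0 /(leq_trans T0).
have rep U h v : good_slots U -> (0 < size U)%N -> lattice U h -> supp (in_basis U) v ->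
    h == sem v (fun k => word_at U (Lc :: k)) %[null U] ->
    represents (Elt U (Node None Leaf Leaf v Leaf) true) h.
  move=> gU U0 Lh Pv Nv; split=> // _; split=> /=; last by rewrite !add0r addr0.
  apply/supp_node; split; [by []|by split|by split| |by split].
  apply: supp_sub Pv => k /(keys_of_ok N_ok) pk /=.
  by rewrite (perm_size pk) size_map U0 spellable_perm // perm_sym.
have r1 := rep _ _ _ gs S0 Lf P1 N1.
have r2 : represents (Elt T (Node None Leaf Leaf v2 Leaf) true) g.
  by apply: rep => //; case/andP: TS.
pose x1 := Elt S (Node None Leaf Leaf v1 Leaf) true.
pose x2 := Elt T (Node None Leaf Leaf v2 Leaf) true.
have [_ _] := @mul0_ok _ _ mBl mBr eps tb x1 x2 f g tb_ok gd r1 r2.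
have T3 : (size T <= 3)%N.
  have : (size (S ++ T) <= 7)%N.
    have /andP [u /allP a] := gd; rewrite -(size_iota 0 7); apply: uniq_leq_size => // x /a.
    by rewrite mem_iota.
  by rewrite size_cat; case/andP: TS; lia.
set r := row _ => H; have [|_ Nr] := H; first by rewrite /= T3.
have Pr : supp (fun k => exists2 k', k = Lc :: k' & in_basis (S ++ T) k') r.
  apply: supp_scale; apply: supp_bind P1 _ _; last by split.
  move=> k1 b1; apply: supp_bind P2 _ _; last by split.
  move=> k2 b2; have [] := closed_normal gd TS b1 b2.
  case: (normal _ _) => [_ _|]; first by split.
  case=> [x|] [|? ? ? ? ?] [|? ? ? ? ?] c [|? ? ? ? ?] // _ Pc.
  apply/supp_node; split; [by []|by split|by split| |by split].
  by apply: supp_sub Pc => k kb; exists k.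
exists (left_part r).
  by apply: supp_sub (supp_left_part Pr) => k [k' [->]].
rewrite -sem_left //; apply: supp_sub Pr => k [k' -> _]; by exists k'.
Qed.

(** By induction on the word, since a product of normal words is a combination of
    normal words by the closure check. *)
Lemma spanned_word w : good_slots (letters w) -> spanned (letters w) (hat w).
Proof.
have gt0 u : (0 < size (letters u))%N by elim: u => //= u IH v _; rewrite size_cat ltn_addr.
have spE u v f g : perm_eq (letters u ++ letters v) (letters v ++ letters u) ->
  f = - g -> good_slots (letters u ++ letters v) ->
  spanned (letters v ++ letters u) g -> spanned (letters u ++ letters v) f.
  move=> p fg gd [x Px Nx]; exists (scale f4 x).
    apply: supp_scale; apply: supp_sub Px => k; rewrite /in_basis.
    by rewrite (keys_of_content (content_eq (perm_map letter_of p))).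
  have p' : perm_eq (letters v ++ letters u) (letters u ++ letters v) by rewrite perm_sym.
  rewrite (sem_eq _ (fun k => word_at_perm m (Lc :: k) gd p)).
  rewrite fg; apply: Null_perm p' _.
  apply: (@Null_trans _ _ _ _ (signed true (sem x (fun k => word_at (letters v ++ letters u) (Lc :: k))))).
    exact: (@Null_signed2 _ _ _ _ true).
  apply: Null_sym; apply: Null_trans (signF_mul _ true _).
    by apply: sem_scale; [exact: Null_0|exact: Null_B|move=> k; apply: word_at5].
  by apply: lattice_sem => k; apply: lattice_word_at.
elim: w => [i|u IHu v IHv] /= gd.
  exists (single [:: letter_of i] f1).
    apply: supp_single; rewrite /in_basis /=.
    by move: closedN => /andP [/allP H _]; apply: H; case: (letter_of i).
  rewrite sem_single mulr1n.
  have i7 : (i < 7)%N by move: gd; rewrite /good_slots /= andbT.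
  have s1 : std [:: i].
    by apply/allP => j _; apply/negP => /and3P []; rewrite !inE => /eqP <- /eqP; lia.
  have [c E] := spelling_eq gd (perm_refl _) s1.
  by rewrite /word_at /spells /= c E; apply: Null_refl.
have [gu gv] := good_cat gd.
have Lu : lattice (letters u) (hat u) by apply: lattice_word.
have Lv : lattice (letters v) (hat v) by apply: lattice_word.
have [le|lt] := leqP (size (letters v)) (size (letters u)).
  by apply: spanned_mul => //; rewrite ?gt0 ?IHu ?IHv //; auto.
have p : perm_eq (letters u ++ letters v) (letters v ++ letters u) by rewrite perm_catC.
rewrite hat_mul; apply: (spE u v _ (mulV (hat v) (hat u)) p _ gd); first exact: mulVC.
apply: spanned_mul; auto; last by rewrite gt0 ltnW.
exact: good_perm p gd.
Qed.

End Span.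

End Engine.

(** * From congruences modulo 5 to equalities *)

Definition subspace (F : fieldType) (M : lmodType F) (W : M -> Prop) : Prop :=
  [/\ W 0, forall x y, W x -> W y -> W (x + y) & forall a x, W x -> W (a *: x)].

Lemma subspace_sum (F : fieldType) (M : lmodType F) (W : M -> Prop) (I : Type)
  (r : seq I) (P : pred I) (f : I -> M) : subspace W ->
  (forall i, P i -> W (f i)) -> W (\sum_(i <- r | P i) f i).
Proof. by case=> W0 WD _ H; elim/big_ind: _. Qed.

(** If v = 5 b v modulo W for an integral matrix b, then (1 - 5 b) v = 0 modulo W, and
    the determinant of 1 - 5 b is nonzero, being 1 modulo 5. *)
Lemma nakayama (F : numFieldType) (M : lmodType F) (W : M -> Prop) n
    (v : 'I_n -> M) (b : 'M[int]_n) : subspace W ->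
  (forall i, W (v i - (\sum_j v j *~ b i j) *+ 5)) -> forall i, W (v i).
Proof.
move=> sW H i; have [W0 WD WZ] := sW.
pose a : 'M[int]_n := \matrix_(k, l) ((k == l)%:R - 5 * b k l).
have det_a : \det a != 0.
  (* Reducing modulo 5 turns the matrix into the identity. *)
  have : (\det (map_mx (intr : int -> 'F_5) a)) != 0.
    rewrite (_ : map_mx _ a = 1%:M) ?det1 ?oner_neq0 //.
    apply/matrixP => k l; rewrite !mxE rmorphB rmorphM /= (_ : 5%:~R = 0 :> 'F_5).
      by rewrite mul0r subr0 rmorph_nat.
    exact/eqP.
  rewrite det_map_mx; apply: contra => /eqP ->; by rewrite rmorph0.
have E k : v k - (\sum_j v j *~ b k j) *+ 5 = \sum_j (a k j)%:~R *: v j.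
  rewrite -sumrMnl [v k in LHS](_ : _ = \sum_j (k == j)%:R *: v j); last first.
    rewrite (bigD1 k) //= eqxx scale1r big1 ?addr0 // => j.
    by rewrite eq_sym => /negbTE ->; rewrite scale0r.
  rewrite -sumrB; apply: eq_bigr => j _; rewrite mxE rmorphB rmorphM /= scalerBl.
  congr (_ - _); first by case: eqP => _; rewrite ?scale1r ?scale0r.
  by rewrite -scalerA !scaler_int pmulrn.
(* Cramer's rule: the adjugate matrix avoids division inside W. *)
have Wdet : W ((\det a)%:~R *: v i).
  rewrite (_ : _ *: _ = \sum_k ((\adj a) i k)%:~R *: (v k - (\sum_j v j *~ b k j) *+ 5)).
    by apply: subspace_sum => // k _; apply: WZ.
  transitivity (\sum_j ((\adj a *m a) i j)%:~R *: v j).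
    rewrite mul_adj_mx (bigD1 i) //= mxE eqxx mulr1n big1 ?addr0 // => j.
    by rewrite mxE eq_sym => /negbTE ->; rewrite mulr0n scale0r.
  under [RHS]eq_bigr => k _ do rewrite E scaler_sumr.
  rewrite exchange_big /=; apply: eq_bigr => j _.
  rewrite mxE rmorph_sum /= scaler_suml; apply: eq_bigr => k _.
  by rewrite rmorphM /= scalerA.
have := WZ (\det a)%:~R^-1 _ Wdet; rewrite scalerA mulVf ?scale1r //.
by rewrite intr_eq0.
Qed.

(** Multilinear words on n slots are finite in number, and [nakayama] is applied to a
    list of them. *)
Fixpoint words (L : seq nat) (d : nat) : seq word :=
  if d is d'.+1 then
    [seq Var x | x <- L] ++ [seq Mul u v | u <- words L d', v <- words L d']
  else [::].

Lemma size_letters_gt0 w : (0 < size (letters w))%N.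
Proof. by elim: w => //= u IH v _; rewrite size_cat ltn_addr. Qed.

Lemma mem_words L d w : {subset letters w <= L} -> (size (letters w) <= d)%N ->
  w \in words L d.
Proof.
elim: d w => [|d IH] w sL; first by have := size_letters_gt0 w; case: (size _).
case: w sL => [x|u v] sL sz; rewrite /= mem_cat.
  by rewrite map_f //; apply: sL; rewrite inE.
apply/orP; right; move: sz; rewrite /= size_cat => sz.
have v0 := size_letters_gt0 v; have u0 := size_letters_gt0 u.
apply: allpairs_f; apply: IH; try by [move=> x xu; apply: sL; rewrite /= mem_cat xu ?orbT|lia].
Qed.

(** * Symmetrisation *)

Section Symmetrisation.

Variables (F : numFieldType) (B : lmodType F) (m : B -> B -> B).
Hypothesis mBl : forall x y z, m (x - y) z = m x z - m y z.
Hypothesis mBr : forall x y z, m z (x - y) = m z x - m z y.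
Variables (eps : seq bool) (n : nat).
Hypothesis n7 : (n <= 7)%N.

Notation V := ((nat -> B) -> B).
Notation hat := (hat m).
Notation lattice := (lattice m).
Notation Null := (Null m eps).
Notation word_at := (word_at m).
Notation "x == y %[null S ]" := (eqN (Null S) x y)
  (at level 70, y at next level, format "x  ==  y  %[null  S ]").

Let S := iota 0 n.

Lemma iota_good : good_slots S.
Proof.
rewrite /good_slots iota_uniq; apply/allP => x; rewrite mem_iota => /= x_n.
exact: leq_trans x_n n7.
Qed.

(** Twice the projection to the functions on which the swap of the pair j acts by the
    sign of the pair; nothing happens if the pair is not inside the n slots. *)
Definition sym1 (j : nat) (f : V) : V :=
  if (j.*2.+1 < n)%N then f + signed (nth false eps j) (act (tau j) f) else f.

Definition sym (f : V) : V := sym1 0 (sym1 1 (sym1 2 f)).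

Lemma signedD b (f g : V) : signed b (f + g) = signed b f + signed b g.
Proof. by case: b; rewrite /signed // opprD. Qed.

Lemma sym1B j f g : sym1 j (f - g) = sym1 j f - sym1 j g.
Proof. by rewrite /sym1; case: ifP => // _; rewrite actB signedB opprD addrACA. Qed.

Lemma symB f g : sym (f - g) = sym f - sym g.
Proof. by rewrite /sym !sym1B. Qed.

Lemma sym0 : sym 0 = 0. Proof. by rewrite -(subrr 0) symB !subrr. Qed.

Lemma sym10 j : sym1 j 0 = 0. Proof. by rewrite -(subrr 0) sym1B !subrr. Qed.

Lemma symD f g : sym (f + g) = sym f + sym g.
Proof.
have N x : sym (- x) = - sym x by rewrite -sub0r symB sym0 sub0r.
by rewrite -{1}[g]opprK symB N opprK.
Qed.

Lemma symMn f k : sym (f *+ k) = sym f *+ k.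
Proof. by elim: k => [|k IH]; [rewrite !mulr0n sym0 | rewrite !mulrS symD IH]. Qed.

Lemma sym1Z j a f : sym1 j (a *: f) = a *: sym1 j f.
Proof.
rewrite /sym1; case: ifP => // _; rewrite scalerDr; congr (_ + _).
rewrite -[act _ _]/(a *: act (tau j) f).
by case: nth; rewrite /signed // scalerN.
Qed.

Lemma symZ a f : sym (a *: f) = a *: sym f.
Proof. by rewrite /sym !sym1Z. Qed.

Lemma sym1C i j f : sym1 i (sym1 j f) = sym1 j (sym1 i f).
Proof.
rewrite /sym1; case: ifP => // _; case: ifP => // _.
rewrite !actD !act_signed !signedD !signed_add (act_tauC i j) addbC.
by rewrite -!addrA; congr (_ + _); rewrite addrCA.
Qed.

Lemma sym1_swap j f : (j.*2.+1 < n)%N ->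
  sym1 j (f - signed (nth false eps j) (act (tau j) f)) = 0.
Proof.
move=> jn; rewrite /sym1 jn actB act_signed act_tauK signedB signed_add addbb /=.
by rewrite addrA subrK subrr.
Qed.

(** Symmetrisation turns the sign rule, until now part of a congruence, into an
    equality. *)
Lemma sym_swap j f : (j < 3)%N -> (j.*2.+1 < n)%N ->
  sym (f - signed (nth false eps j) (act (tau j) f)) = 0.
Proof.
move=> j3 jn; rewrite /sym.
case: j j3 jn => [|[|[|]]] // _ jn.
- by rewrite (sym1C 1 2) (sym1C 0 2) (sym1C 0 1) sym1_swap // !sym10.
- by rewrite (sym1C 1 2) sym1_swap // !sym10.
- by rewrite sym1_swap // !sym10.
Qed.

Lemma sym_Null f : Null S f -> exists2 h, lattice S h & sym f = sym h *+ 5.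
Proof.
elim=> [h Lh|j h j3 a b Lh||f1 f2 _ [h1 L1 E1] _ [h2 L2 E2]].
- by exists h => //; rewrite symMn.
- exists 0; first exact: lattice0.
  by rewrite sym0 mul0rn sym_swap //; move: b; rewrite mem_iota.
- by exists 0; [exact: lattice0 | rewrite sym0 mul0rn].
- by exists (h1 - h2); [exact: latticeB | rewrite !symB E1 E2 mulrnBl].
Qed.

Let ws := [seq w <- words S n | perm_eq (letters w) S].

Lemma mem_ws w : perm_eq (letters w) S -> w \in ws.
Proof.
move=> p; rewrite mem_filter p; apply: mem_words; last by rewrite (perm_size p) size_iota.
by move=> x; rewrite (perm_mem p).
Qed.

Let wi (i : 'I_(size ws)) := nth (Var 0) ws i.

Lemma lattice_coef h : lattice S h -> exists b : 'I_(size ws) -> int, h = \sum_i hat (wi i) *~ b i.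
Proof.
elim=> [w pw||f1 f2 _ [b1 ->] _ [b2 ->]].
- have wW := mem_ws pw; have iw : (index w ws < size ws)%N by rewrite index_mem.
  exists (fun i => (i == Ordinal iw)%:R); rewrite (bigD1 (Ordinal iw)) //= eqxx mulr1z.
  rewrite big1 ?addr0 => [|i /negbTE ->]; last by rewrite mulr0z.
  by rewrite /wi /= nth_index.
- by exists (fun => 0); rewrite big1 // => i _; rewrite mulr0z.
- by exists (fun i => b1 i - b2 i); rewrite -sumrB; apply: eq_bigr => i _; rewrite mulrzBr.
Qed.

Variables (tb : trie vec) (N : basis).
Hypothesis spN : forall w, good_slots (letters w) -> spanned m eps N (letters w) (hat w).

Let K := undup (keys_of N (map letter_of S)).

Definition combination (x : V) : Prop :=
  exists c : key -> F, x = \sum_(k <- K) c k *: sym (word_at S (Lc :: k)).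

Lemma combination_subspace : subspace combination.
Proof.
split=> [|x y [c ->] [d ->]|a x [c ->]].
- by exists (fun => 0); rewrite big1_seq // => k _; rewrite scale0r.
- exists (fun k => c k + d k); rewrite -big_split; apply: eq_bigr => k _ /=.
  by rewrite scalerDl.
- exists (fun k => a * c k); rewrite scaler_sumr; apply: eq_bigr => k _.
  by rewrite scalerA.
Qed.

Lemma combination_sem v : supp (in_basis N S) v ->
  combination (sym (sem v (fun k => word_at S (Lc :: k)))).
Proof.
have [W0 WD WZ] := combination_subspace.
have WM x k : combination x -> combination (x *+ k) by rewrite -scaler_nat; apply: WZ.
have Wg k : in_basis N S k -> combination (sym (word_at S (Lc :: k))).
  move=> kK; exists (fun k' => (k' == k)%:R).
  have kK' : k \in K by rewrite mem_undup.
  rewrite (bigD1_seq k) ?undup_uniq //= eqxx scale1r big1 ?addr0 // => k' /negbTE ->.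
  by rewrite scale0r.
rewrite (@sem_additive _ _ sym); last exact: symB.
have: forall P g, supp P v -> (forall k, P k -> combination (g k)) -> combination (sem v g).
  elim: v => [|o a IHa b IHb c IHc d IHd] P g /=; first by [].
  move=> /supp_node [Ho Ha Hb Hc Hd] H.
  apply: (WD _ _); first by case: o Ho => [x|] Ho //; apply/WM/H/Ho.
  apply: (WD _ _); first by apply: IHa Ha _ => k; apply: H.
  apply: (WD _ _); first by apply: IHb Hb _ => k; apply: H.
  by apply: (WD _ _); [apply: IHc Hc _ => k; apply: H | apply: IHd Hd _ => k; apply: H].
by move=> H Pv; apply: H Pv Wg.
Qed.

Lemma sym_sum (I : Type) (r : seq I) (g : I -> V) :
  sym (\sum_(i <- r) g i) = \sum_(i <- r) sym (g i).
Proof. by apply: (big_morph sym symD sym0). Qed.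

Lemma symMz f z : sym (f *~ z) = sym f *~ z.
Proof. by rewrite -!scaler_int symZ. Qed.

(** Before symmetrisation a word is a combination of normal words modulo [Null]; after
    it, modulo 5 times the lattice of all words only, and [nakayama] applies to the
    list of all words. *)
Theorem sym_combination w : perm_eq (letters w) S -> combination (sym (hat w)).
Proof.
have H (i : 'I_(size ws)) : exists b : 'I_(size ws) -> int,
    combination (sym (hat (wi i)) - (\sum_j sym (hat (wi j)) *~ b j) *+ 5).
  have : wi i \in ws by apply: mem_nth.
  rewrite mem_filter => /andP [pw _]; set w' := wi i in pw *.
  have pw' : perm_eq S (letters w') by rewrite perm_sym.
  have gw := good_perm pw' iota_good.
  have [v Pv Nv] := spN gw.
  have [h Lh E] := sym_Null (Null_perm pw Nv).
  have [b hE] := lattice_coef Lh; exists b.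
  have -> : \sum_j sym (hat (wi j)) *~ b j = sym h.
    by rewrite hE sym_sum; apply: eq_bigr => j _; rewrite symMz.
  rewrite -E symB subKr (sem_eq _ (fun k => word_at_perm m (Lc :: k) gw pw)).
  apply: combination_sem; apply: supp_sub Pv => k; rewrite /in_basis.
  by rewrite (keys_of_content N (content_eq (perm_map letter_of pw))).
have [b Hb] := choice H => pw.
have wW := mem_ws pw; have iw : (index w ws < size ws)%N by rewrite index_mem.
rewrite (_ : w = wi (Ordinal iw)); last by rewrite /wi /= nth_index.
pose bm : 'M[int]_(size ws) := \matrix_(i, j) b i j.
apply: (@nakayama F _ combination _ (fun i => sym (hat (wi i))) bm combination_subspace) => i.
by rewrite (eq_bigr (fun j => sym (hat (wi j)) *~ b i j)) // => j _; rewrite mxE.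
Qed.

End Symmetrisation.

(** * V(6) and the split octonions *)

Section Octonions.

Variables (F : numFieldType) (alpha : {bilinear V6 F -> V6 F -> V6 F}).
Hypothesis alpha_alt : alternating alpha.
Hypothesis alpha_norm : V6_normalized alpha.

Notation v i := (V6_v F (V6_wt i)).

Lemma alphaN x y : alpha x y = - alpha y x.
Proof.
have := alpha_alt (x + y); rewrite linearDl linearDr /= linearDr /= !alpha_alt.
by rewrite add0r addr0 => /eqP; rewrite addr_eq0 => /eqP.
Qed.

Definition table_coef (i j : nat) : F * nat :=
  match i, j with
  | 0%N, 3%N => (20, 0%N) | 0%N, 4%N => (10, 1%N) | 0%N, 5%N => (4, 2%N) | 0%N, 6%N => (1, 3%N)
  | 1%N, 2%N => (- 60, 0%N) | 1%N, 3%N => (- 20, 1%N) | 1%N, 5%N => (6, 3%N) | 1%N, 6%N => (4, 4%N)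
  | 2%N, 3%N => (- 20, 2%N) | 2%N, 4%N => (- 15, 3%N) | 2%N, 6%N => (10, 5%N)
  | 3%N, 4%N => (- 20, 4%N) | 3%N, 5%N => (- 20, 5%N) | 3%N, 6%N => (20, 6%N)
  | 4%N, 5%N => (- 60, 6%N)
  | _, _ => (0, 0%N)
  end.

Lemma alpha_table (i j : 'I_7) : (i < j)%N ->
  alpha (v i) (v j) = (table_coef i j).1 *: v (table_coef i j).2.
Proof.
move=> ij; rewrite alpha_norm // /V6_table unlock; move: ij.
by case: i => -[|[|[|[|[|[|[|//]]]]]]] ?; case: j => -[|[|[|[|[|[|[|//]]]]]]] ? //= _;
  rewrite ?addr0 ?scale0r ?scale1r.
Qed.

(** The scaling of the weight vectors under which the given product becomes
    [oct_mul]. *)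
Definition oct_scale (o : oct) : F :=
  match o with
  | y3 => - 10^-1 | x1 => 300^-1 | x2 => 1 | h0 => 10^-1 | y2 => - 150^-1 | y1 => 5 | x3 => 1
  end.

Lemma oct_scale_neq0 o : oct_scale o != 0.
Proof. by case: o; rewrite /= ?oppr_eq0 ?invr_eq0 ?pnatr_eq0 ?oner_eq0. Qed.

Definition oct_vec (o : oct) : V6 F := oct_scale o *: v (nat_of_oct o).

Definition mval (u : mono) : V6 F :=
  match u with None => 0 | Some (s, p, a) => ((-1) ^+ s * 2 ^+ p) *: oct_vec a end.

Lemma alpha_oct_vec a b : alpha (oct_vec a) (oct_vec b) = mval (oct_mul a b).
Proof.
have lt i j : (i < j < 7)%N ->
    alpha (v i) (v j) = (table_coef i j).1 *: v (table_coef i j).2.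
  case/andP=> ij j7; have i7 := ltn_trans ij j7.
  exact: (alpha_table (i := Ordinal i7) (j := Ordinal j7)).
have gt i j : (i < j < 7)%N ->
    alpha (v j) (v i) = - (table_coef i j).1 *: v (table_coef i j).2.
  by move=> ij; rewrite alphaN lt // scaleNr.
rewrite /oct_vec linearZl_LR linearZr_LR /= scalerA.
case: a; case: b; rewrite /= ?alpha_alt ?scaler0 //;
  (rewrite lt; last by []) || (rewrite gt; last by []);
  rewrite /= ?oppr0 ?scale0r ?scaler0 // /oct_vec !scalerA /=; congr (_ *: _); field;
  by rewrite ?pnatr_eq0.
Qed.

Lemma eq_octE a b : eq_oct a b = (a == b). Proof. by case: a; case: b. Qed.

Lemma signD (b c : bool) : (-1) ^+ (b (+) c) = (-1) ^+ b * (-1) ^+ c :> F.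
Proof. by rewrite signr_addb. Qed.

Lemma alpha_mval u w : alpha (mval u) (mval w) = mval (mono_mul u w).
Proof.
case: u => [[[s p] a]|]; last by rewrite /= linear0l.
case: w => [[[t q] b]|]; last by rewrite /= linear0r.
rewrite /= linearZl_LR linearZr_LR /= alpha_oct_vec scalerA.
case: (oct_mul a b) => [[[r d] c]|] /=; last by rewrite scaler0.
by rewrite scalerA !signD !exprD; congr (_ *: _); ring.
Qed.

Lemma mono_eval_ok t w :
  word_eval alpha (fun i => oct_vec (nth h0 t i)) w = mval (mono_eval t w).
Proof.
elim: w => [i|u IHu w IHw] /=; first by rewrite expr0 mulr1 scale1r.
by rewrite IHu IHw alpha_mval.
Qed.

Definition coord (o : oct) (x : V6 F) : F := x 0 (inord (nat_of_oct o)) / oct_scale o.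

Lemma coordZ o a x : coord o (a *: x) = a * coord o x.
Proof. by rewrite /coord mxE mulrA. Qed.
Lemma coordD o x y : coord o (x + y) = coord o x + coord o y.
Proof. by rewrite /coord mxE mulrDl. Qed.
Lemma coord0 o : coord o 0 = 0.
Proof. by rewrite /coord mxE mul0r. Qed.

Lemma coord_oct_vec o a : coord o (oct_vec a) = (a == o)%:R.
Proof.
rewrite /coord /oct_vec mxE mxE; have -> : V6_wt (nat_of_oct a) == V6_wt (inord (nat_of_oct o) : 'I_7) = (a == o).
  rewrite inordK; last by case: o.
  by case: a; case: o.
case: eqP => [->|_]; last by rewrite mulr0 mul0r.
by rewrite mulr1 divff // oct_scale_neq0.
Qed.

Lemma coord_expand x : x = \sum_(o <- all_oct) coord o x *: oct_vec o.
Proof.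
apply/rowP => i; rewrite summxE; rewrite -(inord_val i).
have inE' (k : nat) : (k < 7)%N -> (inord k : 'I_7) = k :> nat by move=> ?; rewrite inordK.
rewrite /all_oct !big_cons big_nil /oct_vec /coord !mxE !inordK //=.
have L o : x 0 (inord (nat_of_oct o)) / oct_scale o * (oct_scale o * 1) = x 0 (inord (nat_of_oct o)).
  by rewrite mulr1 divfK ?oct_scale_neq0.
case: i => -[|[|[|[|[|[|[|//]]]]]]] ilt /=; rewrite ?mulr0 ?add0r ?addr0;
  symmetry; first [exact: (L y3) | exact: (L x1) | exact: (L x2) | exact: (L h0)
    | exact: (L y2) | exact: (L y1) | exact: (L x3)].
Qed.

Lemma coord_inj x y : (forall o, coord o x = coord o y) -> x = y.
Proof.
by move=> H; rewrite [x]coord_expand [y]coord_expand; apply: eq_bigr => o _; rewrite H.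
Qed.

Definition rel_at (s : nat -> V6 F) (R : relation) : V6 F :=
  foldr (fun bw x =>
    (if bw.1 then - word_eval alpha s bw.2 else word_eval alpha s bw.2) + x) 0 R.

Lemma rel_at_coord t R o :
  coord o (rel_at (fun i => oct_vec (nth h0 t i)) R)
  = (mono_sum o false (mono_terms t R))%:R - (mono_sum o true (mono_terms t R))%:R.
Proof.
elim: R => [|[b w] R IH] /=; first by rewrite coord0 subrr.
rewrite coordD IH mono_eval_ok.
have -> : (if b then - mval (mono_eval t w) else mval (mono_eval t w))
    = (-1) ^+ b *: mval (mono_eval t w).
  by case: b; rewrite ?expr0 ?expr1 ?scale1r ?scaleN1r.
case: (mono_eval t w) => [[[s p] a]|] /=; last by rewrite scaler0 coord0 add0r.
rewrite coordZ coordZ coord_oct_vec eq_octE; case: eqP => _; last by rewrite !mulr0 add0r.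
rewrite mulr1; case: s; case: b => /=; rewrite !natrD natrX ?expr0 ?expr1; ring.
Qed.

Lemma mem_tuples n t : size t = n -> t \in tuples n.
Proof.
elim: n t => [|n IH] t; first by move/size0nil ->.
case: t => // a t [st].
rewrite (_ : tuples n.+1 = [seq b :: r | b <- all_oct, r <- tuples n]) //.
by apply/allpairsP; exists (a, t); split; [case: a | apply: IH |].
Qed.

Lemma rel_at_basis R t n : holds_on_basis R n -> size t = n ->
  rel_at (fun i => oct_vec (nth h0 t i)) R = 0.
Proof.
move/allP => H /mem_tuples /H C; apply: coord_inj => o; rewrite coord0 rel_at_coord.
move: C; rewrite /cancels; case: (mono_terms t R) => [_|x l]; first by rewrite subrr.
by move/allP/(_ o); rewrite eqnE => C; rewrite (eqP (C _)) ?subrr //; case: o {C}.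
Qed.

Definition update (s : nat -> V6 F) (i : nat) (x : V6 F) (j : nat) : V6 F :=
  if j == i then x else s j.

Lemma word_eval_notin s i x w : i \notin letters w ->
  word_eval alpha (update s i x) w = word_eval alpha s w.
Proof.
move=> iw; apply: eq_word_eval => j jw; rewrite /update; case: eqP => // ji.
by rewrite -ji jw in iw.
Qed.

Lemma word_eval_linear s i a x y w : uniq (letters w) -> i \in letters w ->
  word_eval alpha (update s i (a *: x + y)) w =
  a *: word_eval alpha (update s i x) w + word_eval alpha (update s i y) w.
Proof.
elim: w => [j|u IHu w IHw] /=; first by rewrite inE /update => _ /eqP ->; rewrite eqxx.
rewrite cat_uniq mem_cat => /and3P [uu /hasPn D uw] /orP [iu|iw].
  have iw : i \notin letters w by apply/negP => /D; rewrite /= iu.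
  by rewrite !(word_eval_notin _ _ iw) IHu // linearPl.
have iu := D _ iw; rewrite /= in iu.
by rewrite !(word_eval_notin _ _ iu) IHw // linearPr.
Qed.

(** A multilinear relation is linear in each variable, so that it holds everywhere as
    soon as it holds on the basis. *)
Lemma rel_at_linear s i a x y n R : multilinear R n -> (i < n)%N ->
  rel_at (update s i (a *: x + y)) R = a *: rel_at (update s i x) R + rel_at (update s i y) R.
Proof.
move=> mlR i_n; elim: R mlR => [|[b w] R IH] /=; first by rewrite scaler0 addr0.
case/andP => p /IH ->; rewrite word_eval_linear; last first.
- by rewrite (perm_mem p) mem_iota.
- by rewrite (perm_uniq p) iota_uniq.
by case: b; rewrite ?opprD !scalerDr ?scalerN addrACA.
Qed.

Lemma rel_at_expand s i n R : multilinear R n -> (i < n)%N ->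
  (forall o, rel_at (update s i (oct_vec o)) R = 0) -> rel_at s R = 0.
Proof.
move=> mlR i_n H.
have -> : s = update s i (s i) by apply/funext => j; rewrite /update; case: eqP => [->|].
rewrite (coord_expand (s i)); elim: all_oct => [|o l IH].
  rewrite big_nil; have := rel_at_linear s 0 0 0 mlR i_n.
  rewrite scaler0 addr0 scale0r add0r; have := rel_at_linear s 1 0 0 mlR i_n.
  rewrite scaler0 addr0 scale1r => E _; move: E => /eqP.
  by rewrite -subr_eq0 opprD addNKr oppr_eq0 => /eqP.
by rewrite big_cons (rel_at_linear _ _ _ _ mlR i_n) H IH scaler0 addr0.
Qed.

(** The variables are specialised to basis vectors one at a time: k counts the
    variables that are still arbitrary. *)
Lemma satisfies_basis R n : multilinear R n -> holds_on_basis R n -> satisfies alpha R.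
Proof.
move=> mlR hR.
suff H k : (k <= n)%N -> forall s, (forall i, (k <= i < n)%N -> exists o, s i = oct_vec o) ->
    rel_at s R = 0.
  by move=> s; apply: (H n) => // i; rewrite ltnNge; case: leqP.
elim: k => [|k IH] kn s Hs.
  have Hs' i : exists o, (i < n)%N -> s i = oct_vec o.
    by case: (ltnP i n) => [/Hs [o E]|_]; [exists o | exists h0].
  have [t Ht] := choice Hs'.
  rewrite -(rel_at_basis hR (size_mkseq t n)).
  elim: R mlR {hR} => //= -[b w] R IH /andP [p /IH ->].
  congr ((if _ then - _ else _) + _); apply: eq_word_eval => i;
    by rewrite (perm_mem p) mem_iota => /= i_n; rewrite nth_mkseq ?Ht.
apply: (rel_at_expand mlR kn) => o; apply: IH => [|i ik]; first exact: ltnW.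
rewrite /update; case: eqP => [_|/eqP ne]; first by exists o.
by apply: Hs; move: ik; rewrite leq_eqVlt eq_sym (negbTE ne).
Qed.

Lemma satA_alpha : satisfies alpha relA.
Proof. by move=> s /=; rewrite addr0 alphaN addNr. Qed.

End Octonions.

(** * Independence on V(6) *)

Section Lifts.

Variable F : numFieldType.

Definition lifts (x : F) (c : F5) : Prop := exists z : int, x = (valF c)%:R + (z * 5)%:~R.

Lemma lifts_nat n c : n = valF c %[mod 5] -> lifts n%:R c.
Proof.
move=> E; exists ((n %/ 5)%:Z - (valF c %/ 5)%:Z).
rewrite {1}(divn_eq n 5) {1}(divn_eq (valF c) 5) E !natrD !natrM.
by rewrite rmorphM rmorphB /= -!pmulrn; ring.
Qed.

Lemma lifts0 : lifts 0 f0. Proof. exact: (@lifts_nat 0). Qed.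

Lemma liftsD x y a b : lifts x a -> lifts y b -> lifts (x + y) (addF a b).
Proof.
move=> [z ->] [t ->]; have [|u E] := @lifts_nat (valF a + valF b) (addF a b).
  by case: a; case: b.
exists (u + z + t); have -> : (valF (addF a b))%:R = (valF a + valF b)%:R - (u * 5)%:~R :> F.
  by rewrite E addrK.
by rewrite natrD !rmorphM !rmorphD /=; ring.
Qed.

Lemma liftsM x y a b : lifts x a -> lifts y b -> lifts (x * y) (mulF a b).
Proof.
move=> [z ->] [t ->]; have [|u E] := @lifts_nat (valF a * valF b) (mulF a b).
  by case: a; case: b.
exists (u + z * (valF b)%:Z + t * (valF a)%:Z + z * t * 5).
have -> : (valF (mulF a b))%:R = (valF a * valF b)%:R - (u * 5)%:~R :> F by rewrite E addrK.
rewrite natrM !(rmorphM, rmorphD) /= -!pmulrn; ring.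
Qed.

Lemma lifts_sign (b : bool) : lifts ((-1) ^+ b) (signF b).
Proof.
case: b; last exact: (@lifts_nat 1).
by exists (-1); rewrite /= rmorphM /= rmorphN1; ring.
Qed.

Lemma lifts_pow2 p : lifts (2 ^+ p) (pow2F p).
Proof.
elim: p => [|p IH]; first exact: (@lifts_nat 1).
by rewrite exprS; apply: liftsM IH; apply: (@lifts_nat 2).
Qed.

End Lifts.

Section Independence.

Variables (F : numFieldType) (alpha : {bilinear V6 F -> V6 F -> V6 F}).
Hypothesis alpha_alt : alternating alpha.
Hypothesis alpha_norm : V6_normalized alpha.
Variables (eps : seq bool) (n : nat).

Notation V := ((nat -> V6 F) -> V6 F).
Notation sym := (sym eps n).
Notation hat := (hat alpha).
Notation word_at := (word_at alpha).

Definition point (t : seq oct) (i : nat) : V6 F := oct_vec F (nth h0 t i).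

Lemma point_tau t j : size t = n -> (j.*2.+1 < n)%N -> point t \o tau j = point (swap_at j t).
Proof.
move=> st jn; apply/funext => i; rewrite /point /= /swap_at /tau !eqnE; congr (oct_vec F _).
have [i_t|t_i] := ltnP i (size t).
  by rewrite nth_mkseq //; repeat case: ifP.
rewrite [RHS]nth_default ?size_mkseq //.
by rewrite !ifN ?nth_default //; apply/eqP; lia.
Qed.

Lemma size_swap_at j t : size (swap_at j t) = size t.
Proof. exact: size_mkseq. Qed.

Lemma sym_point (js : seq nat) (f : V) t : size t = n ->
  foldl (fun g j => sym1 eps n j g) f (rev js) (point t)
  = \sum_(p <- sym_terms eps n js t) (-1) ^+ p.1 *: f (point p.2).
Proof.
elim: js t => [|j js IH] t st; first by rewrite big_seq1 scale1r.
rewrite rev_cons -cats1 foldl_cat /= {1}/sym1; case: ifP => jn; last exact: IH.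
set g := foldl _ _ _ in IH *.
rewrite -[LHS]/(g (point t) + signed (nth false eps j) (act (tau j) g) (point t)).
rewrite IH // big_cat /=; congr (_ + _).
have -> : signed (nth false eps j) (act (tau j) g) (point t)
    = (-1) ^+ nth false eps j *: g (point t \o tau j).
  by case: nth; rewrite ?expr0 ?expr1 ?scale1r ?scaleN1r.
rewrite point_tau // IH ?size_swap_at // scaler_sumr big_map; apply: eq_bigr => p _ /=.
by rewrite scalerA signr_addb.
Qed.

Lemma lifts_mono o w t : lifts (coord o (hat w (point t))) (mono_coef o (mono_eval t w)).
Proof.
rewrite /hat (mono_eval_ok alpha_alt alpha_norm) /mono_coef.
case: (mono_eval t w) => [[[s p] a]|] /=; last by rewrite coord0; apply: lifts0.
rewrite coordZ coord_oct_vec eq_octE; case: eqP => _; last by rewrite mulr0; apply: lifts0.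
by rewrite mulr1; apply: liftsM; [apply: lifts_sign | apply: lifts_pow2].
Qed.

Lemma coord_sum (I : Type) o (r : seq I) (g : I -> V6 F) :
  coord o (\sum_(i <- r) g i) = \sum_(i <- r) coord o (g i).
Proof. by apply: (big_morph _ (coordD o) (coord0 F o)). Qed.

Lemma lifts_sym o w t : size t = n ->
  lifts (coord o (sym (hat w) (point t)))
    (sym_coef (sym_terms eps n [:: 0; 1; 2] t) o w).
Proof.
move=> st; rewrite -[sym _]/(foldl (fun g j => sym1 eps n j g) (hat w) (rev [:: 0; 1; 2]%N)).
rewrite sym_point // coord_sum; elim: (sym_terms _ _ _ _) => [|p l IH].
  by rewrite big_nil; apply: lifts0.
rewrite big_cons; apply: liftsD IH; rewrite coordZ.
by apply: liftsM; [apply: lifts_sign | apply: lifts_mono].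
Qed.

Section Elimination.

Variables (N : basis) (c : key -> F).
Let S := iota 0 n.
Let K := keys_of N (map letter_of S).
Hypothesis uK : uniq K.
Let wd k := left_comb (low_slots k [::]).
Hypothesis vanish : forall s, \sum_(k <- K) c k *: sym (hat (wd k)) s = 0.

Let g k : F := if k \in K then c k else 0.

(** Coefficients are compared modulo 5 times their own integral span.  Then a
    combination that vanishes on V(6) makes every evaluation row a null row, although
    the coefficients themselves are arbitrary numbers. *)
Definition Nul5 (x : F) : Prop := exists b : key -> int, x = (\sum_(k <- K) g k *~ b k) *+ 5.

Lemma Nul5_0 : Nul5 0.
Proof. by exists (fun => 0); rewrite big1 ?mul0rn // => k _; rewrite mulr0z. Qed.

Lemma Nul5_B x y : Nul5 x -> Nul5 y -> Nul5 (x - y).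
Proof.
move=> [b ->] [d ->]; exists (fun k => b k - d k).
rewrite -mulrnBl -sumrB; congr (_ *+ _); apply: eq_bigr => k _.
by rewrite mulrzBr.
Qed.

Lemma Nul5_g k : killed5 Nul5 (g k).
Proof.
exists (fun k' => (k' == k)%:R); congr (_ *+ 5).
rewrite /g; case: ifP => kK; last first.
  rewrite big1_seq // => k' /= k'K; case: eqP => [E|_]; last by rewrite mulr0z.
  by rewrite -E k'K in kK.
rewrite (bigD1_seq k) //= eqxx mulr1z kK big1 ?addr0 // => k' /negbTE ->.
by rewrite mulr0z.
Qed.

Lemma eval_row_null t o : size t = n ->
  null_row Nul5 (fun k => k \in K) g (eval_row eps n [seq (k, wd k) | k <- K] (t, o)).
Proof.
move=> st; rewrite /eval_row -[(t, o).1]/t -[(t, o).2]/o; set ts := sym_terms _ _ _ _.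
pose row L : vec := foldr (fun kw acc => match sym_coef ts o kw.2 with
  | f0 => acc | x => axpy f1 (single kw.1 x) acc end) Leaf [seq (k, wd k) | k <- L].
rewrite -/(row K).
have step k L : row (k :: L) = match sym_coef ts o (wd k) with
    | f0 => row L | x => axpy f1 (single k x) (row L) end by [].
split.
  elim: {1 4}K (fun k (kK : k \in K) => kK) => [|k L IH] HL; first by split.
  have kK : k \in K by apply: HL; rewrite inE eqxx.
  have IL : supp (fun k => k \in K) (row L) by apply: IH => x xL; apply: HL; rewrite inE xL orbT.
  by rewrite step; case: sym_coef => //; apply: supp_axpy => //; apply: supp_single.
have H L : eqN Nul5 (sem (row L) g) (\sum_(k <- L) g k *+ valF (sym_coef ts o (wd k))).
  elim: L => [|k L IH]; first by rewrite big_nil; apply: eqN_refl; apply: Nul5_0.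
  rewrite step big_cons.
  have T x : eqN Nul5 (sem (axpy f1 (single k x) (row L)) g)
      (g k *+ valF x + (\sum_(j <- L) g j *+ valF (sym_coef ts o (wd j)))).
    apply: (eqN_trans Nul5_0 Nul5_B (sem_axpy Nul5_0 Nul5_B _ _ _ Nul5_g)).
    rewrite sem_single mulr1n; apply: (eqND Nul5_0 Nul5_B) => //.
    by apply: eqN_refl; apply: Nul5_0.
  by case: sym_coef => //; rewrite mulr0n add0r.
apply: (eqN_Nul Nul5_0 Nul5_B (H K)).
(* The exact equation of which the row is the reduction modulo 5. *)
have E0 : \sum_(k <- K) c k * coord o (sym (hat (wd k)) (point t)) = 0.
  rewrite -[RHS](coord0 F o) -(vanish (point t)) coord_sum; apply: eq_bigr => k _.
  by rewrite coordZ.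
have lk k : lifts (coord o (sym (hat (wd k)) (point t))) (sym_coef ts o (wd k)).
  exact: lifts_sym.
have [z Hz] := choice lk; exists (fun k => - z k).
apply/eqP; rewrite -subr_eq0 -[X in _ == X]E0; apply/eqP.
rewrite -sumrMnl -sumrB; apply: eq_big_seq => k kK; rewrite /g kK Hz.
by rewrite -mulr_natr -(mulr_natr _ 5) -mulrzr rmorphN rmorphM /=; ring.
Qed.

(** Elimination of the evaluation rows reduces c_k to 0. *)
Lemma independent_Nul codes : independent eps N n codes -> forall k, k \in K -> Nul5 (c k).
Proof.
move=> /andP [_ /allP H] k kK; have /and4P [_ _ _] := H k kK.
set nf := solve _ => /=.
have piv : pivots_ok Nul5 (fun k => k \in K) g
  (foldl (insert 500) Leaf [seq eval_row eps n [seq (k, wd k) | k <- K] (row_point n d) | d <- codes]).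
  have : pivots_ok Nul5 (fun k => k \in K) g Leaf by split.
  elim: codes {H nf} Leaf => [|d l IH] P HP; first exact: HP.
  apply: IH; apply: (insert_ok Nul5_0 Nul5_B _ Nul5_g HP).
  rewrite [row_point _ _]surjective_pairing; apply: eval_row_null.
  rewrite /row_point /= size_takel //.
  by elim: {1 2}n d => //= q IHq d; case: N.div_eucl => ? ? /=; rewrite ltnS IHq.
have nfok := solve_ok Nul5_0 Nul5_B Nul5_g piv.
have [_ _] := normal_ok Nul5_0 nfok kK.
rewrite -/nf; case: (normal nf k) => //= E _.
by move: E; rewrite /eqN subr0 /g kK.
Qed.

(** The coefficients c satisfy c = 5 b c for an integral matrix b, so they vanish by
    [nakayama]. *)
Lemma independent_zero codes : independent eps N n codes -> forall k, k \in K -> c k = 0.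
Proof.
move=> ind k kK.
have ik : (index k K < size K)%N by rewrite index_mem.
pose kk (i : 'I_(size K)) := nth [::] K i.
have kkK i : kk i \in K by apply: mem_nth.
have Hb i : exists b : key -> int, c (kk i) = (\sum_(k <- K) g k *~ b k) *+ 5.
  exact: independent_Nul ind _ (kkK i).
have [b {}Hb] := choice Hb.
pose bm : 'M[int]_(size K) := \matrix_(i, j) b i (kk j).
have := @nakayama F F^o (fun x => x = 0) _ (fun i => c (kk i)) bm.
have sub : subspace (F := F) (M := F^o) (fun x => x = 0).
  by split=> // [x y -> ->|a x ->]; [rewrite addr0|rewrite scaler0].
move=> /(_ sub) Nk; have := Nk _ (Ordinal ik); rewrite /kk /= nth_index //; apply=> i.
apply/eqP; rewrite subr_eq0 Hb; apply/eqP; congr (_ *+ 5).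
rewrite (big_nth [::]) big_mkord; apply: eq_bigr => j _.
by rewrite mxE /g mem_nth.
Qed.

End Elimination.

Theorem independent_ok N codes (c : key -> F) : (0 < n <= 7)%N -> independent eps N n codes ->
  let K := keys_of N (map letter_of (iota 0 n)) in
  (forall s, \sum_(k <- K) c k *: sym (word_at (iota 0 n) (Lc :: k)) s = 0) ->
  forall k, k \in K -> c k = 0.
Proof.
move=> /andP [n0 n7] ind K H; have /andP [uK /allP aK] := ind.
apply: (independent_zero uK _ ind) => s; rewrite -[RHS](H s).
apply: eq_big_seq => k kK; congr (_ *: sym _ s).
have /and4P [p sd /eqP kE _] := aK k kK.
have gd : good_slots (iota 0 n) := iota_good n7.
have [cf le] := spelling_eq gd p sd; rewrite kE in cf le.
by rewrite /word_at /spells /= cf le (size_spellable cf) size_iota n0.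
Qed.

End Independence.

(** * Reduction to multilinear identities *)

Definition eval_terms (F : pzRingType) (B : lmodType F) (m : B -> B -> B)
    (L : seq (F * word)) (s : nat -> B) : B :=
  \sum_(p <- L) p.1 *: word_eval m s p.2.

(** The n-th difference of a function of subsets [T] of the first n numbers: the sum
    of (-1)^(n - |T|) G(T) over all such subsets. *)
Fixpoint differences (B : zmodType) (n : nat) (G : (nat -> bool) -> B) (T : nat -> bool) : B :=
  if n is n'.+1 then
    differences n' G (fun i => (i == n') || T i) - differences n' G (fun i => (i != n') && T i)
  else G T.

Lemma eq_differences (B : zmodType) n (G H : (nat -> bool) -> B) T : G =1 H -> differences n G T = differences n H T.
Proof. by move=> E; elim: n T => [|n IH] T //=; rewrite !IH. Qed.

Lemma differences0 (B : zmodType) n T : differences n (fun=> 0 : B) T = 0.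
Proof. by elim: n T => [|n IH] T //=; rewrite !IH subrr. Qed.

Lemma differencesD (B : zmodType) n (G H : (nat -> bool) -> B) T :
  differences n (fun T => G T + H T) T = differences n G T + differences n H T.
Proof. by elim: n T => [|n IH] T //=; rewrite !IH opprD addrACA. Qed.

Lemma differences_sum (B : zmodType) n (I : Type) (r : seq I) (G : I -> (nat -> bool) -> B) T :
  differences n (fun T => \sum_(i <- r) G i T) T = \sum_(i <- r) differences n (G i) T.
Proof.
elim: r => [|i r IH]; first by rewrite big_nil -[RHS](differences0 B n T); apply: eq_differences => U; rewrite big_nil.
rewrite big_cons -IH -differencesD; apply: eq_differences => U; exact: big_cons.
Qed.

Lemma differencesZ (F : pzRingType) (B : lmodType F) n a (G : (nat -> bool) -> B) T :
  differences n (fun T => a *: G T) T = a *: differences n G T.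
Proof. by elim: n T => [|n IH] T //=; rewrite !IH scalerBr. Qed.

(** Inclusion and exclusion: at a number missing from [l] the two terms of the
    difference are equal and cancel. *)
Lemma differences_indicator (B : zmodType) n (l : seq nat) (x : B) T :
  differences n (fun T => if all T l then x else 0) T
  = if all (mem l) (iota 0 n) && all (fun i => (i < n)%N || T i) l then x else 0.
Proof.
elim: n T => [|n IH] T; first by rewrite /= (eq_all (a2 := T)).
rewrite [LHS]/= !IH -addn1 iotaD all_cat /= andbT add0n.
case: (all (mem l) (iota 0 n)); rewrite /= ?subrr //.
have [nl|nl] := boolP (n \in l).
  rewrite [X in _ - X](_ : _ = 0) ?subr0.
    congr (if _ then _ else _); apply: eq_all => i.
    by rewrite addn1 ltnS orbA (leq_eqVlt i n) (orbC (i == n)).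
  by case: ifP => // /allP /(_ n nl); rewrite ltnn eqxx.
apply/eqP; rewrite subr_eq0; apply/eqP; congr (if _ then _ else _).
by apply: eq_in_all => i il; case: eqP => // E; rewrite -E il in nl.
Qed.

(** Let [l] be a list of n variables.  Substituting for each variable i the sum of the
    new variables y_j with l_j = i and j in T, and taking the n-th difference in T,
    keeps the terms that contain every new variable: this polarises polynomials of
    degree at most n and kills their terms of lower degree. *)
Section Fillings.

Variable l : seq nat.
Let n := size l.

Fixpoint fillings (w : word) : seq word :=
  match w with
  | Var i => [seq Var j | j <- iota 0 n & nth 0 l j == i]
  | Mul u v => [seq Mul a b | a <- fillings u, b <- fillings v]
  end.

Definition full (w : word) : bool := all (mem (letters w)) (iota 0 n).

Lemma fillings_spec w w' : w' \in fillings w ->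
  wmap (nth 0%N l) w' = w /\ all (fun i => i < n)%N (letters w').
Proof.
elim: w w' => [i|u IHu v IHv] w' /=.
  case/mapP => j; rewrite mem_filter mem_iota => /andP [/eqP E] /= jn -> /=.
  by rewrite E jn.
case/allpairsP => -[a b] /= [/IHu [Ea Ha] /IHv [Eb Hb] ->] /=.
by rewrite Ea Eb all_cat Ha Hb.
Qed.

Lemma size_letters_filling w w' : w' \in fillings w -> size (letters w') = size (letters w).
Proof. by case/fillings_spec => <- _; rewrite letters_wmap size_map. Qed.

Lemma full_perm w w' : (size (letters w) <= n)%N -> w' \in fillings w -> full w' ->
  perm_eq (letters w') (iota 0 n).
Proof.
move=> sw w'w /allP fw; rewrite perm_sym.
have le : (size (letters w') <= size (iota 0 n))%N.
  by rewrite size_iota (size_letters_filling w'w).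
have [es eqm] := uniq_min_size (iota_uniq 0 n) fw le.
apply: uniq_perm => //; first exact: iota_uniq.
by rewrite -(eq_uniq es eqm) iota_uniq.
Qed.

Lemma fillings_letters w k : (forall j, (j < size (letters w))%N ->
    (k + j < n)%N /\ nth 0 l (k + j) = nth 0 (letters w) j) ->
  exists2 w', w' \in fillings w & letters w' = iota k (size (letters w)).
Proof.
elim: w k => [i|u IHu v IHv] k H /=.
  have [kn E] := H 0%N isT; rewrite addn0 /= in kn E.
  by exists (Var k) => //; rewrite map_f // mem_filter E eqxx mem_iota.
have [a au la] : exists2 w', w' \in fillings u & letters w' = iota k (size (letters u)).
  apply: IHu => j ju; have [|? ->] := H j; first by rewrite /= size_cat ltn_addr.
  by split=> //; rewrite nth_cat ju.
have [b bv lb] : exists2 w', w' \in fillings v &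
    letters w' = iota (k + size (letters u)) (size (letters v)).
  apply: IHv => j jv; have [|] := H (size (letters u) + j)%N.
    by rewrite /= size_cat ltn_add2l.
  by rewrite addnA => ? ->; split=> //; rewrite /= nth_cat ltnNge leq_addr addKn.
exists (Mul a b); first exact: allpairs_f.
by rewrite /= la lb size_cat iotaD.
Qed.

Section Substitution.

Variables (B : zmodType) (m : B -> B -> B).
Hypothesis mBl : forall x y z, m (x - y) z = m x z - m y z.
Hypothesis mBr : forall x y z, m z (x - y) = m z x - m z y.

Let m0l x : m 0 x = 0. Proof. by rewrite -(subrr 0) mBl !subrr. Qed.
Let m0r x : m x 0 = 0. Proof. by rewrite -(subrr 0) mBr !subrr. Qed.
Let mNl x y : m (- x) y = - m x y. Proof. by rewrite -sub0r mBl m0l sub0r. Qed.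
Let mNr x y : m x (- y) = - m x y. Proof. by rewrite -sub0r mBr m0r sub0r. Qed.
Let mDl x y z : m (x + y) z = m x z + m y z.
Proof. by rewrite -{1}[y]opprK mBl mNl opprK. Qed.
Let mDr x y z : m z (x + y) = m z x + m z y.
Proof. by rewrite -{1}[y]opprK mBr mNr opprK. Qed.

Definition partial_sum (y : nat -> B) (T : nat -> bool) (i : nat) : B :=
  \sum_(j <- iota 0 n | nth 0 l j == i) (if T j then y j else 0).

Lemma word_eval_partial y T w : word_eval m (partial_sum y T) w
  = \sum_(w' <- fillings w) (if all T (letters w') then word_eval m y w' else 0).
Proof.
elim: w => [i|u IHu v IHv] /=.
  by rewrite big_map big_filter; apply: eq_bigr => j _; rewrite /= andbT.
rewrite IHu IHv big_allpairs_dep.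
rewrite (big_morph (fun x => m x _) (fun a b => mDl a b _) (m0l _)); apply: eq_bigr => a _.
rewrite (big_morph (m _) (fun x y => mDr x y _) (m0r _)); apply: eq_bigr => b _ /=.
by rewrite all_cat; case: (all _ _) => //=; case: (all _ _).
Qed.

Lemma differences_word_eval y w T : differences n (fun T => word_eval m (partial_sum y T) w) T
  = \sum_(w' <- fillings w | full w') word_eval m y w'.
Proof.
rewrite (eq_differences _ _ (word_eval_partial y ^~ w)) differences_sum [RHS]big_mkcond.
apply: eq_big_seq => w' w'w; rewrite differences_indicator -/(full w').
have [_ H] := fillings_spec w'w.
by rewrite (sub_all _ H) ?andbT // => i ->.
Qed.

End Substitution.

Definition nfull (w : word) : nat := count full (fillings w).

(** In the commutative ring of integers, with every new variable equal to 1, the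
    polarised word takes as value the number of full fillings; and there the value of
    a word depends only on its letters up to order. *)
Lemma nfull_perm w1 w2 : perm_eq (letters w1) (letters w2) -> nfull w1 = nfull w2.
Proof.
have ev (s : nat -> int) w : word_eval *%R s w = \prod_(i <- letters w) s i.
  by elim: w => [i|u IHu v IHv] /=; [rewrite big_seq1 | rewrite big_cat IHu IHv].
have E w : (nfull w)%:R = differences n (fun T => \prod_(i <- letters w) partial_sum (fun=> 1) T i)
    (fun=> true) :> int.
  rewrite (eq_differences _ _ (fun T => esym (ev (partial_sum (fun=> 1) T) w))).
  rewrite (differences_word_eval (fun x y z : int => mulrBl z x y) (fun x y z => mulrBr z x y)).
  rewrite /nfull -sum1_count natr_sum; apply: eq_bigr => w' _.
  by rewrite ev big1.
move=> p; apply/eqP; rewrite -(eqr_nat int) !E; apply/eqP; apply: eq_differences => T.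
exact: perm_big.
Qed.

Lemma nfull_eq0 w : (size (letters w) <= n)%N -> ~~ perm_eq (letters w) l -> nfull w = 0%N.
Proof.
move=> sw np; apply/eqP; rewrite -leqn0 leqNgt -has_count; apply/hasP => -[w' w'w fw].
have p := full_perm sw w'w fw; case/negP: np.
have [<- _] := fillings_spec w'w; rewrite letters_wmap.
by apply: perm_trans (perm_map _ p) _; rewrite map_nth_iota0 // take_size perm_refl.
Qed.

Lemma nfull_gt0 w : letters w = l -> (0 < nfull w)%N.
Proof.
move=> wl; have [j jw|w' w'w lw'] := @fillings_letters w 0; first by rewrite add0n wl in jw *.
rewrite -has_count; apply/hasP; exists w' => //.
by rewrite /full lw' wl; apply/allP.
Qed.

Section Terms.

Variables (F : numFieldType) (B : lmodType F) (m : B -> B -> B).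
Hypothesis mBl : forall x y z, m (x - y) z = m x z - m y z.
Hypothesis mBr : forall x y z, m z (x - y) = m z x - m z y.

Definition polar (L : seq (F * word)) : seq (F * word) :=
  flatten [seq [seq (p.1, w') | w' <- fillings p.2 & full w'] | p <- L].

Lemma polar_differences L y : eval_terms m (polar L) y
  = differences n (fun T => eval_terms m L (partial_sum y T)) (fun=> true).
Proof.
rewrite differences_sum /eval_terms /polar big_flatten big_map; apply: eq_bigr => p _.
by rewrite differencesZ differences_word_eval // scaler_sumr big_map big_filter.
Qed.

(** Setting the new variables back to the old ones recovers the part of [L] with the
    letters [l], each word with the multiplicity [nfull]. *)
Lemma polar_restitution L s : all (fun p => size (letters p.2) <= n)%N L ->
  eval_terms m (polar L) (s \o nth 0%N l)
  = \sum_(p <- L | perm_eq (letters p.2) l) (p.1 *: word_eval m s p.2) *+ nfull p.2.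
Proof.
move/allP => H; rewrite /eval_terms /polar big_flatten big_map [RHS]big_mkcond.
apply: eq_big_seq => p pL; rewrite big_map big_filter.
transitivity ((p.1 *: word_eval m s p.2) *+ nfull p.2).
  rewrite /nfull -sum1_count -sumrMnr big_seq_cond [RHS]big_seq_cond.
  apply: eq_bigr => w' /andP [/fillings_spec [E _] _].
  by rewrite -word_eval_wmap E.
by case: ifPn => // np; rewrite nfull_eq0 ?H.
Qed.

End Terms.

End Fillings.

Section Reduction.

Variables (F : numFieldType) (A B : lmodType F) (mA : A -> A -> A) (mB : B -> B -> B).
Hypothesis mABl : forall x y z, mA (x - y) z = mA x z - mA y z.
Hypothesis mABr : forall x y z, mA z (x - y) = mA z x - mA z y.
Hypothesis mBBl : forall x y z, mB (x - y) z = mB x z - mB y z.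
Hypothesis mBBr : forall x y z, mB z (x - y) = mB z x - mB z y.
Variable d : nat.
Hypothesis multilinear_case : forall n L, (0 < n <= d)%N ->
  all (fun p : F * word => perm_eq (letters p.2) (iota 0 n)) L ->
  (forall s, eval_terms mA L s = 0) -> forall s, eval_terms mB L s = 0.

(** Let w0 be a word of maximal degree in [L].  Polarising along the letters of w0 gives
    a multilinear identity, and substituting them back gives a nonzero multiple
    of the part of [L] whose words have the letters of w0.  So this part vanishes on
    both algebras, and there remain fewer terms. *)
Theorem reduction_to_multilinear L : all (fun p : F * word => size (letters p.2) <= d)%N L ->
  (forall s, eval_terms mA L s = 0) -> forall s, eval_terms mB L s = 0.
Proof.
have [k] := ubnP (size L); elim: k L => // k IH L; rewrite ltnS => sL dL HA.
have [->|L0] := eqVneq L [::]; first by move=> s; rewrite /eval_terms big_nil.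
have [p0 p0L max] : exists2 p0, p0 \in L &
    all (fun p => size (letters p.2) <= size (letters p0.2))%N L.
  elim: L L0 {sL dL HA} => // p [|q L] IHL _; first by exists p; rewrite ?inE //= leqnn.
  have [//|p0 p0L max] := IHL; have [le|lt] := leqP (size (letters p.2)) (size (letters p0.2)).
    by exists p0; [rewrite inE p0L orbT | rewrite /= le].
  exists p; first by rewrite inE eqxx.
  by rewrite /= leqnn; apply: sub_all max => x /leq_trans -> //; apply: ltnW.
set l := letters p0.2 in max.
pose Q (p : F * word) := perm_eq (letters p.2) l.
have H2 (C : lmodType F) (m : C -> C -> C) s : eval_terms m L s
    = eval_terms m (filter Q L) s + eval_terms m (filter (predC Q) L) s.
  by rewrite /eval_terms (bigID Q) /= !big_filter.
(* All words of the part have the same number of full fillings as w0. *)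
have H1 (C : lmodType F) (m : C -> C -> C) s :
    (forall x y z, m (x - y) z = m x z - m y z) ->
    (forall x y z, m z (x - y) = m z x - m z y) ->
    eval_terms m (polar l L) (s \o nth 0%N l) = (nfull l p0.2)%:R *: eval_terms m (filter Q L) s.
  move=> mBl mBr; rewrite polar_restitution // /eval_terms big_filter scaler_sumr.
  by apply: eq_bigr => p pl; rewrite scaler_nat (nfull_perm l (w2 := p0.2)).
have c0 : (nfull l p0.2)%:R != 0 :> F by rewrite pnatr_eq0 -lt0n nfull_gt0.
have cancel (C : lmodType F) (x : C) : (nfull l p0.2)%:R *: x = 0 -> x = 0.
  by move/eqP; rewrite scaler_eq0 (negbTE c0) => /eqP.
have HpA y : eval_terms mA (polar l L) y = 0.
  by rewrite polar_differences // (eq_differences _ _ (fun T => HA _)) differences0.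
(* Full fillings of words of degree at most n are multilinear. *)
have HpB : forall y, eval_terms mB (polar l L) y = 0.
  apply: (multilinear_case (n := size l)) HpA.
    by rewrite size_letters_gt0 /=; apply: (allP dL).
  apply/allP => q /flattenP [? /mapP [p pL ->]] /mapP [w']; rewrite mem_filter => /andP [fw w'w] ->.
  exact: full_perm ((allP max) p pL) w'w fw.
have QA s : eval_terms mA (filter Q L) s = 0 by apply: cancel; rewrite -H1.
have QB s : eval_terms mB (filter Q L) s = 0 by apply: cancel; rewrite -H1.
move=> s; rewrite H2 QB add0r; apply: IH.
- apply: leq_trans sL; rewrite size_filter -(count_predC Q L) -[X in (X < _)%N]add0n ltn_add2r.
  by rewrite -has_count; apply/hasP; exists p0; rewrite ?/Q ?perm_refl.
- by apply/allP => p; rewrite mem_filter => /andP [_ /(allP dL)].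
- by move=> s'; have := HA s'; rewrite H2 QA add0r.
Qed.

End Reduction.

(** * Transfer from V(6) to other algebras *)

Section Projection.

Variables (F : numFieldType) (B C : lmodType F) (mB : B -> B -> B) (mul_anticomm : C -> C -> C).
Variable phi : {linear B -> C}.
Hypothesis phiM : forall x y, phi (mB x y) = mul_anticomm (phi x) (phi y).

Definition over (f : (nat -> B) -> B) (g : (nat -> C) -> C) : Prop :=
  forall s, phi (f s) = g (phi \o s).

Lemma over_hat w : over (hat mB w) (hat mul_anticomm w).
Proof. by rewrite /hat => s; elim: w => //= u IHu v IHv; rewrite phiM IHu IHv. Qed.

Lemma over_word_at S k : over (word_at mB S k) (word_at mul_anticomm S k).
Proof. by rewrite /word_at; case: ifP => _ s; [apply: over_hat | apply: linear0]. Qed.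

Lemma over_sym1 eps n j f g : over f g -> over (sym1 eps n j f) (sym1 eps n j g).
Proof.
move=> fg s; rewrite /sym1; case: ifP => // _.
rewrite -[LHS]/(phi (f s + signed (nth false eps j) (act (tau j) f) s)) linearD /= fg.
congr (_ + _); case: nth; rewrite /signed.
  by rewrite -[LHS]/(phi (- f (s \o tau j))) linearN /= fg.
exact: fg.
Qed.

Lemma over_sym eps n f g : over f g -> over (sym eps n f) (sym eps n g).
Proof. by move=> fg; do 3 apply: over_sym1. Qed.

Lemma over_terms L : over (eval_terms mB L) (eval_terms mul_anticomm L).
Proof.
move=> s; rewrite /eval_terms linear_sum; apply: eq_bigr => p _.
by rewrite linearZ /=; congr (_ *: _); apply: over_hat.
Qed.

End Projection.

Section Product.

Variables (F : numFieldType) (A C : lmodType F) (mA : A -> A -> A) (mul_anticomm : C -> C -> C).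

Definition pair_mul (x y : A * C) : A * C := (mA x.1 y.1, mul_anticomm x.2 y.2).

Lemma pair_satisfies R : satisfies mA R -> satisfies mul_anticomm R -> satisfies pair_mul R.
Proof.
move=> HA HC s; rewrite [RHS]surjective_pairing [LHS]surjective_pairing.
congr (_, _).
  rewrite -[RHS](HA (fst \o s)) {HA HC}; elim: R => //= -[b w] R /= <-; congr (_ + _).
  have E : (word_eval pair_mul s w).1 = word_eval mA (fst \o s) w.
    by elim: w => //= u -> v ->.
  by case: b; rewrite /= -E.
rewrite -[RHS](HC (snd \o s)) {HA HC}; elim: R => //= -[b w] R /= <-; congr (_ + _).
have E : (word_eval pair_mul s w).2 = word_eval mul_anticomm (snd \o s) w.
  by elim: w => //= u -> v ->.
by case: b; rewrite /= -E.
Qed.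

End Product.

(** All tuples of basis vectors are tried: 7^5 for k and 7^4 for the Malcev identity. *)
Lemma relK_holds : holds_on_basis relK 5.
Proof. by vm_cast_no_check (erefl true). Qed.

Lemma relJ_holds : holds_on_basis relJ 4.
Proof. by vm_cast_no_check (erefl true). Qed.

Section Transfer.

Variables (F : numFieldType) (A : lmodType F) (mul : {bilinear A -> A -> A}).
Variable alpha : {bilinear V6 F -> V6 F -> V6 F}.
Hypothesis alpha_alt : alternating alpha.
Hypothesis alpha_norm : V6_normalized alpha.
Hypotheses (mulA : satisfies mul relA) (mulJ : satisfies mul relJ) (mulK : satisfies mul relK).

Let B := (A * V6 F)%type.
Let mB : B -> B -> B := pair_mul mul alpha.

Let mBl x y z : mB (x - y) z = mB x z - mB y z.
Proof. by rewrite /mB /pair_mul /= !linearBl. Qed.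
Let mBr x y z : mB z (x - y) = mB z x - mB z y.
Proof. by rewrite /mB /pair_mul /= !linearBr. Qed.

Let mBA : satisfies mB relA.
Proof. exact/pair_satisfies/satA_alpha. Qed.
Let mBJ : satisfies mB relJ.
Proof. by apply: pair_satisfies => //; apply: (satisfies_basis alpha_alt alpha_norm _ relJ_holds). Qed.
Let mBK : satisfies mB relK.
Proof. by apply: pair_satisfies => //; apply: (satisfies_basis alpha_alt alpha_norm _ relK_holds). Qed.

Definition multilinear_terms (n : nat) (L : seq (F * word)) : bool :=
  all (fun p => perm_eq (letters p.2) (iota 0 n)) L.

Definition vanishing (n : nat) (L : seq (F * word)) : Prop :=
  multilinear_terms n L /\ forall s, eval_terms alpha L s = 0.

(** On the product of A and V(6) the symmetrised L is a combination of symmetrised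
    normal words.  Projecting to V(6), where L vanishes and these words are
    independent, shows that all coefficients are 0; then project to A. *)
Lemma sym_vanishes eps msk codes n L : certificate eps msk codes -> size codes = 7%N ->
  (0 < n <= 7)%N -> vanishing n L -> sym eps n (eval_terms mul L) = 0.
Proof.
rewrite /certificate; case E: (run eps msk) => [[tb N] msk'] /andP [cl ind] sc n17 [mL vL].
have n7 : (n <= 7)%N by case/andP: n17.
have [tb_ok N_ok] : state_ok mB eps (tb, N, msk').
  by rewrite -E; apply: run_ok.
have {}ind : independent eps N n (nth [::] codes n.-1).
  have i7 : (n.-1 < 7)%N by case/andP: n17; lia.
  have := allP ind (nth (0%N, [::]) (zip (iota 1 7) codes) n.-1).
  rewrite nth_zip ?size_iota // nth_iota // add1n prednK; last by case/andP: n17.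
  apply; have -> : (n, nth [::] codes n.-1) = nth (0%N, [::]) (zip (iota 1 7) codes) n.-1.
    rewrite nth_zip ?size_iota // nth_iota // add1n prednK //; by case/andP: n17.
  by apply: mem_nth; rewrite size_zip size_iota sc.
have uK : uniq (keys_of N (map letter_of (iota 0 n))) by case/andP: ind.
have sp w : good_slots (letters w) -> spanned mB eps N (letters w) (hat mB w).
  exact: (spanned_word mBl mBr mBA tb_ok N_ok cl).
have [c Ec] : combination mB eps n N (sym eps n (eval_terms mB L)).
  have [W0 WD WZ] := combination_subspace mB eps n N.
  elim: (L) mL => [|p L' IH] /=.
    rewrite (_ : eval_terms mB [::] = 0) ?sym0 //.
    by apply/funext => s; rewrite /eval_terms big_nil.
  move=> /andP [pw /IH CL'].
  rewrite (_ : eval_terms mB (p :: L') = p.1 *: hat mB p.2 + eval_terms mB L'); last first.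
    by apply/funext => s; rewrite /eval_terms big_cons.
  by rewrite symD symZ; apply: (WD _ _) CL'; apply: (WZ _ _); apply: sym_combination.
rewrite undup_id // in Ec.
pose p1 : {linear B -> A} := fst; pose p2 : {linear B -> V6 F} := snd.
have p1M x y : p1 (mB x y) = mul (p1 x) (p1 y) by [].
have p2M x y : p2 (mB x y) = alpha (p2 x) (p2 y) by [].
(* Assignments in V(6) are lifted with the component 0 in A, and conversely below. *)
have c0 k : k \in keys_of N (map letter_of (iota 0 n)) -> c k = 0.
  apply: (independent_ok alpha_alt alpha_norm n17 ind) => s.
  pose s' i : B := (0, s i).
  have E0 : p2 (sym eps n (eval_terms mB L) s') = 0.
    rewrite (over_sym eps n (over_terms p2M L)).
    by rewrite (_ : eval_terms alpha L = 0) ?sym0 //; apply/funext.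
  rewrite -[RHS]E0 Ec -[s]/(p2 \o s').
  rewrite fct_sumE linear_sum.
  apply: eq_bigr => k' _; rewrite -(over_sym eps n (over_word_at p2M _ _)).
  by rewrite -linearZ.
apply/funext => s; pose s' i : B := (s i, 0).
rewrite -[s]/(p1 \o s') -(over_sym eps n (over_terms p1M L)).
rewrite Ec big1_seq ?linear0 // => k /= kK; by rewrite c0 // scale0r.
Qed.

Lemma points_sizes : [/\ size points_fff = 7, size points_tff = 7, size points_ttf = 7
  & size points_ttt = 7]%N.
Proof. by []. Qed.

(** A sign pattern is killed if the corresponding component of every multilinear
    identity of V(6) in n variables is an identity of A. *)
Definition killed (n : nat) (eps : seq bool) : Prop :=
  forall L, vanishing n L -> sym eps n (eval_terms mul L) = 0.

(** The exchange of the pairs i and i+1 carries a sign pattern to the one with two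
    entries exchanged, and identities of V(6) to identities of V(6). *)
Definition rho (i x : nat) : nat :=
  if (i.*2 <= x < i.*2.+2)%N then x.+2 else
  if (i.*2.+2 <= x < i.*2.+4)%N then x.-2 else x.

Definition swap_pair (i j : nat) : nat :=
  if j == i then i.+1 else if j == i.+1 then i else j.

Lemma rhoK i : involutive (rho i).
Proof. by move=> x; rewrite /rho; repeat case: ifP; lia. Qed.

Lemma rho_tau i j x : rho i (tau j x) = tau (swap_pair i j) (rho i x).
Proof. by rewrite /rho /tau /swap_pair; repeat case: ifP; lia. Qed.

Lemma act_rho_tau (M : zmodType) i j (f : (nat -> M) -> M) :
  act (rho i) (act (tau j) f) = act (tau (swap_pair i j)) (act (rho i) f).
Proof.
apply/funext => s; rewrite /act; congr f; apply/funext => x /=.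
by rewrite rho_tau.
Qed.

Lemma act_rhoK (M : zmodType) i (f : (nat -> M) -> M) : act (rho i) (act (rho i) f) = f.
Proof. by apply/funext => s; rewrite /act; congr f; apply/funext => x /=; rewrite rhoK. Qed.

Lemma sym1_rho eps eps' n i j (f : (nat -> A) -> A) :
  nth false eps' (swap_pair i j) = nth false eps j -> (i.*2.+3 < n)%N ->
  act (rho i) (sym1 eps n j f) = sym1 eps' n (swap_pair i j) (act (rho i) f).
Proof.
move=> E i_n; rewrite /sym1 E.
have -> : ((swap_pair i j).*2.+1 < n)%N = (j.*2.+1 < n)%N.
  by rewrite /swap_pair; repeat case: ifP; lia.
by case: ifP => // _; rewrite actD act_signed act_rho_tau.
Qed.

Lemma rho_iota i n : (i.*2.+3 < n)%N -> perm_eq (map (rho i) (iota 0 n)) (iota 0 n).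
Proof.
move=> i_n; apply: uniq_perm.
- by rewrite (map_inj_uniq (inv_inj (rhoK i))) iota_uniq.
- exact: iota_uniq.
move=> x; rewrite mem_iota /= add0n; apply/mapP/idP => [[y]|x_n].
  by rewrite mem_iota /= => y_n ->; rewrite /rho; repeat case: ifP; lia.
exists (rho i x); last by rewrite rhoK.
by rewrite mem_iota /= /rho; repeat case: ifP; lia.
Qed.

Definition relabel (sigma : nat -> nat) (L : seq (F * word)) : seq (F * word) :=
  [seq (p.1, wmap sigma p.2) | p <- L].

Lemma eval_relabel (M : lmodType F) (m : M -> M -> M) sigma L :
  eval_terms m (relabel sigma L) = act sigma (eval_terms m L).
Proof.
apply/funext => s; rewrite /eval_terms big_map /act; apply: eq_bigr => p _ /=.
by rewrite word_eval_wmap.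
Qed.

Lemma vanishing_relabel i n L : (i.*2.+3 < n)%N -> vanishing n L -> vanishing n (relabel (rho i) L).
Proof.
move=> i_n [mL vL]; split; last by move=> s; rewrite eval_relabel; apply: vL.
rewrite /multilinear_terms all_map; apply: sub_all mL => p pw /=.
by rewrite letters_wmap; apply: perm_trans (perm_map _ pw) (rho_iota i_n).
Qed.

Lemma killed_swap0 n a b c : (3 < n)%N -> killed n [:: a; b; c] -> killed n [:: b; a; c].
Proof.
move=> n3 H L vL; have i_n : (0.*2.+3 < n)%N by [].
rewrite -(act_rhoK 0 (eval_terms mul L)) -eval_relabel.
have := congr1 (act (rho 0)) (H _ (vanishing_relabel i_n vL)); rewrite act0 /sym.
by do 3 rewrite (@sym1_rho _ [:: b; a; c]) //; rewrite /swap_pair /= (sym1C _ _ 1 0).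
Qed.

Lemma killed_swap1 n a b c : (5 < n)%N -> killed n [:: a; b; c] -> killed n [:: a; c; b].
Proof.
move=> n5 H L vL; have i_n : (1.*2.+3 < n)%N by [].
rewrite -(act_rhoK 1 (eval_terms mul L)) -eval_relabel.
have := congr1 (act (rho 1)) (H _ (vanishing_relabel i_n vL)); rewrite act0 /sym.
by do 3 rewrite (@sym1_rho _ [:: a; c; b]) //; rewrite /swap_pair /= (sym1C _ _ 2 1).
Qed.

Lemma killed_eq n eps eps' :
  (forall j, (j < 3)%N -> (j.*2.+1 < n)%N -> nth false eps j = nth false eps' j) ->
  killed n eps -> killed n eps'.
Proof.
move=> E H L /H; rewrite /sym.
have e j f : (j < 3)%N -> sym1 eps n j f = sym1 eps' n j f :> ((nat -> A) -> A).
  by move=> j3; rewrite /sym1; case: ifP => // jn; rewrite E.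
by rewrite !e.
Qed.

(** Only the pairs inside the n slots count, and exchanges of pairs sort the signs. *)
Lemma killed_all n a b c : (0 < n <= 7)%N -> killed n [:: a; b; c].
Proof.
move=> n17; have [s0 s1 s2 s3] := points_sizes.
have fff : killed n [:: false; false; false] := fun L => sym_vanishes certificate_fff s0 n17.
have tff : killed n [:: true; false; false] := fun L => sym_vanishes certificate_tff s1 n17.
have ttf : killed n [:: true; true; false] := fun L => sym_vanishes certificate_ttf s2 n17.
have ttt : killed n [:: true; true; true] := fun L => sym_vanishes certificate_ttt s3 n17.
(* At most one pair lies inside the slots. *)
have [n3|n3] := leqP n 3.
  by case: a; [apply: killed_eq tff|apply: killed_eq fff] => -[|[|[]]] //=; lia.
have ftf : killed n [:: false; true; false] by apply: killed_swap0.
(* Exactly two pairs lie inside the slots. *)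
have [n5|n5] := leqP n 5.
  by case: a; case: b; [apply: killed_eq ttf|apply: killed_eq tff|
    apply: killed_eq ftf|apply: killed_eq fff] => -[|[|[]]] //=; lia.
have tft : killed n [:: true; false; true] by apply: killed_swap1.
have fft : killed n [:: false; false; true] by apply: killed_swap1.
have ftt : killed n [:: false; true; true] by apply: killed_swap0.
by case: a; case: b; case: c.
Qed.

(** A function is half the sum of its symmetric and skew parts. *)
Lemma sym1_both eps eps' n j (f : (nat -> A) -> A) :
  nth false eps j = ~~ nth false eps' j -> sym1 eps n j f = 0 -> sym1 eps' n j f = 0 -> f = 0.
Proof.
have two (g : (nat -> A) -> A) : g + g = 0 -> g = 0.
  move=> E; have : (2 : F) *: g = 0 by rewrite scaler_nat mulr2n.
  by move/eqP; rewrite scaler_eq0 pnatr_eq0 => /eqP.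
move=> E; rewrite /sym1 E; case: ifP => // _ E1 E2; apply: two.
have := congr2 +%R E1 E2; rewrite addr0 addrACA.
by case: nth; rewrite /signed /= ?subrr ?addNr addr0.
Qed.

Theorem multilinear_transfer n L : (0 < n <= 7)%N -> vanishing n L ->
  forall s, eval_terms mul L s = 0.
Proof.
move=> n17 vL s; set f := eval_terms mul L; suff -> : f = 0 by [].
have H a b c : sym1 [:: a] n 0 (sym1 [:: a; b] n 1 (sym1 [:: a; b; c] n 2 f)) = 0.
  exact: (@killed_all n a b c).
have e1 a b (g : (nat -> A) -> A) : sym1 [:: a; b] n 1 g = sym1 [:: false; b] n 1 g by [].
have e2 a b c (g : (nat -> A) -> A) :
  sym1 [:: a; b; c] n 2 g = sym1 [:: false; false; c] n 2 g by [].
have H1 b c : sym1 [:: false; b] n 1 (sym1 [:: false; false; c] n 2 f) = 0.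
  have H' a : sym1 [:: a] n 0 (sym1 [:: false; b] n 1 (sym1 [:: false; false; c] n 2 f)) = 0.
    by rewrite -(e1 a) -(e2 a b); apply: H.
  exact: (@sym1_both [:: true] [:: false] n 0).
have H2 c : sym1 [:: false; false; c] n 2 f = 0.
  by apply: (@sym1_both [:: false; true] [:: false; false] n 1); rewrite ?H1.
by apply: (@sym1_both [:: false; false; true] [:: false; false; false] n 2); rewrite ?H2.
Qed.

End Transfer.

(** * Identities of degree at most 7 *)

Lemma size_letters w : size (letters w) = word_degree w.
Proof. by elim: w => //= u <- v <-; rewrite size_cat. Qed.

Section Identities.

Variables (F : numFieldType) (A : lmodType F) (mul : A -> A -> A).

Lemma anticomm_satisfies : identity_of mul (anticomm_id F) -> satisfies mul relA.
Proof. by move/anticomm_idP => H s /=; rewrite addr0; apply: H. Qed.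

Lemma malcev_satisfies : identity_of mul (malcev_id F) -> satisfies mul relJ.
Proof.
by move/malcev_idP => H s; rewrite -[RHS](H (s 0%N) (s 1%N) (s 2%N) (s 3%N)) /= addr0 !addrA.
Qed.

Lemma k_satisfies : identity_of mul (k_id F) -> satisfies mul relK.
Proof.
by move/k_idP => H s; rewrite -[RHS](H (s 0%N) (s 1%N) (s 2%N) (s 3%N) (s 4%N)) /= addr0 !addrA.
Qed.

Lemma napoly_eval_terms (f : napoly F) s :
  napoly_eval mul s f = eval_terms mul [seq (f@_w, w) | w <- msupp f] s.
Proof. by rewrite /eval_terms big_map. Qed.

End Identities.

Theorem theorem4p7 (R : realType)
    (alpha : {bilinear V6 R[i] -> V6 R[i] -> V6 R[i]})
    (alpha_alt : alternating alpha)
    (alpha_sl2 : sl2_morphism alpha)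
    (alpha_norm : V6_normalized alpha)
    (f : napoly R[i])
    (f_deg : (napoly_degree f <= 7)%N)
    (f_id : identity_of alpha f) :
  consequence
    (fun g => [\/ g = anticomm_id R[i], g = malcev_id R[i] | g = k_id R[i]]) f.
Proof.
move=> A mul H s; rewrite napoly_eval_terms.
have mulA := anticomm_satisfies (H _ (Or31 _ _ erefl)).
have mulJ := malcev_satisfies (H _ (Or32 _ _ erefl)).
have mulK := k_satisfies (H _ (Or33 _ _ erefl)).
apply: (@reduction_to_multilinear R[i] (V6 R[i]) A alpha mul _ _ _ _ 7);
  try by [move=> *; rewrite linearBl | move=> *; rewrite linearBr].
- move=> n L n7 mL vL.
  exact: (@multilinear_transfer R[i] A mul alpha alpha_alt alpha_norm mulA mulJ mulK n L n7 (conj mL vL)).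
- apply/allP => p /mapP [w wf ->] /=; rewrite size_letters.
  by apply: leq_trans f_deg; apply: leq_bigmax_seq.
- by move=> s'; rewrite -napoly_eval_terms.
Qed.
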